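(* Let $k\geq 2$ be an integer and $i$ an integer satisfying $0\leq i\leq 2k$. Put $$\alpha_k=\frac{-4k}{(2^{2k}-1)(3^{2k}-1)B_{2k}}.$$ Then $$\varphi^{4k-2i}(z)\,\varphi^{2i}(3z)= \sum_{r\mid 12} b_{(r,i,k)}\, E_{2k}(rz) + \sum_{1\leq j\leq 4k-5} a_{(j,i,k)}\, C_{j,2k}(z),$$ where $r$ runs over the positive divisors $1,2,3,4,6,12$ of $12$, \begin{align*} b_{(1,i,k)}&=(-1)^{k}\,(3^{2k-i}+(-1)^{i+1})\,\alpha_k,\\ b_{(2,i,k)}&=(-1)^{i+1}(1+(-1)^{i+k})(3^{2k-i}+(-1)^{i+1})\,\alpha_k,\\ b_{(3,i,k)}&=(-1)^{i+k}\,3^{2k-i}(3^{i}+(-1)^{i+1})\,\alpha_k,\\ b_{(4,i,k)}&=(-1)^{i}\,2^{2k}(3^{2k-i}+(-1)^{i+1})\,\alpha_k,\\ b_{(6,i,k)}&=-(1+(-1)^{i+k})\,3^{2k-i}(3^{i}+(-1)^{i+1})\,\alpha_k,\\ b_{(12,i,k)}&=2^{2k}\,3^{2k-i}(3^{i}+(-1)^{i+1})\,\alpha_k, \end{align*} and, for $1\leq j\leq 4k-5$, recursively $$a_{(j,i,k)}= N(1^{4k-2i},3^{2i};j) - \sum_{r\mid 12} b_{(r,i,k)}\,\sigma_{2k-1}(j/r) - \sum_{1\leq l\leq j-1} a_{(l,i,k)}\, c_{l,2k}(j).$$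
   Context: Here $z\in\mathbb{H}=\{z\in\mathbb{C}:\mathrm{Im}(z)>0\}$ and $q=e^{2\pi i z}$ (in $e^{2\pi i z}$, $i$ is the imaginary unit; elsewhere $i$ is the integer parameter). Ramanujan's theta function is $\varphi(z)=\sum_{n=-\infty}^{\infty} q^{n^2}$. $N(1^{4k-2i},3^{2i};n)$ is the number of $(x_1,\ldots,x_{4k})\in\mathbb{Z}^{4k}$ with $n = x_1^2+\cdots+x_{4k-2i}^2+3x_{4k-2i+1}^2+\cdots+3x_{4k}^2$. The Bernoulli numbers $B_n$ are defined by $\frac{x}{e^x-1}=\sum_{n=0}^\infty\frac{B_nx^n}{n!}$. For positive integers $m,n$, $\sigma_m(n)=\sum_{d\mid n,\,d\geq1} d^m$, and $\sigma_m(n)=0$ if $n$ is not a positive integer. The Eisenstein series is $E_{2k}(z)=-\frac{B_{2k}}{4k}+\sum_{n=1}^\infty\sigma_{2k-1}(n)q^n$. The Dedekind eta function is $\eta(z)=e^{\pi i z/12}\prod_{n=1}^\infty(1-e^{2\pi i n z})$. For integers $j,k$ define $$C_{j,k}(z)= \Big(\frac{\eta^{10}(2z)\, \eta^{5}(3z)\, \eta(4z)\, \eta^{2}(6z)}{\eta^{15}(z)\, \eta^{3}(12z)}\Big)\Big(\frac{\eta^{2}(2z)\, \eta(3z)\, \eta^{3}(12z)}{\eta^{3}(z)\, \eta(4z)\, \eta^{2}(6z)}\Big)^{j}\Big(\frac{\eta^{6}(z)\,\eta(6z)}{\eta^{3}(2z)\, \eta^{2}(3z)}\Big)^{k},$$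 and let $c_{j,k}(n)$ denote the coefficient of $q^n$ in its $q$-expansion, which has the form $C_{j,k}(z)=q^j+\sum_{n=j+1}^\infty c_{j,k}(n)q^n$. (The statement uses $C_{j,2k}$ and $c_{j,2k}$, i.e. the second index is replaced by $2k$.) *)

(* Defs.v *)
From HB Require Import structures.
From mathcomp Require Import all_boot all_order all_algebra.
From mathcomp Require Import complex.
From mathcomp Require Import finmap.
From mathcomp Require Import all_classical all_reals all_analysis.

Set Implicit Arguments.
Unset Strict Implicit.
Unset Printing Implicit Defensive.

Import Order.TTheory GRing.Theory Num.Theory.
Import numFieldNormedType.Exports.

#[global] Open Scope classical_set_scope.
#[global] Open Scope ring_scope.
#[global] Open Scope complex_scope.

(* The topology of R[i] given by the modulus, as for any numFieldType. *)
HB.instance Definition _ (R : rcfType) := NormedModule.copy R[i] R[i]^o.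

Definition upper_half_plane (R : realType) : set R[i] :=
  [set z | 0 < complex.Im z].
Arguments upper_half_plane : clear implicits.

Definition expC (R : realType) (z : R[i]) : R[i] :=
  (expR (complex.Re z))%:C * (cos (complex.Im z) +i* sin (complex.Im z)).

Definition nome (R : realType) (z : R[i]) : R[i] :=
  expC ((2 * pi)%:C * 'i * z).

(* The sum over all integers is absolutely convergent on the upper half-plane;
   it is taken as the limit of the sums over the integers m with |m| <= N,
   enumerated as m = n - N for 0 <= n <= 2 N. *)
Definition theta (R : realType) (z : R[i]) : R[i] :=
  limn (fun N : nat =>
    \sum_(0 <= n < (2 * N).+1) nome z ^ ((n%:Z - N%:Z) ^+ 2)).

Definition dedekind_eta (R : realType) (z : R[i]) : R[i] :=
  expC ((pi / 12)%:C * 'i * z) *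
  limn (fun N : nat =>
    \prod_(1 <= n < N.+1) (1 - expC ((2 * pi)%:C * 'i * n%:R * z))).

(* N(1^s, 3^t; n). The set is finite, so that fset_set is faithful. *)
Definition nb_repr (s t n : nat) : nat :=
  #|` fset_set [set x : {ffun 'I_(s + t) -> int} |
      n%:Z = (\sum_(l < s) x (lshift t l) ^+ 2
              + \sum_(l < t) 3 * x (rshift s l) ^+ 2)%R]|.

Definition is_bernoulli (R : realType) (B : nat -> R) : Prop :=
  \forall x \near 0^',
    (series (fun n => B n * x ^+ n / n`!%:R) : nat -> R) @ \oo
      --> x / (expR x - 1).

Definition bernoulli_number (R : realType) : nat -> R :=
  xget (fun=> 0) (@is_bernoulli R).
Arguments bernoulli_number : clear implicits.

(* The argument is rational, so that sigma m (j / r) makes sense; the value is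
   0 unless x is a positive integer (divisors 0 is empty). *)
Definition sigma (m : nat) (x : rat) : nat :=
  if x \is a Num.nat then (\sum_(d <- divisors (Num.truncn x)) d ^ m)%N else 0%N.

(* [eisenstein k] is the series of weight 2k. *)
Definition eisenstein (R : realType) (k : nat) (z : R[i]) : R[i] :=
  (- (bernoulli_number R (2 * k) / (4 * k)%:R))%:C +
  limn (fun N : nat =>
    \sum_(1 <= n < N.+1) (sigma (2 * k - 1) n%:R)%:R * nome z ^+ n).

Definition etaC (R : realType) (j k : int) (z : R[i]) : R[i] :=
  let e (r : nat) : R[i] := dedekind_eta (r%:R * z) in
  (e 2 ^+ 10 * e 3 ^+ 5 * e 4 * e 6 ^+ 2 / (e 1 ^+ 15 * e 12 ^+ 3))
  * (e 2 ^+ 2 * e 3 * e 12 ^+ 3 / (e 1 ^+ 3 * e 4 * e 6 ^+ 2)) ^ j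
  * (e 1 ^+ 6 * e 6 / (e 2 ^+ 3 * e 3 ^+ 2)) ^ k.

Definition is_qexpansion (R : realType) (f : R[i] -> R[i]) (c : nat -> R[i]) :
    Prop :=
  forall z, upper_half_plane R z ->
    (series (fun n => c n * nome z ^+ n) : nat -> R[i]) @ \oo --> f z.

(* The n-th coefficient of the (unique) expansion of f in nonnegative powers
   of q; a dummy value if f has no such expansion. *)
Definition qcoef (R : realType) (f : R[i] -> R[i]) : nat -> R[i] :=
  xget (fun=> 0) (is_qexpansion f).

Definition etaC_coef (R : realType) (j k n : nat) : R[i] :=
  qcoef (@etaC R j%:Z k%:Z) n.
Arguments etaC_coef : clear implicits.

Definition alpha (R : realType) (k : nat) : R :=
  - (4 * k)%:R /
  ((2 ^+ (2 * k) - 1) * (3 ^+ (2 * k) - 1) * bernoulli_number R (2 * k)).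
Arguments alpha : clear implicits.

Definition bcoef (R : realType) (r i k : nat) : R :=
  let s : R := (-1) ^+ (i + 1) in
  let t : R := 1 + (-1) ^+ (i + k) in
  match r with
  | 1 => (-1) ^+ k * (3 ^+ (2 * k - i) + s) * alpha R k
  | 2 => s * t * (3 ^+ (2 * k - i) + s) * alpha R k
  | 3 => (-1) ^+ (i + k) * 3 ^+ (2 * k - i) * (3 ^+ i + s) * alpha R k
  | 4 => (-1) ^+ i * 2 ^+ (2 * k) * (3 ^+ (2 * k - i) + s) * alpha R k
  | 6 => - t * 3 ^+ (2 * k - i) * (3 ^+ i + s) * alpha R k
  | 12 => 2 ^+ (2 * k) * 3 ^+ (2 * k - i) * (3 ^+ i + s) * alpha R k
  | _ => 0
  end.
Arguments bcoef : clear implicits.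

(* Main.v *)
From HB Require Import structures.
Require Import Defs.
From mathcomp Require Import all_boot all_order all_algebra.
From mathcomp Require Import complex finmap.
From mathcomp Require Import all_classical all_reals all_analysis.
From mathcomp Require Import zify ring lra.
Import Order.TTheory GRing.Theory Num.Theory.
Import numFieldNormedType.Exports.

Set Implicit Arguments.
Unset Strict Implicit.
Unset Printing Implicit Defensive.

(* Work with formal power series in q. The logarithmic derivatives of the eta
   quotients of level 12 are combinations of the E_2(rz), r | 12; in terms of a
   Hauptmodul t and a form W of weight one these, E_4(rz) and E_6(rz) are W^k
   times explicit polynomials in t, because both sides solve Ramanujan's
   differential system and its only resonance is settled by the discriminant.
   Skoruppa-type identities for convolutions of divisor sums give
   the recursion of the Weierstrass function, hence E_2k(rz) is W^(2k) times a
   polynomial of degree at most 4k in t, whose values at the six cusps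
   t = 0, -1/2, -1/3, -1/4, -1/6, oo follow from the recursion. The product of
   theta series is of the same kind, by Gauss's product. The b_(r,i,k) make the
   two sides agree at all cusps, so that the difference is W^(2k) times
   R(t) = (1+2t)(1+3t)(1+4t)(1+6t) times a combination of t^j,
   1 <= j <= 4k-5, and C_(j,2k) = t^j R(t) W^(2k) = q^j + ... makes the
   coefficients satisfy the recursion of the a_(j,i,k). *)
(** * Formal power series *)

(** Neither transformation laws nor a dimension formula is used, so no identity between modular
    forms can be settled by comparing finitely many coefficients. Differential equations replace
    them: up to resonances, a solution is pinned down by its constant terms. Hence [t], [W] and L =
    DW/W, with D = q d/dq, are built as the formal solution of an autonomous system and recognised
    as eta quotients only later, by logarithmic derivatives. The quasimodular L is common to the six
    r: r E_2(q^r)/12 - L is W^2 times a polynomial in t. A form of weight M is encoded as W^M Q(t)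
    with deg Q <= 2M, a section of O(2M) on the projective line; its value at a cusp is a value of Q
    or its top coefficient, and these values are multiplicative. At a cusp E_4^3 = E_6^2, so E_4 and
    E_6 have values rho^2 and rho^3 there, and the recursion passes rho^k on to weight 2k. The
    choice of the b_(r,i,k) thus becomes a linear system at six points, in which alpha_k cancels
    both the constant term -B_2k/(4k) and the factor (2^2k - 1)(3^2k - 1). *)

Record fps (K : Type) := Fps { coefs :> nat -> K }.

Lemma fpsP (K : Type) (f g : fps K) : (forall n, f n = g n) -> f = g.
Proof. by case: f g => [f] [g] /= /funext ->. Qed.

HB.instance Definition _ (K : Type) := gen_eqMixin (fps K).
HB.instance Definition _ (K : Type) := gen_choiceMixin (fps K).

Section FpsRing.
Variable K : comNzRingType.
Implicit Types f g h : fps K.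

Definition fps_zero : fps K := Fps (fun=> 0).
Definition fps_one : fps K := Fps (fun n => (n == 0)%:R).
Definition fps_opp f := Fps (fun n => - f n).
Definition fps_add f g := Fps (fun n => f n + g n).
Definition fps_mul f g := Fps (fun n => \sum_(i < n.+1) f i * g (n - i)%N).

(** Coefficients up to n of a Cauchy product only see truncations, so the ring laws are inherited
    from polynomials. *)
Let tr n f : {poly K} := \poly_(i < n.+1) f i.

Let coef_tr n f m : (m <= n)%N -> (tr n f)`_m = f m.
Proof. by move=> le_mn; rewrite coef_poly ltnS le_mn. Qed.

Let coef_trM n f g m : (m <= n)%N -> fps_mul f g m = (tr n f * tr n g)`_m.
Proof.
move=> le_mn; rewrite coefM; apply: eq_bigr => -[i /= le_im] _.
by rewrite !coef_tr // (leq_trans _ le_mn) ?leq_subr.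
Qed.

Lemma fps_addA : associative fps_add.
Proof. by move=> f g h; apply: fpsP => n /=; rewrite addrA. Qed.
Lemma fps_addC : commutative fps_add.
Proof. by move=> f g; apply: fpsP => n /=; rewrite addrC. Qed.
Lemma fps_add0 : left_id fps_zero fps_add.
Proof. by move=> f; apply: fpsP => n /=; rewrite add0r. Qed.
Lemma fps_addN : left_inverse fps_zero fps_opp fps_add.
Proof. by move=> f; apply: fpsP => n /=; rewrite addNr. Qed.

Lemma fps_mulC : commutative fps_mul.
Proof. by move=> f g; apply: fpsP => n; rewrite !(@coef_trM n) // mulrC. Qed.

Lemma fps_mulA : associative fps_mul.
Proof.
move=> f g h; apply: fpsP => n.
transitivity (tr n f * tr n g * tr n h)`_n; last first.
  rewrite coefM -[RHS]/(\sum_(i < n.+1) fps_mul f g i * h (n - i)%N).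
  by apply: eq_bigr => -[i le_in] _; rewrite (@coef_trM n) // coef_tr ?leq_subr.
rewrite -mulrA coefM -[LHS]/(\sum_(i < n.+1) f i * fps_mul g h (n - i)%N).
by apply: eq_bigr => -[i le_in] _; rewrite (@coef_trM n) ?leq_subr // coef_tr.
Qed.

Lemma fps_mul1 : left_id fps_one fps_mul.
Proof.
move=> f; apply: fpsP => n /=; rewrite big_ord_recl /= mul1r subn0 big1 ?addr0 //.
by move=> i _; rewrite mul0r.
Qed.

Lemma fps_mulDl : left_distributive fps_mul fps_add.
Proof.
move=> f g h; apply: fpsP => n /=; rewrite -big_split /=.
by apply: eq_bigr => i _; rewrite mulrDl.
Qed.

Lemma fps_one_neq0 : fps_one != fps_zero.
Proof. by apply/eqP => /(congr1 (fun f : fps K => f 0%N)) /= /eqP; rewrite oner_eq0. Qed.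

HB.instance Definition _ := GRing.isZmodule.Build (fps K)
  fps_addA fps_addC fps_add0 fps_addN.
HB.instance Definition _ := GRing.Zmodule_isComNzRing.Build (fps K)
  fps_mulA fps_mulC fps_mul1 fps_mulDl fps_one_neq0.

Lemma fps0E n : (0 : fps K) n = 0. Proof. by []. Qed.
Lemma fps1E n : (1 : fps K) n = (n == 0%N)%:R. Proof. by []. Qed.
Lemma fpsNE f n : (- f) n = - f n. Proof. by []. Qed.
Lemma fpsDE f g n : (f + g) n = f n + g n. Proof. by []. Qed.
Lemma fpsBE f g n : (f - g) n = f n - g n. Proof. by []. Qed.
Lemma fpsME f g n : (f * g) n = \sum_(i < n.+1) f i * g (n - i)%N.
Proof. by []. Qed.
Lemma fpsM0E f g : (f * g) 0%N = f 0%N * g 0%N.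
Proof. by rewrite fpsME big_ord1. Qed.
Lemma fpsX0E f n : (f ^+ n) 0%N = f 0%N ^+ n.
Proof. by elim: n => [|n IH]; rewrite ?exprS ?fpsM0E ?IH. Qed.
Lemma fps_sumE I (r : seq I) (P : pred I) (F : I -> fps K) n :
  (\sum_(i <- r | P i) F i) n = \sum_(i <- r | P i) F i n.
Proof. by elim/big_rec2: _ => //= i x y _ <-. Qed.

Definition fpsC (c : K) : fps K := Fps (fun n => if n is 0 then c else 0).

Lemma fpsCE c n : fpsC c n = if n is 0 then c else 0. Proof. by []. Qed.

Lemma fpsC_mulE c f n : (fpsC c * f) n = c * f n.
Proof.
rewrite fpsME big_ord_recl /= subn0 big1 ?addr0 // => i _; exact: mul0r.
Qed.

Fact fpsC_is_zmod_morphism : zmod_morphism fpsC.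
Proof. by move=> a b; apply: fpsP => -[|n]; rewrite fpsBE /= ?subr0. Qed.
Fact fpsC_is_monoid_morphism : monoid_morphism fpsC.
Proof.
split; first by apply: fpsP => -[|n].
by move=> a b; apply: fpsP => -[|n]; rewrite fpsC_mulE //= mulr0.
Qed.
HB.instance Definition _ := GRing.isZmodMorphism.Build K (fps K) fpsC
  fpsC_is_zmod_morphism.
HB.instance Definition _ := GRing.isMonoidMorphism.Build K (fps K) fpsC
  fpsC_is_monoid_morphism.

Lemma fps_natE m n : (m%:R : fps K) n = if n is 0 then m%:R else 0.
Proof. by rewrite -(rmorph_nat fpsC). Qed.

Lemma fps_natME m f n : (m%:R * f) n = m%:R * f n.
Proof. by rewrite -(rmorph_nat fpsC) fpsC_mulE. Qed.

Definition fpsX : fps K := Fps (fun n => (n == 1)%:R).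

Lemma fpsX_mulE f n : (fpsX * f) n = if n is n'.+1 then f n' else 0.
Proof.
case: n => [|n]; rewrite fpsME ?big_ord1 ?mul0r // big_ord_recl mul0r add0r.
rewrite big_ord_recl /= mul1r subSS subn0 big1 ?addr0 // => i _; exact: mul0r.
Qed.

Lemma fpsXnE m n : (fpsX ^+ m) n = (n == m)%:R.
Proof.
elim: m n => [|m IH] n; first by rewrite expr0.
by rewrite exprS fpsX_mulE; case: n => [|n] //; rewrite IH eqSS.
Qed.

Lemma fpsXn_mulE m f n : (fpsX ^+ m * f) n = if (m <= n)%N then f (n - m)%N else 0.
Proof.
elim: m n => [|m IH] n; first by rewrite expr0 mul1r subn0.
by rewrite exprS -mulrA fpsX_mulE; case: n => [|n] //; rewrite IH ltnS subSS.
Qed.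

Definition fpsD f : fps K := Fps (fun n => n%:R * f n).

Lemma fpsDerE f n : fpsD f n = n%:R * f n. Proof. by []. Qed.

Fact fpsD_is_zmod_morphism : zmod_morphism fpsD.
Proof. by move=> f g; apply: fpsP => n; rewrite /= mulrBr. Qed.
HB.instance Definition _ := GRing.isZmodMorphism.Build (fps K) (fps K) fpsD
  fpsD_is_zmod_morphism.

Lemma fpsDM f g : fpsD (f * g) = fpsD f * g + f * fpsD g.
Proof.
apply: fpsP => n; rewrite fpsDE !fpsME /= mulr_sumr -big_split /=.
apply: eq_bigr => -[i /= le_in] _.
by rewrite -{1}(subnKC (le_in : (i <= n)%N)) natrD; ring.
Qed.

Lemma fpsDC c : fpsD (fpsC c) = 0.
Proof. by apply: fpsP => -[|n]; rewrite /= (mul0r, mulr0). Qed.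

Lemma fpsD_nat m : fpsD m%:R = 0.
Proof. by rewrite -(rmorph_nat fpsC) fpsDC. Qed.

Lemma fpsD1 : fpsD 1 = 0. Proof. exact: (fpsD_nat 1). Qed.

Lemma fpsDX : fpsD fpsX = fpsX.
Proof. by apply: fpsP => n /=; case: eqP => [->|_]; rewrite (mulr1, mulr0). Qed.

Lemma fpsDXn f n : fpsD (f ^+ n) = n%:R * f ^+ n.-1 * fpsD f.
Proof.
elim: n => [|n IH]; first by rewrite expr0 fpsD1 !mul0r.
rewrite exprS fpsDM IH; case: n {IH} => [|n] /=; first by ring.
by rewrite exprS -[n.+2%:R]natr1; ring.
Qed.

(* Congruence modulo [q ^ n]. *)
Definition eqfps n f g := forall m, (m < n)%N -> f m = g m.

Lemma eqfps_refl n f : eqfps n f f. Proof. by []. Qed.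
Lemma eqfps_sym n f g : eqfps n f g -> eqfps n g f.
Proof. by move=> e m /e. Qed.
Lemma eqfps_trans n g f h : eqfps n f g -> eqfps n g h -> eqfps n f h.
Proof. by move=> e1 e2 m lt_mn; rewrite e1 ?e2. Qed.
Lemma eqfps_all f g : (forall n, eqfps n f g) -> f = g.
Proof. by move=> e; apply: fpsP => n; apply: (e n.+1). Qed.
Lemma eqfpsD n f f' g g' :
  eqfps n f f' -> eqfps n g g' -> eqfps n (f + g) (f' + g').
Proof. by move=> e1 e2 m lt; rewrite !fpsDE e1 ?e2. Qed.
Lemma eqfpsN n f f' : eqfps n f f' -> eqfps n (- f) (- f').
Proof. by move=> e m lt; rewrite !fpsNE e. Qed.
Lemma eqfpsM n f f' g g' :
  eqfps n f f' -> eqfps n g g' -> eqfps n (f * g) (f' * g').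
Proof.
move=> e1 e2 m lt; rewrite !fpsME; apply: eq_bigr => -[i /= le_im] _.
by rewrite e1 ?e2 ?(leq_ltn_trans _ lt) ?leq_subr.
Qed.
Lemma eqfpsX n f f' m : eqfps n f f' -> eqfps n (f ^+ m) (f' ^+ m).
Proof.
by move=> e; elim: m => [|m IH] //; rewrite !exprS; apply: eqfpsM.
Qed.
Lemma eqfpsXM n f f' : eqfps n f f' -> eqfps n.+1 (fpsX * f) (fpsX * f').
Proof. by move=> e [|m] lt; rewrite !fpsX_mulE // e. Qed.

Lemma eqfps_mull0 n f g : eqfps n f 0 -> eqfps n (f * g) 0.
Proof. by move=> e; rewrite -(mul0r g); apply: eqfpsM. Qed.

(* Substitution of [q ^ r] for [q]; using [r.-1.+1] instead of [r] makes it a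
   ring morphism for every [r]. *)
Definition fps_subst r f : fps K :=
  Fps (fun n => if (r.-1.+1 %| n)%N then f (n %/ r.-1.+1)%N else 0).

End FpsRing.

Arguments fpsC {K} c.
Arguments fpsX {K}.

Section Subst.
Variables (K : comNzRingType) (r : nat).
Implicit Types f g : fps K.

Lemma fps_substE f n : (0 < r)%N ->
  fps_subst r f n = if (r %| n)%N then f (n %/ r)%N else 0.
Proof. by move=> r_gt0; rewrite /= prednK. Qed.

Fact fps_subst_is_zmod_morphism : zmod_morphism (@fps_subst K r).
Proof.
by move=> f g; apply: fpsP => n /=; case: ifP => // _; rewrite subr0.
Qed.

Lemma fps_substM f g : fps_subst r (f * g) = fps_subst r f * fps_subst r g.
Proof.
apply: fpsP => n; rewrite fpsME /=.
move: r.-1.+1 (ltn0Sn r.-1) => d d_gt0; case: ifP => [/dvdnP[m ->]|ndvd]; last first.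
  rewrite big1 // => -[i /= le_in] _; case: ifP => [dvd_i|]; last by rewrite mul0r.
  by rewrite dvdn_subl // ndvd mulr0.
rewrite mulnK // -(big_mkord xpredT (fun i => f i * g (m - i)%N)).
rewrite -(big_mkord xpredT (fun i => (if (d %| i)%N then f (i %/ d)%N else 0) *
   (if (d %| m * d - i)%N then g ((m * d - i) %/ d)%N else 0))).
rewrite [RHS](bigID (fun i => d %| i)%N) /= [X in _ + X]big1 ?addr0; last first.
  by move=> i /negPf ->; rewrite mul0r.
rewrite -[RHS]big_filter.
have pe : perm_eq [seq i <- index_iota 0 (m * d).+1 | (d %| i)%N]
                  [seq (i * d)%N | i <- index_iota 0 m.+1].
  apply: uniq_perm; first by rewrite filter_uniq // iota_uniq.
    rewrite map_inj_uniq ?iota_uniq // => i j /eqP.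
    by rewrite eqn_pmul2r // => /eqP.
  move=> i; rewrite mem_filter mem_index_iota leq0n ltnS.
  apply/andP/mapP => [[/dvdnP[j ->] le_jm]|[j]].
    by exists j => //; rewrite mem_index_iota /= ltnS -(leq_pmul2r d_gt0).
  by rewrite mem_index_iota /= ltnS => le_jm ->; rewrite dvdn_mull ?leq_mul2r ?le_jm ?orbT.
rewrite (perm_big _ pe) big_map big_seq [RHS]big_seq; apply: eq_bigr => i.
rewrite mem_index_iota leq0n ltnS => le_im.
by rewrite -mulnBl !dvdn_mull // !mulnK.
Qed.

Fact fps_subst_is_monoid_morphism : monoid_morphism (@fps_subst K r).
Proof.
split; last exact: fps_substM.
apply: fpsP => -[|n] /=; first by rewrite ?dvdn0 ?div0n.
case: ifP => // dvd_n; case E: (_ %/ _)%N => //.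
by move: (dvdn_leq (ltn0Sn n) dvd_n); rewrite -divn_gt0 // E.
Qed.

HB.instance Definition _ := GRing.isZmodMorphism.Build (fps K) (fps K)
  (@fps_subst K r) fps_subst_is_zmod_morphism.
HB.instance Definition _ := GRing.isMonoidMorphism.Build (fps K) (fps K)
  (@fps_subst K r) fps_subst_is_monoid_morphism.

Lemma fps_substC (c : K) : fps_subst r (fpsC c) = fpsC c.
Proof.
apply: fpsP => -[|n] /=; first by rewrite ?dvdn0 ?div0n.
case: ifP => // dvd_n; case E: (_ %/ _)%N => //.
by move: (dvdn_leq (ltn0Sn n) dvd_n); rewrite -divn_gt0 // E.
Qed.

Lemma fpsD_subst f : (0 < r)%N -> fpsD (fps_subst r f) = r%:R * fps_subst r (fpsD f).
Proof.
move=> r_gt0; apply: fpsP => n; rewrite fps_natME fpsDerE !fps_substE //.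
case: ifP => [/dvdnP[m ->]|_]; last by rewrite !mulr0.
by rewrite mulnK // fpsDerE natrM mulrA [_ * r%:R]mulrC.
Qed.

End Subst.

(* Solutions of recursions [f n = Phi f n] in which [Phi f n] only depends on
   the values [f m] with [m < n]. *)
Lemma strong_recursion (T : Type) (x0 : T) (Phi : (nat -> T) -> nat -> T) :
    (forall n f g, (forall m, (m < n)%N -> f m = g m) -> Phi f n = Phi g n) ->
  exists f : nat -> T, forall n, f n = Phi f n.
Proof.
move=> ext; pose it n := iter n Phi (fun=> x0).
have stab n m p : (n < m)%N -> (n < p)%N -> it m n = it p n.
  elim/ltn_ind: n m p => n IH [//|m] [//|p]; rewrite !ltnS => le_m le_p /=.
  by apply: ext => k lt_kn; apply: IH => //; apply: leq_trans lt_kn _.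
exists (fun n => it n.+1 n) => n; rewrite -[LHS]/(Phi (it n) n).
by apply: ext => m lt_mn; apply: stab.
Qed.

Section FpsField.
Variable K : numFieldType.
Implicit Types f g h y : fps K.

Lemma fps_nat_inj m f g : (0 < m)%N -> m%:R * f = m%:R * g -> f = g.
Proof.
move=> m_gt0 e; apply: fpsP => n; move: (congr1 (fun f : fps K => f n) e).
by rewrite !fps_natME => /mulfI; apply; rewrite pnatr_eq0 -lt0n.
Qed.

(** For g 0 = 0 this is D y = y g read off coefficientwise; leaving out the term i = n makes the
    recursion solvable for every g. *)
Lemma expint_exists g : exists y, y 0%N = 1 /\
  forall n, (0 < n)%N -> n%:R * y n = \sum_(i < n) y i * g (n - i)%N.
Proof.
have [|y yE] := @strong_recursion K 0 (fun (y : nat -> K) n =>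
    if n is 0 then 1 else n%:R^-1 * \sum_(i < n) y i * g (n - i)%N) _.
  move=> [|n] f h e //; congr (_ * _); apply: eq_bigr => i _.
  by rewrite e.
exists (Fps y) => /=; split=> [|[//|n] _]; first by rewrite yE.
by rewrite [in LHS]yE mulrA divff ?mul1r // pnatr_eq0.
Qed.

(* The solution of [D y = y * g], [y 0 = 1], when [g 0 = 0]. *)
Definition expint g : fps K := projT1 (cid (expint_exists g)).

Lemma expint0E g : expint g 0%N = 1.
Proof. by rewrite /expint; case: cid => y []. Qed.

Lemma expint_recE g n : (0 < n)%N ->
  n%:R * expint g n = \sum_(i < n) expint g i * g (n - i)%N.
Proof. by rewrite /expint; case: cid => y [_] /=; apply. Qed.

Lemma fpsD_expint g : g 0%N = 0 -> fpsD (expint g) = expint g * g.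
Proof.
move=> g0; apply: fpsP => n; rewrite fpsME big_ord_recr /= subnn g0 mulr0 addr0.
by case: n => [|n]; [rewrite mul0r big_ord0|rewrite expint_recE].
Qed.

(* The resonance of [D y = y * g] is at the index [g 0]. *)
Lemma linear_ode_unique g y y' n0 :
    (forall n, (n0 <= n)%N -> n%:R != g 0%N) -> eqfps n0 y y' ->
  fpsD y = y * g -> fpsD y' = y' * g -> y = y'.
Proof.
move=> nres e0 Dy Dy'; apply: fpsP; elim/ltn_ind => n IH.
have [lt_n|le_n] := ltnP n n0; first exact: e0.
have := congr1 (fun f : fps K => f n) Dy'.
have := congr1 (fun f : fps K => f n) Dy.
rewrite !fpsME !big_ord_recr /= subnn.
rewrite (eq_bigr (fun i : 'I_n => y' i * g (n - i)%N)); last by move=> i _; rewrite IH.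
move=> e1 e2; have : (n%:R - g 0%N) * (y n - y' n) = 0.
  by rewrite mulrBr !mulrBl e1 e2; ring.
move/eqP; rewrite mulf_eq0 !subr_eq0 (negPf (nres _ le_n)) /=.
by move/eqP.
Qed.

Lemma expint_unique g y : g 0%N = 0 -> y 0%N = 1 -> fpsD y = y * g -> y = expint g.
Proof.
move=> g0 y0 Dy; apply: (@linear_ode_unique g y (expint g) 1) => //.
- by move=> [|n] // _; rewrite g0 pnatr_eq0.
- by case=> // _; rewrite y0 expint0E.
- exact: fpsD_expint.
Qed.

Lemma expintD g h : g 0%N = 0 -> h 0%N = 0 -> expint (g + h) = expint g * expint h.
Proof.
move=> g0 h0; symmetry; apply: expint_unique.
- by rewrite fpsDE g0 h0 addr0.
- by rewrite fpsM0E !expint0E mulr1.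
- by rewrite fpsDM !fpsD_expint //; ring.
Qed.

Lemma expint0 : expint 0 = 1.
Proof. by symmetry; apply: expint_unique; rewrite // fpsD1 mulr0. Qed.

Lemma expintMn g n : g 0%N = 0 -> expint (g *+ n) = expint g ^+ n.
Proof.
move=> g0; elim: n => [|n IH]; first by rewrite mulr0n expint0.
rewrite mulrS expintD ?IH ?exprS //.
by elim: n {IH} => [|n IH] //; rewrite mulrS fpsDE g0 IH addr0.
Qed.

Lemma expintVr g : g 0%N = 0 -> expint g * expint (- g) = 1.
Proof. by move=> g0; rewrite -expintD ?subrr ?expint0 // fpsNE g0 oppr0. Qed.

Lemma fps_inv_exists f : f 0%N != 0 -> exists g, f * g = 1.
Proof.
move=> f0.
have [|y yE] := @strong_recursion K 0 (fun (y : nat -> K) n =>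
    (f 0%N)^-1 * ((n == 0%N)%:R - \sum_(i < n) f i.+1 * y (n - i.+1)%N)) _.
  move=> n y h e; congr (_ * (_ - _)); apply: eq_bigr => i _.
  by rewrite e //; have := ltn_ord i; lia.
exists (Fps y); apply: fpsP => n; rewrite fpsME big_ord_recl /= subn0 yE.
by rewrite mulrA divff // mul1r subrK.
Qed.

End FpsField.

(** * Convolutions of divisor sums *)

Section DivisorConvolution.

(* Unlike [divisors 0], which is [:: 1], [divs 0] is empty. *)
Definition divs n := [seq d <- iota 1 n | (d %| n)%N].

Lemma divs_uniq n : uniq (divs n).
Proof. by rewrite filter_uniq ?iota_uniq. Qed.

Lemma mem_divs d n : (d \in divs n) = (0 < n)%N && (d %| n)%N.
Proof.
rewrite mem_filter mem_iota add1n ltnS; case: n => [|n] /=.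
  by case: d => [|d]; rewrite andbF.
apply: andb_idr => dvd; rewrite (dvdn_leq _ dvd) // andbT.
by case: d dvd.
Qed.

(* The quadruples (a, b, m, n) of positive integers with a m + b n = N. *)
Definition quads (N : nat) : seq (nat * nat * nat * nat) :=
  [seq (ab.1, ab.2, i %/ ab.1, (N - i) %/ ab.2)%N | i <- iota 0 N.+1,
     ab <- [seq (a, b) | a <- divs i, b <- divs (N - i)]].


Lemma mem_quads N a b m n : ((a, b, m, n) \in quads N) =
  [&& 0 < a, 0 < b, 0 < m, 0 < n & a * m + b * n == N]%N.
Proof.
apply/allpairsPdep/and5P.
  case=> i [[a' b'] [+ + /= e]]; rewrite mem_iota add0n ltnS => le_iN.
  case/allpairsP => -[a1 b1] /= [+ + [? ?]]; subst a' b'; case: e => -> -> -> ->.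
  rewrite !mem_divs => /andP[i_gt0 /dvdnP[m' im]] /andP[Ni_gt0 /dvdnP[n' Nin]].
  rewrite im muln_gt0 in i_gt0; rewrite Nin muln_gt0 in Ni_gt0.
  case/andP: i_gt0 => m_gt0 a_gt0; case/andP: Ni_gt0 => n_gt0 b_gt0.
  rewrite Nin im !mulnK //; split => //.
  by rewrite [(a1 * _)%N]mulnC [(b1 * _)%N]mulnC -Nin -im subnKC.
case=> a_gt0 b_gt0 m_gt0 n_gt0 /eqP <-.
exists (a * m)%N, (a, b); split.
- by rewrite mem_iota add0n ltnS leq_addr.
- apply/allpairsP; exists (a, b); split=> //=.
    by rewrite mem_divs muln_gt0 a_gt0 m_gt0 dvdn_mulr.
  by rewrite addKn mem_divs muln_gt0 b_gt0 n_gt0 dvdn_mulr.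
- by rewrite /= addKn !mulKn.
Qed.

Lemma uniq_quads N : uniq (quads N).
Proof.
apply: allpairs_uniq_dep => [|i _|]; first exact: iota_uniq.
  by apply: allpairs_uniq => [||[a b] [a' b']] //; apply: divs_uniq.
move=> _ _ /allpairsPdep[i [[a b] [_ im ->]]] /allpairsPdep[j [[a' b'] [_ jm ->]]] /=.
move: im jm.
case/allpairsP => -[a1 b1] /= [+ + [? ?]]; subst a1 b1; rewrite !mem_divs => /andP[_ d1] _.
case/allpairsP => -[a1 b1] /= [+ + [? ?]]; subst a1 b1; rewrite !mem_divs => /andP[_ d2] _.
case=> ? ? e _; subst a' b'.
by have -> : i = j by rewrite -(divnK d1) -(divnK d2) e.
Qed.

Variable A : comNzRingType.
Implicit Types (P : nat -> nat -> nat -> nat -> bool).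
Implicit Types (F : nat -> nat -> nat -> nat -> A) (h : nat -> A).

Definition qsum N P F : A :=
  \sum_(x <- quads N | P x.1.1.1 x.1.1.2 x.1.2 x.2) F x.1.1.1 x.1.1.2 x.1.2 x.2.

Lemma eq_qsum N P P' F F' :
    (forall a b m n, (a, b, m, n) \in quads N -> P a b m n = P' a b m n) ->
    (forall a b m n, (a, b, m, n) \in quads N -> P a b m n -> F a b m n = F' a b m n) ->
  qsum N P F = qsum N P' F'.
Proof.
move=> eP eF; rewrite /qsum big_seq_cond [RHS]big_seq_cond.
apply: eq_big => [[[[a b] m] n]|[[[a b] m] n]] /=.
  by case: (boolP (_ \in _)) => //= /eP.
by case/andP => ? ?; apply: eF.
Qed.

Lemma qsum_reindex N P Q F G (f g : nat * nat * nat * nat -> nat * nat * nat * nat) :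
  let Pq P (x : nat * nat * nat * nat) := P x.1.1.1 x.1.1.2 x.1.2 x.2 in
    (forall x, x \in quads N -> Pq P x ->
       [/\ f x \in quads N, Pq Q (f x), g (f x) = x &
           F x.1.1.1 x.1.1.2 x.1.2 x.2 =
           G (f x).1.1.1 (f x).1.1.2 (f x).1.2 (f x).2]) ->
    (forall y, y \in quads N -> Pq Q y ->
       [/\ g y \in quads N, Pq P (g y) & f (g y) = y]) ->
  qsum N P F = qsum N Q G.
Proof.
move=> Pq HP HQ; rewrite /qsum -[RHS]big_filter.
rewrite [RHS](perm_big [seq f x | x <- quads N & Pq P x]) /=; last first.
  apply: uniq_perm; first by rewrite filter_uniq // uniq_quads.
    rewrite map_inj_in_uniq ?filter_uniq ?uniq_quads // => x y.
    rewrite !mem_filter => /andP[Px xq] /andP[Py yq] e.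
    by have [_ _ <- _] := HP x xq Px; rewrite e; case: (HP y yq Py).
  move=> y; rewrite mem_filter; apply/andP/mapP => [[Qy yq]|[x]].
    have [gq Pg e] := HQ y yq Qy; exists (g y) => //.
    by rewrite mem_filter Pg.
  by rewrite mem_filter => /andP[Px xq ->]; have [] := HP x xq Px.
rewrite big_map big_filter big_seq_cond [RHS]big_seq_cond; apply: eq_bigr => x.
by case/andP => xq Px; have [] := HP x xq Px.
Qed.

Lemma qsum_swap N P F :
  qsum N P F = qsum N (fun a b m n => P b a n m) (fun a b m n => F b a n m).
Proof.
pose f (x : nat * nat * nat * nat) := (x.1.1.2, x.1.1.1, x.2, x.1.2).
apply: (@qsum_reindex _ _ _ _ _ f f) => [[[[a b] m] n]|[[[a b] m] n]] /= + Px.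
  by rewrite !mem_quads /f /= => /and5P[-> -> -> -> /eqP <-]; rewrite addnC eqxx; split.
by rewrite !mem_quads /f /= => /and5P[-> -> -> -> /eqP <-]; rewrite addnC eqxx; split.
Qed.

(** A Euclidean step on (a, b): a m + b n = (a - b) m + b (m + n), and the new last entry m + n
    exceeds m. *)
Lemma qsum_euclid_left N F :
  qsum N (fun a b _ _ => b < a)%N F =
  qsum N (fun _ _ m n => m < n)%N (fun a b m n => F (a + b)%N b m (n - m)%N).
Proof.
pose f (x : nat * nat * nat * nat) := (x.1.1.1 - x.1.1.2, x.1.1.2, x.1.2, x.1.2 + x.2)%N.
pose g (x : nat * nat * nat * nat) := (x.1.1.1 + x.1.1.2, x.1.1.2, x.1.2, x.2 - x.1.2)%N.
apply: (@qsum_reindex _ _ _ _ _ f g) => [[[[a b] m] n]|[[[a b] m] n]] /=;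
  rewrite !mem_quads /f /g /= => /and5P[a0 b0 m0 n0 /eqP <-] lt.
  split.
  - rewrite subn_gt0 lt b0 m0 addn_gt0 m0 /=; apply/eqP.
    by rewrite mulnDr mulnBl addnA subnK // leq_mul2r ltnW ?orbT.
  - by rewrite -{1}[m]addn0 ltn_add2l.
  - by rewrite addKn subnK // ltnW.
  - by rewrite addKn subnK // ltnW.
split.
- rewrite subn_gt0 lt b0 m0 addn_gt0 a0 /=; apply/eqP.
  by rewrite mulnDl mulnBr -addnA subnKC // leq_mul2l ltnW ?orbT.
- by rewrite -{1}[b]add0n ltn_add2r.
- by rewrite addnK subnKC // ltnW.
Qed.

(** The dual step, on (m, n): a m + b n = a (m - n) + (a + b) n. *)
Lemma qsum_euclid_right N F :
  qsum N (fun _ _ m n => n < m)%N F =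
  qsum N (fun a b _ _ => a < b)%N (fun a b m n => F a (b - a)%N (m + n)%N n).
Proof.
pose f (x : nat * nat * nat * nat) := (x.1.1.1, x.1.1.1 + x.1.1.2, x.1.2 - x.2, x.2)%N.
pose g (x : nat * nat * nat * nat) := (x.1.1.1, x.1.1.2 - x.1.1.1, x.1.2 + x.2, x.2)%N.
apply: (@qsum_reindex _ _ _ _ _ f g) => [[[[a b] m] n]|[[[a b] m] n]] /=;
  rewrite !mem_quads /f /g /= => /and5P[a0 b0 m0 n0 /eqP <-] lt.
  split.
  - rewrite subn_gt0 lt a0 n0 addn_gt0 a0 /=; apply/eqP.
    by rewrite mulnDl mulnBr addnA subnK // leq_mul2l ltnW ?orbT.
  - by rewrite -{1}[a]addn0 ltn_add2l.
  - by rewrite addKn subnK // ltnW.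
  - by rewrite addKn subnK // ltnW.
split.
- rewrite subn_gt0 lt a0 n0 addn_gt0 m0 /=; apply/eqP.
  by rewrite mulnDr mulnBl -addnA subnKC // leq_mul2r ltnW ?orbT.
- by rewrite -{1}[n]add0n ltn_add2r.
- by rewrite addnK subnKC // ltnW.
Qed.

Definition qtrue (a b m n : nat) := true.

Lemma qsumD N P F G :
  qsum N P (fun a b m n => F a b m n + G a b m n) = qsum N P F + qsum N P G.
Proof. exact: big_split. Qed.

Lemma qsumMl N P F c : qsum N P (fun a b m n => c * F a b m n) = c * qsum N P F.
Proof. by rewrite /qsum mulr_sumr. Qed.

Lemma qsumN N P F : qsum N P (fun a b m n => - F a b m n) = - qsum N P F.
Proof. by rewrite /qsum sumrN. Qed.

Lemma qsumB N P F G :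
  qsum N P (fun a b m n => F a b m n - G a b m n) = qsum N P F - qsum N P G.
Proof. by rewrite qsumD qsumN. Qed.

Lemma qsum_trichotomy N F (u v : nat -> nat -> nat -> nat -> nat) :
  qsum N qtrue F = qsum N (fun a b m n => u a b m n < v a b m n)%N F
    + qsum N (fun a b m n => v a b m n < u a b m n)%N F
    + qsum N (fun a b m n => u a b m n == v a b m n) F.
Proof.
rewrite /qsum -addrA (bigID (fun x => u x.1.1.1 x.1.1.2 x.1.2 x.2 < v x.1.1.1 x.1.1.2 x.1.2 x.2)%N) /=.
congr (_ + _); rewrite (bigID (fun x => v x.1.1.1 x.1.1.2 x.1.2 x.2 < u x.1.1.1 x.1.1.2 x.1.2 x.2)%N) /=.
congr (_ + _); apply: eq_bigl => x; rewrite -leqNgt; last by rewrite -leqNgt eqn_leq andbC.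
by rewrite andb_idl // => /ltnW.
Qed.

Lemma qsum_const_mult N F : qsum N qtrue F =
  \sum_(i < N.+1) \sum_(a <- divs i) \sum_(b <- divs (N - i))
    F a b (i %/ a)%N ((N - i) %/ b)%N.
Proof.
rewrite /qsum big_allpairs_dep -[RHS](big_mkord xpredT (fun i => \sum_(a <- divs i)
  \sum_(b <- divs (N - i)) F a b (i %/ a)%N ((N - i) %/ b)%N)) /index_iota subn0.
by apply: eq_bigr => i _; rewrite big_allpairs_dep /=.
Qed.

Lemma qsum_diag_right N F :
  qsum N (fun _ _ m n => m == n) F =
  \sum_(d <- divs N) \sum_(1 <= a < d) F a (d - a)%N (N %/ d)%N (N %/ d)%N.
Proof.
transitivity (\sum_(x <- [seq (a, d - a, N %/ d, N %/ d)%N | d <- divs N, a <- index_iota 1 d])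
   F x.1.1.1 x.1.1.2 x.1.2 x.2); last by rewrite big_allpairs_dep.
rewrite /qsum -big_filter; apply: perm_big; apply: uniq_perm.
- by rewrite filter_uniq // uniq_quads.
- apply: allpairs_uniq_dep => [|d _|]; [exact: divs_uniq|exact: iota_uniq|].
  move=> _ _ /allpairsPdep[d [a [+ + ->]]] /allpairsPdep[d' [a' [+ + ->]]].
  rewrite !mem_index_iota => _ /andP[_ l1] _ /andP[_ l2] /= [? e _]; subst a'.
  by have -> : d = d' by lia.
- case=> [[[a b] m] n]; rewrite mem_filter mem_quads /=.
  apply/andP/allpairsPdep => [[/eqP <- /and5P[a0 b0 m0 _ /eqP e]]|].
    exists (a + b)%N, a; split.
    + by rewrite mem_divs -e -mulnDl muln_gt0 addn_gt0 a0 m0 dvdn_mulr.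
    + by rewrite mem_index_iota a0 -{1}[a]addn0 ltn_add2l.
    + by rewrite addKn -e -mulnDl mulKn // addn_gt0 a0.
  case=> d [a' [+ + [-> -> -> ->]]]; rewrite mem_divs mem_index_iota.
  case/andP => N0 dvd /andP[a0 lt]; rewrite eqxx; split=> //.
  have d0 : (0 < d)%N by lia.
  rewrite a0 subn_gt0 lt divn_gt0 // (dvdn_leq N0 dvd) /=; apply/eqP.
  have e : (a' + (d - a') = d)%N by rewrite subnKC // ltnW.
  by rewrite -mulnDl e mulnC divnK.
Qed.

Lemma qsum_diag_left N F :
  qsum N (fun a b _ _ => a == b) F =
  \sum_(d <- divs N) \sum_(1 <= m < N %/ d) F d d m (N %/ d - m)%N.
Proof.
transitivity (\sum_(x <- [seq (d, d, m, N %/ d - m)%N | d <- divs N, m <- index_iota 1 (N %/ d)])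
   F x.1.1.1 x.1.1.2 x.1.2 x.2); last by rewrite big_allpairs_dep.
rewrite /qsum -big_filter; apply: perm_big; apply: uniq_perm.
- by rewrite filter_uniq // uniq_quads.
- apply: allpairs_uniq_dep => [|d _|]; [exact: divs_uniq|exact: iota_uniq|].
  by move=> _ _ /allpairsPdep[d [a [_ _ ->]]] /allpairsPdep[d' [a' [_ _ ->]]] /= [-> _ -> _].
- case=> [[[a b] m] n]; rewrite mem_filter mem_quads /=.
  apply/andP/allpairsPdep => [[/eqP <- /and5P[a0 _ m0 n0 /eqP e]]|].
    exists a, m; rewrite -e -mulnDr mulKn // addKn; split=> //.
      by rewrite mem_divs muln_gt0 addn_gt0 a0 m0 dvdn_mulr.
    by rewrite mem_index_iota m0 -{1}[m]addn0 ltn_add2l.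
  case=> d [m' [+ + [-> -> -> ->]]]; rewrite mem_divs mem_index_iota.
  case/andP => N0 dvd /andP[a0 lt]; rewrite eqxx; split=> //.
  have d0 : (0 < d)%N by apply: dvdn_gt0 dvd.
  rewrite d0 a0 subn_gt0 lt /=; apply/eqP.
  have e : (m' + (N %/ d - m') = N %/ d)%N by rewrite subnKC // ltnW.
  by rewrite -mulnDr e mulnC divnK.
Qed.

Let dist_addK (a b : nat) : (`|(a + b)%N - b|)%N = a.
Proof. by rewrite distnEl ?leq_addl // addnK. Qed.

(** Euclidean steps reduce the terms in |a - b| to the half m < n ([S1]) and those in a + b to the
    half b < a ([S2]). Completing both halves to full sums produces the same sum over a < b with
    opposite signs. What remains is the full sum with weight (a b + b^2) + (a - b) b = 2 a b, and
    the diagonals m = n and a = b. *)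
Lemma qsum_weighted_identity N h :
  qsum N qtrue (fun a b _ _ => (a * b)%:R * (h (a + b)%N + h (`|a - b|)%N)) =
  4 * qsum N qtrue (fun a b _ _ => (a * b)%:R * h a)
  + qsum N (fun _ _ m n => m == n) (fun a b _ _ => (a * b)%:R * h (a + b)%N)
  - 2 * qsum N (fun _ _ m n => m == n) (fun a b _ _ => (b * (a + b))%:R * h a)
  + qsum N (fun a b _ _ => a == b) (fun a _ _ _ => (a * a)%:R * h 0%N).
Proof.
pose S1 := qsum N (fun a b m n => m < n)%N (fun a b _ _ => (a * b + b * b)%:R * h a).
pose S2 := qsum N (fun a b m n => b < a)%N (fun a b _ _ => ((a%:R - b%:R) * b%:R) * h a).
have e1 : qsum N qtrue (fun a b _ _ => (a * b)%:R * h (`|a - b|)%N) =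
    2 * S1 + qsum N (fun a b _ _ => a == b) (fun a _ _ _ => (a * a)%:R * h 0%N).
  rewrite (qsum_trichotomy N _ (fun a b _ _ => a) (fun a b _ _ => b)); congr (_ + _).
    rewrite [X in X + _]qsum_swap mulr2n mulrDl mul1r; congr (_ + _);
      rewrite qsum_euclid_left; apply: eq_qsum => // a b m n _ _.
      by rewrite distnC dist_addK mulnC mulnDl.
    by rewrite dist_addK mulnDl.
  by apply: eq_qsum => // a b m n _ /eqP <-; rewrite distnn.
have e2 : qsum N qtrue (fun a b _ _ => (a * b)%:R * h (a + b)%N) =
    2 * S2 + qsum N (fun _ _ m n => m == n) (fun a b _ _ => (a * b)%:R * h (a + b)%N).
  rewrite (qsum_trichotomy N _ (fun _ _ m n => m) (fun _ _ m n => n)); congr (_ + _).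
  rewrite [X in _ + X]qsum_swap mulr2n mulrDl mul1r /S2 qsum_euclid_left; congr (_ + _);
    apply: eq_qsum => // a b m n _ _; last by rewrite mulnC addnC natrD natrM; ring.
  by rewrite natrD natrM; ring.
have e3 : S1 = qsum N qtrue (fun a b _ _ => (a * b + b * b)%:R * h a)
    - qsum N (fun a b _ _ => a < b)%N (fun a b _ _ => ((b%:R - a%:R) * b%:R) * h a)
    - qsum N (fun _ _ m n => m == n) (fun a b _ _ => (b * (a + b))%:R * h a).
  rewrite [in RHS](qsum_trichotomy N _ (fun _ _ m n => m) (fun _ _ m n => n)).
  rewrite [in RHS]qsum_euclid_right -/S1.
  rewrite (@eq_qsum N _ (fun a b _ _ => (a < b)%N) _
     (fun a b _ _ => ((b%:R - a%:R) * b%:R) * h a)) //; last first.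
    move=> a b m n _ lt; congr (_ * _); rewrite natrD !natrM natrB; first by ring.
    exact: ltnW.
  rewrite (@eq_qsum N _ (fun _ _ m n => m == n) (fun a b _ _ => (a * b + b * b)%:R * h a)
     (fun a b _ _ => (b * (a + b))%:R * h a)) //; first by ring.
  by move=> a b m n _ _; rewrite mulnDr [(b * a)%N]mulnC.
have e4 : qsum N qtrue (fun a b _ _ => ((a%:R - b%:R) * b%:R) * h a) =
    S2 - qsum N (fun a b _ _ => a < b)%N (fun a b _ _ => ((b%:R - a%:R) * b%:R) * h a).
  rewrite (qsum_trichotomy N _ (fun a b _ _ => a) (fun a b _ _ => b)).
  rewrite [X in _ + X](_ : _ = 0) ?addr0 1?addrC; last first.
    by rewrite /qsum big1 // => x /eqP ->; rewrite subrr !mul0r.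
  congr (_ + _); rewrite -qsumN; apply: eq_qsum => // a b m n _ _; ring.
have e5 : qsum N qtrue (fun a b _ _ => (a * b + b * b)%:R * h a) +
    qsum N qtrue (fun a b _ _ => ((a%:R - b%:R) * b%:R) * h a) =
    2 * qsum N qtrue (fun a b _ _ => (a * b)%:R * h a).
  rewrite -qsumD -qsumMl; apply: eq_qsum => // a b m n _ _.
  by rewrite natrD !natrM; ring.
have -> : qsum N qtrue (fun a b _ _ => (a * b)%:R * (h (a + b)%N + h (`|a - b|)%N)) =
    qsum N qtrue (fun a b _ _ => (a * b)%:R * h (a + b)%N)
    + qsum N qtrue (fun a b _ _ => (a * b)%:R * h (`|a - b|)%N).
  by rewrite -qsumD; apply: eq_qsum => // a b m n _ _; rewrite mulrDr.
rewrite e1 e2 e3 -[4]/(2 * 2)%:R natrM -mulrA -e5 e4; ring.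
Qed.

(** The same decomposition with weight one. Because of the difference on the left the full sums
    cancel as well, and only diagonals remain. *)
Lemma qsum_identity N h :
  qsum N qtrue (fun a b _ _ => h (`|a - b|)%N - h (a + b)%N) =
  2 * (qsum N (fun a b _ _ => a == b) (fun a _ _ _ => h a)
       - qsum N (fun _ _ m n => m == n) (fun a _ _ _ => h a))
  + qsum N (fun a b _ _ => a == b) (fun _ _ _ _ => h 0%N)
  - qsum N (fun _ _ m n => m == n) (fun a b _ _ => h (a + b)%N).
Proof.
pose S1 := qsum N (fun a b m n => m < n)%N (fun a b _ _ => h a).
pose S2 := qsum N (fun a b m n => b < a)%N (fun a b _ _ => h a).
have e1 : qsum N qtrue (fun a b _ _ => h (`|a - b|)%N) =
    2 * S1 + qsum N (fun a b _ _ => a == b) (fun a _ _ _ => h 0%N).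
  rewrite (qsum_trichotomy N _ (fun a b _ _ => a) (fun a b _ _ => b)); congr (_ + _).
    rewrite [X in X + _]qsum_swap mulr2n mulrDl mul1r; congr (_ + _);
      rewrite qsum_euclid_left; apply: eq_qsum => // a b m n _ _.
      by rewrite distnC dist_addK.
    by rewrite dist_addK.
  by apply: eq_qsum => // a b m n _ /eqP <-; rewrite distnn.
have e2 : qsum N qtrue (fun a b _ _ => h (a + b)%N) =
    2 * S2 + qsum N (fun _ _ m n => m == n) (fun a b _ _ => h (a + b)%N).
  rewrite (qsum_trichotomy N _ (fun _ _ m n => m) (fun _ _ m n => n)); congr (_ + _).
  rewrite [X in _ + X]qsum_swap mulr2n mulrDl mul1r /S2 qsum_euclid_left; congr (_ + _).
  by apply: eq_qsum => // a b m n _ _; rewrite addnC.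
have e3 : S1 = qsum N qtrue (fun a b _ _ => h a)
    - qsum N (fun a b _ _ => a < b)%N (fun a b _ _ => h a)
    - qsum N (fun _ _ m n => m == n) (fun a b _ _ => h a).
  rewrite [in RHS](qsum_trichotomy N _ (fun _ _ m n => m) (fun _ _ m n => n)).
  by rewrite [in RHS]qsum_euclid_right -/S1; ring.
have e4 : S2 = qsum N qtrue (fun a b _ _ => h a)
    - qsum N (fun a b _ _ => a < b)%N (fun a b _ _ => h a)
    - qsum N (fun a b _ _ => a == b) (fun a b _ _ => h a).
  by rewrite [in RHS](qsum_trichotomy N _ (fun a b _ _ => a) (fun a b _ _ => b)) -/S2; ring.
by rewrite qsumB e1 e2 e3 e4; ring.
Qed.

End DivisorConvolution.

Section Lambert.
Variable A : comNzRingType.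
Implicit Types h : nat -> A.

(** The Lambert series with terms h(d) q^d / (1 - q^d); products of two of them are sums over
    quadruples. *)
Definition divsum h : fps A := Fps (fun N => \sum_(d <- divs N) h d).

Lemma divsumE h N : divsum h N = \sum_(d <- divs N) h d. Proof. by []. Qed.

Lemma divsum0E h : divsum h 0%N = 0.
Proof. by rewrite /= /divs big_nil. Qed.

Lemma divsumM h1 h2 N :
  (divsum h1 * divsum h2) N = qsum N qtrue (fun a b _ _ => h1 a * h2 b).
Proof.
rewrite qsum_const_mult fpsME; apply: eq_bigr => i _; rewrite !divsumE mulr_suml.
by apply: eq_bigr => a _; rewrite mulr_sumr.
Qed.

Lemma qsum_diag_left_const N (F : nat -> A) :
  qsum N (fun a b _ _ => a == b) (fun a _ _ _ => F a) =
  \sum_(d <- divs N) ((N %/ d)%:R - 1) * F d.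
Proof.
rewrite qsum_diag_left big_seq [RHS]big_seq; apply: eq_bigr => d.
rewrite mem_divs => /andP[N0 dvd].
have d0 : (0 < d)%N by apply: dvdn_gt0 dvd.
have Nd0 : (0 < N %/ d)%N by rewrite divn_gt0 // dvdn_leq.
rewrite sumr_const_nat -[in RHS](prednK Nd0) -natr1 addrK.
by rewrite mulr_natl subn1.
Qed.

(** The factor N that comes out is how the derivation D enters the identities between divisor
    sums. *)
Lemma divsum_scale_dual N (F : nat -> A) :
  \sum_(d <- divs N) (N %/ d)%:R * (d%:R * F d) = N%:R * \sum_(d <- divs N) F d.
Proof.
rewrite mulr_sumr big_seq [RHS]big_seq; apply: eq_bigr => d.
by rewrite mem_divs => /andP[_ dvd]; rewrite mulrA -natrM divnK.
Qed.

End Lambert.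

Section DivisorIdentities.
Variable A : comNzRingType.
Implicit Types h : nat -> A.

Let sum_mul_sub d : (6 * \sum_(1 <= a < d) (a * (d - a))%:R = d%:R ^+ 3 - d%:R :> A).
Proof.
(* The upper end is separated from the d of the summand to allow an induction. *)
suff e n : (n <= d)%N ->
    6 * \sum_(0 <= a < n) (a * (d - a))%:R =
    3 * d%:R * (n%:R ^+ 2 - n%:R) - (2 * n%:R ^+ 3 - 3 * n%:R ^+ 2 + n%:R) :> A.
  have := e d (leqnn d); case: (posnP d) => [->|d_gt0]; first by rewrite !big_geq // => _; ring.
  by rewrite big_ltn // mul0n add0r => ->; ring.
elim: n => [|n IH] lt_nd; first by rewrite big_geq //; ring.
rewrite big_nat_recr //= mulrDr IH 1?ltnW // natrM natrB 1?ltnW // -[n.+1%:R]natr1.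
ring.
Qed.

(** The factor 6 clears the denominator in the sum (d^3 - d)/6 of the a (d - a), so that the
    identity holds over any commutative ring; it is applied to powers of d and to the power series
    [cosh2]. *)
Lemma weighted_divisor_identity N h :
  6 * qsum N qtrue (fun a b _ _ => (a * b)%:R * (h (a + b)%N + h (`|a - b|)%N)) =
  24 * qsum N qtrue (fun a b _ _ => (a * b)%:R * h a)
  + \sum_(d <- divs N) ((d%:R ^+ 3 - d%:R) * h d
      - 12 * d%:R * \sum_(1 <= a < d) (d%:R - a%:R) * h a
      - 6 * d%:R ^+ 2 * h 0%N)
  + 6 * h 0%N * N%:R * \sum_(d <- divs N) d%:R.
Proof.
rewrite qsum_weighted_identity !qsum_diag_right qsum_diag_left_const.
have -> : \sum_(d <- divs N) ((N %/ d)%:R - 1) * ((d * d)%:R * h 0%N) =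
    h 0%N * N%:R * (\sum_(d <- divs N) d%:R) - \sum_(d <- divs N) d%:R ^+ 2 * h 0%N.
  rewrite -[h 0%N * _ * _]mulrA -divsum_scale_dual mulr_sumr -sumrB.
  by apply: eq_bigr => d _; rewrite natrM; ring.
have -> : \sum_(d <- divs N) \sum_(1 <= a < d) ((d - a) * (a + (d - a)))%:R * h a =
    \sum_(d <- divs N) d%:R * \sum_(1 <= a < d) (d%:R - a%:R) * h a.
  apply: eq_bigr => d _; rewrite mulr_sumr; apply: eq_big_nat => a /andP[_ /ltnW lt].
  by rewrite subnKC // natrM natrB //; ring.
have e : 6 * \sum_(d <- divs N) \sum_(1 <= a < d) (a * (d - a))%:R * h (a + (d - a))%N =
    \sum_(d <- divs N) (d%:R ^+ 3 - d%:R) * h d.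
  rewrite mulr_sumr; apply: eq_bigr => d _; rewrite -sum_mul_sub -mulrA; congr (_ * _).
  by rewrite mulr_suml; apply: eq_big_nat => a /andP[_ /ltnW lt]; rewrite subnKC.
rewrite !sumrB -e.
have -> : \sum_(d <- divs N) 12 * d%:R * (\sum_(1 <= a < d) (d%:R - a%:R) * h a) =
    12 * \sum_(d <- divs N) d%:R * (\sum_(1 <= a < d) (d%:R - a%:R) * h a).
  by rewrite mulr_sumr; apply: eq_bigr => d _; rewrite mulrA.
have -> : \sum_(d <- divs N) 6 * d%:R ^+ 2 * h 0%N =
    6 * \sum_(d <- divs N) d%:R ^+ 2 * h 0%N.
  by rewrite mulr_sumr; apply: eq_bigr => d _; rewrite mulrA.
by ring.
Qed.

(** For h an even power, the left side is a combination of products of divisor sums of odd index,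
    and N %/ d on the right yields a derivative. *)
Lemma divisor_identity N h :
  qsum N qtrue (fun a b _ _ => h (`|a - b|)%N - h (a + b)%N) =
  \sum_(d <- divs N) (((N %/ d)%:R - 1) * (2 * h d + h 0%N)
     - 2 * \sum_(1 <= a < d) h a - (d%:R - 1) * h d).
Proof.
rewrite qsum_identity !qsum_diag_right !qsum_diag_left_const.
rewrite mulrBr !mulr_sumr -!sumrN -!big_split /= big_seq [RHS]big_seq.
apply: eq_bigr => d; rewrite mem_divs => /andP[N0 dvd].
rewrite (@eq_big_nat _ _ _ 1 d (fun a => h (a + (d - a))%N) (fun=> h d)); last first.
  by move=> a /andP[_ lt]; rewrite subnKC // ltnW.
have -> : \sum_(1 <= a < d) h d = (d%:R - 1) * h d.
  by rewrite sumr_const_nat -[in LHS]mulr_natl natrB ?(dvdn_gt0 N0 dvd).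
by ring.
Qed.

End DivisorIdentities.

(** Reduces a goal that is c times a known equation to an identity that [ring] can check. *)
Lemma eq_lincomb (A : comNzRingType) (c x y l r : A) :
  x = y -> l - r = c * (x - y) -> l = r.
Proof. by move=> ->; rewrite subrr mulr0 => /subr0_eq. Qed.

Section PolynomialCase.
Variable K : numFieldType.

Definition sigmaq (m : nat) : fps K := divsum (fun d => d%:R ^+ m).

Lemma sigmaq0E m : sigmaq m 0%N = 0. Proof. exact: divsum0E. Qed.

Lemma sigmaqE m N : sigmaq m N = \sum_(d <- divs N) d%:R ^+ m. Proof. by []. Qed.

Let dist_even (a b m : nat) :
  (`|a - b|)%N%:R ^+ (2 * m) = (a%:R - b%:R) ^+ (2 * m) :> K.
Proof.
case: (leqP a b) => [le_ab|/ltnW le_ba].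
  by rewrite distnEr // natrB // !exprM -[in RHS]sqrrN opprB.
by rewrite distnEl // natrB.
Qed.

(** Faulhaber's formulas by telescoping: it is enough to exhibit a polynomial with the right
    difference. *)
Let powsum (P : nat -> K) (Q : K -> K) :
    Q 1 = 0 -> (forall d : nat, Q (d%:R + 1) - Q d%:R = P d) ->
  forall d, (0 < d)%N -> \sum_(1 <= a < d) P a = Q d%:R.
Proof.
move=> Q1 QS [//|d] _; elim: d => [|d IH]; first by rewrite big_geq.
by rewrite big_nat_recr //= IH -QS // -[d.+2%:R]natr1; ring.
Qed.

Let divs_gt0 N d : d \in divs N -> (0 < d)%N.
Proof. by rewrite mem_divs => /andP[N0]; apply: dvdn_gt0. Qed.

Let eq_divsum N (F G : nat -> K) : (forall d, (0 < d)%N -> F d = G d) ->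
  \sum_(d <- divs N) F d = \sum_(d <- divs N) G d.
Proof.
by move=> e; rewrite big_seq [RHS]big_seq; apply: eq_bigr => d /divs_gt0 /e.
Qed.

Let qsumM N (i j : nat) :
  qsum N qtrue (fun a b _ _ => a%:R ^+ i * b%:R ^+ j) = (sigmaq i * sigmaq j) N.
Proof. by rewrite divsumM. Qed.

(** With E_2 = 1 - 24 sigma_1 and E_4 = 1 + 240 sigma_3 this is E_2^2 = E_4 + 12 D E_2. *)
Lemma sigmaq1_sqr :
  12 * sigmaq 1 ^+ 2 = 5 * sigmaq 3 + sigmaq 1 - 6 * fpsD (sigmaq 1).
Proof.
apply: fpsP => N; rewrite fpsBE fpsDE !fps_natME fpsDerE !sigmaqE.
have := weighted_divisor_identity N (fun=> 1 : K).
have -> : qsum N qtrue (fun a b _ _ => (a * b)%:R * (1 + 1)) =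
    2 * qsum N qtrue (fun a b _ _ => a%:R ^+ 1 * b%:R ^+ 1 : K).
  by rewrite -qsumMl; apply: eq_qsum => // a b m n _ _; rewrite natrM; ring.
have -> : qsum N qtrue (fun a b _ _ => (a * b)%:R * 1) =
    qsum N qtrue (fun a b _ _ => a%:R ^+ 1 * b%:R ^+ 1 : K).
  by apply: eq_qsum => // a b m n _ _; rewrite natrM; ring.
rewrite qsumM -expr2.
rewrite (@eq_divsum N _ (fun d => - 5 * d%:R ^+ 3 - d%:R ^+ 1)); last first.
  move=> d d0; rewrite (powsum (Q := fun x => (x - 1) * (d%:R - x / 2))) //.
  - by field.
  - by rewrite subrr mul0r.
  - by move=> n; field.
rewrite sumrB -mulr_sumr.
have -> : \sum_(d <- divs N) d%:R = \sum_(d <- divs N) d%:R ^+ 1 :> K by [].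
by move/(@eq_lincomb K (-1)); apply; ring.
Qed.

(** This is E_4^2 = E_8. For h(d) = d^4 the products sigma_1 sigma_5 cancel: 6 (2 + 2) of them on
    the left, 24 on the right. *)
Lemma sigmaq3_sqr : 120 * sigmaq 3 ^+ 2 = sigmaq 7 - sigmaq 3.
Proof.
apply: fpsP => N; rewrite fpsBE !fps_natME !sigmaqE.
have := weighted_divisor_identity N (fun d => d%:R ^+ 4 : K).
have -> : qsum N qtrue (fun a b _ _ => (a * b)%:R * ((a + b)%:R ^+ 4 + (`|a - b|)%N%:R ^+ 4)) =
    2 * (sigmaq 1 * sigmaq 5) N + 2 * (sigmaq 5 * sigmaq 1) N + 12 * (sigmaq 3 * sigmaq 3) N :> K.
  rewrite -!qsumM -!qsumMl -!qsumD; apply: eq_qsum => // a b m n _ _.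
  by rewrite (dist_even a b 2) natrM natrD; ring.
have -> : qsum N qtrue (fun a b _ _ => (a * b)%:R * a%:R ^+ 4) =
    (sigmaq 5 * sigmaq 1) N :> K.
  by rewrite -qsumM; apply: eq_qsum => // a b m n _ _; rewrite natrM; ring.
rewrite [sigmaq 1 * _]mulrC -expr2.
rewrite (@eq_divsum N _ (fun d => 3 / 5 * d%:R ^+ 7 - 3 / 5 * d%:R ^+ 3)); last first.
  (* [Q] sums d a^4 - a^5 over 1 <= a < x. *)
  move=> d d0; rewrite (powsum (Q := fun x =>
    d%:R * (x ^+ 5 / 5 - x ^+ 4 / 2 + x ^+ 3 / 3 - x / 30)
    - (x ^+ 6 / 6 - x ^+ 5 / 2 + 5 * x ^+ 4 / 12 - x ^+ 2 / 12))) //.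
  - by field.
  - by field.
  - by move=> n; field.
rewrite sumrB -!mulr_sumr expr0n /=.
by move/(@eq_lincomb K (5 / 3)); apply; field.
Qed.

(** This is 3 D E_4 = E_2 E_4 - E_6, with E_6 = 1 - 504 sigma_5. *)
Lemma sigmaq1_sigmaq3 : 240 * (sigmaq 1 * sigmaq 3) =
  21 * sigmaq 5 + 10 * sigmaq 3 - sigmaq 1 - 30 * fpsD (sigmaq 3).
Proof.
apply: fpsP => N; rewrite !(fpsBE, fpsDE) !fps_natME fpsDerE !sigmaqE.
have := divisor_identity N (fun d => d%:R ^+ 4 : K).
have -> : qsum N qtrue (fun a b _ _ => (`|a - b|)%N%:R ^+ 4 - (a + b)%:R ^+ 4) =
    - 16 * (sigmaq 1 * sigmaq 3) N :> K.
  have -> : -16 * (sigmaq 1 * sigmaq 3) N = - 8 * (sigmaq 1 * sigmaq 3) N - 8 * (sigmaq 3 * sigmaq 1) N :> K.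
    by rewrite [sigmaq 3 * _]mulrC; ring.
  rewrite -!qsumM -!qsumMl -!qsumB; apply: eq_qsum => // a b m n _ _.
  by rewrite (dist_even a b 2) natrD; ring.
rewrite (@eq_divsum N _ (fun d => 2 * ((N %/ d)%:R * (d%:R * d%:R ^+ 3)) - 7 / 5 * d%:R ^+ 5
    - 2 / 3 * d%:R ^+ 3 + d%:R ^+ 1 / 15)); last first.
  move=> d d0; rewrite (powsum (Q := fun x =>
    (x ^+ 5 / 5 - x ^+ 4 / 2 + x ^+ 3 / 3 - x / 30))) //.
  - by rewrite expr0n /=; field.
  - by field.
  - by move=> n; field.
rewrite !big_split /= !sumrN -!mulr_sumr -mulr_suml divsum_scale_dual.
by move/(@eq_lincomb K (-15)); apply; field.
Qed.

(** Combined with E_4^2 = E_8, which eliminates sigma_7, this gives 2 D E_6 = E_2 E_6 - E_4^2. *)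
Lemma sigmaq1_sigmaq5 : 504 * (sigmaq 1 * sigmaq 5) + 840 * sigmaq 3 ^+ 2 =
  27 * sigmaq 7 + 21 * sigmaq 5 - 7 * sigmaq 3 + sigmaq 1 - 42 * fpsD (sigmaq 5).
Proof.
apply: fpsP => N; rewrite !(fpsBE, fpsDE) !fps_natME fpsDerE !sigmaqE.
have := divisor_identity N (fun d => d%:R ^+ 6 : K).
have -> : qsum N qtrue (fun a b _ _ => (`|a - b|)%N%:R ^+ 6 - (a + b)%:R ^+ 6) =
    - 24 * (sigmaq 1 * sigmaq 5) N - 40 * (sigmaq 3 * sigmaq 3) N :> K.
  have -> : -24 * (sigmaq 1 * sigmaq 5) N = - 12 * (sigmaq 1 * sigmaq 5) N - 12 * (sigmaq 5 * sigmaq 1) N :> K.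
    by rewrite [sigmaq 5 * _]mulrC; ring.
  rewrite -!qsumM -!qsumMl -!qsumB; apply: eq_qsum => // a b m n _ _.
  by rewrite (dist_even a b 3) natrD; ring.
rewrite -expr2.
rewrite (@eq_divsum N _ (fun d => 2 * ((N %/ d)%:R * (d%:R * d%:R ^+ 5)) - 9 / 7 * d%:R ^+ 7
    - d%:R ^+ 5 + d%:R ^+ 3 / 3 - d%:R ^+ 1 / 21)); last first.
  move=> d d0; rewrite (powsum (Q := fun x =>
    (x ^+ 7 / 7 - x ^+ 6 / 2 + x ^+ 5 / 2 - x ^+ 3 / 6 + x / 42))) //.
  - by rewrite expr0n /=; field.
  - by field.
  - by move=> n; field.
rewrite !big_split /= !sumrN -!mulr_sumr -!mulr_suml divsum_scale_dual.
by move/(@eq_lincomb K (-21)); apply; field.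
Qed.

End PolynomialCase.

(** * Eisenstein series of all weights from those of weights 2, 4, 6 *)

Section HyperbolicSeries.
Variable K : numFieldType.

Definition fps_exp (c : K) : fps K := Fps (fun j => c ^+ j / j`!%:R).

Let fact_neq0 n : n`!%:R != 0 :> K.
Proof. by rewrite pnatr_eq0 -lt0n fact_gt0. Qed.

Lemma fps_expE c j : fps_exp c j = c ^+ j / j`!%:R. Proof. by []. Qed.

Lemma fps_expD a b : fps_exp (a + b) = fps_exp a * fps_exp b.
Proof.
rewrite mulrC; apply: fpsP => n; rewrite fpsME /= exprDn mulr_suml.
apply: eq_bigr => -[i /= le_in] _; rewrite ltnS in le_in.
rewrite -mulr_natr; have := bin_fact le_in => /(congr1 (fun n => n%:R : K)).
rewrite !natrM => <-; have i0 := fact_neq0 i; have ni0 := fact_neq0 (n - i)%N.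
have := fact_neq0 n; rewrite -(bin_fact le_in) !natrM !mulf_eq0 !negb_or.
by case/andP=> b0 _; field; rewrite b0 i0 ni0.
Qed.

Lemma fps_exp0 : fps_exp 0 = 1.
Proof. by apply: fpsP => -[|n]; rewrite fps_expE ?expr0 ?divr1 // expr0n mul0r. Qed.

Lemma fpsD_exp c : fpsD (fps_exp c) = fpsX * fpsC c * fps_exp c.
Proof.
apply: fpsP => -[|n]; rewrite -mulrA fpsX_mulE ?fpsC_mulE fpsDerE ?mul0r //.
by rewrite !fps_expE factS natrM exprS; field; rewrite fact_neq0 -(natrD _ 1 n) pnatr_eq0.
Qed.

(** The series 2 cosh(n x) in a new variable x. Its product formula has the shape h(a + b) + h(|a -
    b|) of the weighted divisor identity. *)
Definition cosh2 (n : nat) : fps K := fps_exp n%:R + fps_exp (- n%:R).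

Lemma cosh2E n j : cosh2 n j = if odd j then 0 else 2 * n%:R ^+ j / j`!%:R.
Proof.
rewrite fpsDE !fps_expE exprNn -signr_odd; case: (odd j).
  by rewrite expr1; ring.
by rewrite expr0; ring.
Qed.

Lemma cosh2M a b : cosh2 a * cosh2 b = cosh2 (a + b) + cosh2 `|a - b|.
Proof.
have e : cosh2 `|a - b| = fps_exp (a%:R - b%:R) + fps_exp (b%:R - a%:R).
  case: (leqP a b) => [le_ab|/ltnW le_ba].
    by rewrite distnEr // /cosh2 natrB // opprB addrC.
  by rewrite distnEl // /cosh2 natrB // opprB.
by rewrite e /cosh2 natrD opprD !fps_expD; ring.
Qed.

Lemma cosh20 : cosh2 0 = 2.
Proof. by rewrite /cosh2 oppr0 fps_exp0. Qed.

(* [g = x ^ 2 / (e ^ x + e ^ - x - 2)] *)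
Variables g w : fps K.
Hypothesis w_def : w = cosh2 1 - 2.
Hypothesis gE : g * w = fpsX ^+ 2.

Let wE j : w j = if (j == 0%N) || odd j then 0 else 2 / j`!%:R.
Proof.
rewrite w_def fpsBE cosh2E expr1n mulr1 fps_natE; case: j => [|j] /=.
  by rewrite divr1 subrr.
by rewrite subr0.
Qed.

Lemma fps_mul_inj_cosh (f h : fps K) : f * w = h * w -> f = h.
Proof.
move=> /(congr1 (fun y => g * y)); rewrite ![g * _]mulrCA gE => e.
apply: fpsP => n; have := congr1 (fun y : fps K => y n.+2) e.
by rewrite ![_ * _ ^+ 2]mulrC !fpsXn_mulE /= subn2.
Qed.

Let g_sum n : \sum_(i < n.+1) g i * w (n.+2 - i)%N = (n == 0%N)%:R.
Proof.
have : (g * w) n.+2 = (fpsX ^+ 2 : fps K) n.+2 by rewrite gE.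
have w0 : w 0%N = 0 by rewrite wE.
have w1 : w 1%N = 0 by rewrite wE.
rewrite fpsXnE fpsME 2!big_ord_recr /= subnn subSnn w0 w1 !mulr0 !addr0 !eqSS.
by move=> <-.
Qed.

Let g_rec n : g n = (n == 0%N)%:R - \sum_(i < n) g i * w (n.+2 - i)%N.
Proof.
rewrite -g_sum big_ord_recr /= -addn2 addKn addn2 addrC addrK.
by rewrite wE /= divff // mulr1.
Qed.

Lemma sinh_odd n : odd n -> g n = 0.
Proof.
elim/ltn_ind: n => n IH odd_n; rewrite g_rec; case: n odd_n IH => [|n] // odd_n IH.
rewrite big1 ?subr0 // => -[i /= lt_in] _.
case odd_i: (odd i); first by rewrite IH ?mul0r.
have le : (i <= n.+3)%N by lia.
have odd3 : odd n.+3 by rewrite /= negbK.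
by rewrite wE oddB // odd_i addbF odd3 orbT mulr0.
Qed.

(** The general value is g n = (1 - n) B_n / n!; those at 4 and 6 start the recursion of the higher
    weights. *)
Lemma sinh_values :
  [/\ g 0%N = 1, g 2%N = - 1 / 12, g 4%N = 1 / 240 & g 6%N = - 1 / 6048].
Proof.
have g0 : g 0%N = 1 by rewrite g_rec big_ord0 subr0.
have odd0 j : odd j -> g j = 0 by exact: sinh_odd.
have w4 : w 4%N = 1 / 12 by rewrite wE -[4`!%N]/24%N /=; field.
have w6 : w 6%N = 1 / 360 by rewrite wE -[6`!%N]/720%N /=; field.
have w8 : w 8%N = 1 / 20160 by rewrite wE -[8`!%N]/(8 * 7 * 720)%N !natrM /=; field.
have g2 : g 2%N = - 1 / 12.
  rewrite g_rec !big_ord_recr big_ord0 /= !(subSS, subn0) g0 (odd0 1%N isT) w4; by field.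
have g4 : g 4%N = 1 / 240.
  rewrite g_rec !big_ord_recr big_ord0 /= !(subSS, subn0) g0 g2 (odd0 1%N isT) (odd0 3%N isT).
  by rewrite w4 w6; field.
split; [exact: g0|exact: g2|exact: g4|].
rewrite g_rec !big_ord_recr big_ord0 /= !(subSS, subn0) g0 g2 g4.
by rewrite (odd0 1%N isT) (odd0 3%N isT) (odd0 5%N isT) w4 w6 w8; field.
Qed.

(** For P = g / x^2 = 1 / (4 sinh(x/2)^2) this is P'' = 6 P^2 + P, a degenerate Weierstrass
    equation; the factor x^-2 turns x^2 d^2/dx^2 into (D - 2)(D - 3), where D = x d/dx. *)
Lemma sinh_ode : 6 * g ^+ 2 = fpsD (fpsD g) - 5 * fpsD g + 6 * g - fpsX ^+ 2 * g.
Proof.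
have DX2 : fpsD (fpsX ^+ 2) = 2 * fpsX ^+ 2 :> fps K by rewrite fpsDXn /= fpsDX; ring.
pose k := fps_exp 1 - fps_exp (- 1).
have Dw : fpsD w = fpsX * k.
  rewrite w_def !raddfB /= raddfD /= !fpsD_exp fpsD_nat rmorphN rmorph1 /k; ring.
have Dk : fpsD k = fpsX * (w + 2).
  rewrite /k raddfB /= !fpsD_exp rmorphN rmorph1 w_def /cosh2; ring.
have k2 : k ^+ 2 = w * (w + 4).
  have e : fps_exp 1 * fps_exp (- 1) = 1 :> fps K by rewrite -fps_expD subrr fps_exp0.
  rewrite w_def /k /cosh2; apply/eqP; rewrite -subr_eq0; apply/eqP.
  transitivity (4 * (1 - fps_exp 1 * fps_exp (- 1)) : fps K); first by ring.
  by rewrite e subrr mulr0.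
have e1 : fpsD g * w = 2 * fpsX ^+ 2 - g * (fpsX * k).
  have := congr1 (@fpsD K) gE; rewrite (fpsDM g w) Dw DX2 => e.
  by rewrite -[LHS](addrK (g * (fpsX * k))) e; ring.
have e2 : fpsD (fpsD g) * w = 4 * fpsX ^+ 2 - 2 * fpsD g * (fpsX * k)
    - g * (fpsX * k + fpsX ^+ 2 * (w + 2)).
  have := congr1 (@fpsD K) e1.
  rewrite raddfB /= (fpsDM (fpsD g) w) (fpsDM 2 (fpsX ^+ 2)) (fpsDM g (fpsX * k)).
  rewrite (fpsDM fpsX k) fpsDX Dk Dw DX2 fpsD_nat => e.
  by rewrite -[LHS](addrK (fpsD g * (fpsX * k))) e; ring.
(* Multiplying twice by w removes the derivatives of g; what is left is settled by g w = x^2 and by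
   k^2 = w (w + 4), that is (2 sinh x)^2 in terms of w. *)
apply: fps_mul_inj_cosh; apply: fps_mul_inj_cosh; apply: subr0_eq.
have -> : 6 * g ^+ 2 * w * w = 6 * (g * w) ^+ 2 by ring.
have -> : (fpsD (fpsD g) - 5 * fpsD g + 6 * g - fpsX ^+ 2 * g) * w * w =
  (fpsD (fpsD g) * w) * w - 5 * (fpsD g * w) * w + 6 * (g * w) * w - fpsX ^+ 2 * (g * w) * w.
  by ring.
rewrite e2.
have -> : (4 * fpsX ^+ 2 - 2 * fpsD g * (fpsX * k) - g * (fpsX * k + fpsX ^+ 2 * (w + 2))) * w =
  4 * fpsX ^+ 2 * w - 2 * (fpsD g * w) * (fpsX * k) - (g * w) * (fpsX * k + fpsX ^+ 2 * (w + 2)).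
  by ring.
rewrite e1 gE.
have k2' : g * k ^+ 2 = fpsX ^+ 2 * (w + 4) by rewrite k2 mulrA gE.
transitivity (- 2 * fpsX ^+ 2 * (g * k ^+ 2 - fpsX ^+ 2 * (w + 4))
   - 5 * fpsX * k * (g * w - fpsX ^+ 2)); last by rewrite k2' gE !subrr !mulr0 subrr.
by ring.
Qed.

Lemma sinh_conv n : 6 * (\sum_(i < n.+1) g i * g (n - i)%N) =
  (n%:R - 2) * (n%:R - 3) * g n - (if n is n'.+2 then g n' else 0).
Proof.
have := congr1 (fun y : fps K => y n) sinh_ode.
rewrite fps_natME expr2 fpsME !(fpsBE, fpsDE) !fps_natME !fpsDerE fpsXn_mulE => ->.
by case: n => [|[|n]] /=; rewrite ?subn2 /=; ring.
Qed.

(** The Fejer kernel: the sum of (d - |a|) e^(a x) over |a| < d is (2 cosh(d x) - 2) / w. Here [T]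
    is twice this kernel, and its increments [U] are twice the Dirichlet kernels. *)
Lemma cosh_triangle d :
  fpsX ^+ 2 * (2 * (\sum_(1 <= a < d) (d%:R - a%:R) * cosh2 a) + d%:R * 2) =
  2 * g * (cosh2 d - 2).
Proof.
pose T d : fps K := 2 * (\sum_(1 <= a < d) (d%:R - a%:R) * cosh2 a) + d%:R * 2.
pose U d : fps K := 2 + 2 * \sum_(1 <= a < d.+1) cosh2 a.
have TS e : T e.+1 = T e + U e.
  rewrite /T /U; case: e => [|e]; first by rewrite !big_geq //; ring.
  rewrite big_nat_recr //= -[e.+2%:R]natr1.
  have -> : \sum_(1 <= a < e.+1) (e.+1%:R + 1 - a%:R) * cosh2 a =
    \sum_(1 <= a < e.+1) (e.+1%:R - a%:R) * cosh2 a + \sum_(1 <= a < e.+1) cosh2 a.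
    by rewrite -big_split /=; apply: eq_bigr => a _; ring.
  by rewrite [\sum_(1 <= a < e.+2) _]big_nat_recr //=; ring.
have Uw e : w * U e = 2 * (cosh2 e.+1 - cosh2 e).
  rewrite /U w_def; elim: e => [|e IH]; first by rewrite big_geq // cosh20; ring.
  rewrite big_nat_recr //= -[RHS]/(2 * (cosh2 e.+2 - cosh2 e.+1)).
  have := cosh2M e.+1 1; rewrite addn1 distnEl // subSS subn0 => eh.
  have -> : cosh2 e.+2 = cosh2 e.+1 * cosh2 1 - cosh2 e by rewrite eh addrK.
  transitivity ((cosh2 1 - 2) * (2 + 2 * \sum_(1 <= i < e.+1) cosh2 i)
     + 2 * (cosh2 1 - 2) * cosh2 e.+1); first by ring.
  by rewrite IH; ring.
have Tw e : w * T e = 2 * (cosh2 e - 2).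
  elim: e => [|e IH]; first by rewrite /T big_geq // cosh20; ring.
  by rewrite TS mulrDr IH Uw; ring.
by rewrite -gE -mulrA -/(T d) Tw; ring.
Qed.

End HyperbolicSeries.

Section EisensteinRecursion.
Variables (K : numFieldType) (g w : fps K).
Hypothesis w_def : w = cosh2 K 1 - 2.
Hypothesis gE : g * w = fpsX ^+ 2.

Definition coshsum (n : nat) : fps K := divsum (fun d => d%:R * cosh2 K d n).

Lemma coshsumE n N : coshsum n N = \sum_(d <- divs N) d%:R * cosh2 K d n.
Proof. by []. Qed.

Lemma coshsum_sigmaq n :
  coshsum n = if odd n then 0 else fpsC (2 / n`!%:R) * sigmaq K n.+1.
Proof.
apply: fpsP => N; rewrite coshsumE; case: ifP => odd_n.
  by rewrite big1 // => d _; rewrite cosh2E odd_n mulr0.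
rewrite fpsC_mulE sigmaqE mulr_sumr; apply: eq_bigr => d _.
by rewrite cosh2E odd_n exprS; ring.
Qed.

(** In [fps (fps K)] the outer variable is x, and the coefficients are series in q. *)
Let gC : fps (fps K) := Fps (fun n => fpsC (g n)).
Let V : fps (fps K) := Fps coshsum.

(* [x ^ 2] times the Weierstrass function, up to an additive constant *)
Definition wpq : fps (fps K) := gC + fpsX ^+ 2 * V.

Let X2E (A : comNzRingType) (f : fps A) n : (fpsX ^+ 2 * f) n.+2 = f n.
Proof. by rewrite fpsXn_mulE !subSS subn0. Qed.

Let X2E' (A : comNzRingType) (f : fps A) n : (fpsX ^+ 2 * f) n =
  if n is n'.+2 then f n' else 0.
Proof. by case: n => [|[|n]]; rewrite fpsXn_mulE // !subSS subn0. Qed.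

(** The product formula of cosh makes the left side a convolution; the factor x^2 = g w allows the
    inner sums over a < d to be evaluated as Fejer kernels. *)
Let weighted_identity_cosh N :
  fpsX ^+ 2 * (6 * qsum N qtrue (fun a b _ _ => (a%:R * cosh2 K a) * (b%:R * cosh2 K b))) =
  fpsX ^+ 2 * (24 * qsum N qtrue (fun a b _ _ => (a%:R * cosh2 K a) * b%:R)
    + \sum_(d <- divs N) (d%:R ^+ 3 - d%:R) * cosh2 K d
    + 12 * N%:R * \sum_(d <- divs N) d%:R)
  - 12 * (g * (\sum_(d <- divs N) d%:R * cosh2 K d - 2 * \sum_(d <- divs N) d%:R)).
Proof.
have := weighted_divisor_identity N (cosh2 K); rewrite cosh20.
rewrite (@eq_qsum _ N _ qtrue (fun a b _ _ => (a * b)%:R * (cosh2 K (a + b) + cosh2 K `|a - b|))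
  (fun a b _ _ => (a%:R * cosh2 K a) * (b%:R * cosh2 K b))) //; last first.
  by move=> a b m n _ _; rewrite -cosh2M natrM; ring.
rewrite (@eq_qsum _ N _ qtrue (fun a b _ _ => (a * b)%:R * cosh2 K a)
  (fun a b _ _ => (a%:R * cosh2 K a) * b%:R)) //; last first.
  by move=> a b m n _ _; rewrite natrM; ring.
move=> ->.
have e : fpsX ^+ 2 * \sum_(d <- divs N) ((d%:R ^+ 3 - d%:R) * cosh2 K d
      - 12 * d%:R * \sum_(1 <= a < d) (d%:R - a%:R) * cosh2 K a - 6 * d%:R ^+ 2 * 2) =
   fpsX ^+ 2 * (\sum_(d <- divs N) (d%:R ^+ 3 - d%:R) * cosh2 K d)
   - 12 * (g * (\sum_(d <- divs N) d%:R * cosh2 K d - 2 * \sum_(d <- divs N) d%:R)).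
  rewrite [2 * \sum_(d <- _) _]mulr_sumr -sumrB !mulr_sumr -sumrB; apply: eq_bigr => d _.
  have := cosh_triangle w_def gE d => t.
  set s := \sum_(1 <= a < d) _ in t *.
  transitivity (fpsX ^+ 2 * ((d%:R ^+ 3 - d%:R) * cosh2 K d) - 6 * d%:R * (fpsX ^+ 2 * (2 * s + d%:R * 2))).
    by ring.
  by rewrite t; ring.
rewrite !mulrDr e; ring.
Qed.

Let coshsum_conv n : (0 < n)%N -> 6 * (V * V) n =
  24 * (sigmaq K 1 * coshsum n) + (n.+2 * n.+1)%:R * coshsum n.+2 - coshsum n
  - 12 * (gC * V) n.+2 + 24 * (fpsC (g n.+2) * sigmaq K 1).
Proof.
move=> n0; apply: fpsP => N.
have := congr1 (fun y : fps K => y n.+2) (weighted_identity_cosh N).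
rewrite fpsBE !X2E 2!fpsDE !fps_natME.
(* This term is constant in x; it disappears because n > 0. *)
have -> : (12 * N%:R * \sum_(d <- divs N) d%:R : fps K) n = 0.
  by rewrite -natr_sum -!natrM fps_natE; case: n n0.
have -> : (qsum N qtrue (fun a b _ _ => a%:R * cosh2 K a * (b%:R * cosh2 K b))) n
    = (V * V) n N.
  rewrite [in RHS]fpsME fps_sumE /qsum fps_sumE.
  under [RHS]eq_bigr => i _ do rewrite divsumM /qsum.
  rewrite [RHS]exchange_big; apply: eq_bigr => x _.
  rewrite fpsME; apply: eq_bigr => i _.
  by rewrite !fps_natME.
have -> : (qsum N qtrue (fun a b _ _ => a%:R * cosh2 K a * b%:R)) n
    = (sigmaq K 1 * coshsum n) N.
  rewrite mulrC divsumM /qsum fps_sumE; apply: eq_bigr => x _.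
  by rewrite mulrC !fps_natME mulrC expr1.
have -> : (\sum_(d <- divs N) (d%:R ^+ 3 - d%:R) * cosh2 K d) n =
    (n.+2 * n.+1)%:R * coshsum n.+2 N - coshsum n N.
  rewrite fps_sumE !coshsumE mulr_sumr -sumrB; apply: eq_bigr => d _.
  rewrite mulrBl fpsBE -natrX !fps_natME natrX !cosh2E /= negbK.
  case: (odd n); first by rewrite !mulr0 subr0.
  rewrite !factS !natrM; have : n`!%:R != 0 :> K by rewrite pnatr_eq0 -lt0n fact_gt0.
  rewrite !exprS => nf; field; rewrite nf -(natrD _ 1 n) -(natrD _ 2 n) !pnatr_eq0 //.
have -> : (g * (\sum_(d <- divs N) d%:R * cosh2 K d - 2 * \sum_(d <- divs N) d%:R)) n.+2 =
   (gC * V) n.+2 N - 2 * (g n.+2 * sigmaq K 1 N).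
  rewrite mulrBr fpsBE; congr (_ - _).
    rewrite [in RHS]fpsME fps_sumE [LHS]fpsME; apply: eq_bigr => i _.
    rewrite fpsC_mulE coshsumE fps_sumE; congr (_ * _); apply: eq_bigr => d _.
    by rewrite fps_natME.
  rewrite -natr_sum -natrM mulrC fps_natME sigmaqE natrM natr_sum; ring.
rewrite !(fpsDE, fpsNE) !fps_natME fpsC_mulE => ->; ring.
Qed.

Lemma wpqE n : wpq n = fpsC (g n) + (if n is n'.+2 then coshsum n' else 0).
Proof. by rewrite fpsDE X2E'. Qed.

Let wpq_sqr n : (wpq * wpq) n.+4 = (gC * gC) n.+4 + 2 * (gC * V) n.+2 + (V * V) n.
Proof.
have e (a b c : fps (fps K)) : (a + (fpsX ^+ 2 * b + fpsX ^+ 2 * (fpsX ^+ 2 * c))) n.+4 =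
    a n.+4 + (b n.+2 + c n) by rewrite 2!fpsDE 3!X2E.
have -> : wpq * wpq = gC * gC + (fpsX ^+ 2 * (2 * (gC * V)) + fpsX ^+ 2 * (fpsX ^+ 2 * (V * V))).
  by rewrite /wpq; ring.
by rewrite e (fps_natME 2) addrA.
Qed.

Let gC_sqr n : 6 * (gC * gC) n.+2 =
  (n.+2%:R - 2) * (n.+2%:R - 3) * fpsC (g n.+2) - fpsC (g n).
Proof.
transitivity (fpsC ((n.+2%:R - 2) * (n.+2%:R - 3) * g n.+2 - g n)); last first.
  by rewrite rmorphB !rmorphM !rmorphB !rmorph_nat.
rewrite -(sinh_conv w_def gE n.+2) rmorphM rmorph_nat fpsME rmorph_sum.
by congr (_ * _); apply: eq_bigr => i _; rewrite rmorphM.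
Qed.

(** Put P = wpq / x^2. Then P + E_2/12 is a Weierstrass function p with p'' = 6 p^2 - const; the
    shift by E_2/12 produces the linear term, and n > 0 keeps away from the constant. *)
Let wpq_conv n : (0 < n)%N -> 6 * (wpq * wpq) n.+4 =
  ((n.+4%:R - 2) * (n.+4%:R - 3)) * wpq n.+4 + (24 * sigmaq K 1 - 1) * wpq n.+2.
Proof.
move=> n0; rewrite wpq_sqr 2!(mulrDr 6) coshsum_conv // gC_sqr !wpqE natrM.
have -> : n.+4%:R = n.+1%:R + 3 :> fps K by rewrite -natrD addn3.
have -> : n.+2%:R = n.+1%:R + 1 :> fps K by rewrite natr1.
by ring.
Qed.

Lemma wpq_odd n : odd n -> wpq n = 0.
Proof.
move=> odd_n; rewrite wpqE (sinh_odd w_def gE odd_n) rmorph0 add0r.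
case: n odd_n => [|[|n]] // odd_n; have o : odd n by rewrite -[odd n]negbK.
by rewrite coshsum_sigmaq o.
Qed.

(** The terms with i <= 2 and their mirror images are taken out of the convolution. With N = n + 4,
    those in wpq N turn (N - 2)(N - 3) into (N - 6)(N + 1), and 12 wpq 2 = - E_2 cancels the linear
    term, so that nothing quasimodular remains. *)
Lemma wpq_rec n : (0 < n)%N ->
  (n.+4%:R - 6) * (n.+4%:R + 1) * wpq n.+4 =
  6 * \sum_(3 <= i < n.+2) wpq i * wpq (n.+4 - i)%N.
Proof.
case: n => [//|n] _; have := @wpq_conv n.+1 isT.
have w0 : wpq 0%N = 1.
  by rewrite wpqE addr0; have [-> _ _ _] := sinh_values w_def gE; rewrite rmorph1.
have w1 : wpq 1%N = 0 by apply: wpq_odd.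
have w2 : 12 * wpq 2%N = 24 * sigmaq K 1 - 1.
  have c1 : 12 * fpsC (- 1 / 12) = - 1 :> fps K.
    rewrite -(rmorph_nat fpsC 12) -rmorphM.
    by have -> : 12 * (-1 / 12) = -1 :> K; [field|rewrite rmorphN1].
  have c2 : fpsC (2 / 0`!%:R) = 2 :> fps K by rewrite divr1 rmorph_nat.
  rewrite wpqE; have [_ -> _ _] := sinh_values w_def gE.
  by rewrite coshsum_sigmaq c2 mulrDr c1; ring.
move: w0 w1 w2; move: wpq => G w0 w1 w2.
rewrite fpsME -(big_mkord xpredT (fun i => G i * G (n.+4.+1 - i)%N)).
rewrite big_ltn // big_ltn // big_ltn // 3?big_nat_recr //=.
rewrite subn0 !subSS subn0 subnn subSnn.
have -> : (n.+2 - n = 2)%N by rewrite -addn2 addKn.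
rewrite w0 w1 !mul1r !mul0r !mulr1 !mulr0 !add0r.
set S := \sum_(_ <= _ < _) _ => e.
apply: (@eq_lincomb _ (-1) _ _ _ _ e).
rewrite -w2; ring.
Qed.

End EisensteinRecursion.

(** * The modular system of level 12 *)

Section PolynomialEvaluation.
Variable K : comNzRingType.
Implicit Types (t : fps K) (P Q : {poly K}).

Definition peval t : {poly K} -> fps K := horner_morph (fun a => mulrC t (fpsC a)).

HB.instance Definition _ t := GRing.RMorphism.on (peval t).

Lemma pevalX t : peval t 'X = t. Proof. exact: horner_morphX. Qed.
Lemma pevalC t c : peval t c%:P = fpsC c. Proof. exact: horner_morphC. Qed.

Lemma peval_MXaddC t P c : peval t (P * 'X + c%:P) = peval t P * t + fpsC c.
Proof. by rewrite rmorphD rmorphM /= pevalX pevalC. Qed.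

Lemma fpsD_peval t P : fpsD (peval t P) = peval t P^`() * fpsD t.
Proof.
elim/poly_ind: P => [|P c IH]; first by rewrite deriv0 !rmorph0 raddf0 mul0r.
rewrite derivD derivM derivX derivC mulr1 addr0 peval_MXaddC.
rewrite rmorphD rmorphM /= pevalX raddfD /= fpsDM fpsDC IH; ring.
Qed.

Lemma peval0E t P : t 0%N = 0 -> peval t P 0%N = P.[0].
Proof.
move=> t0; elim/poly_ind: P => [|P c IH]; first by rewrite rmorph0 horner0.
rewrite peval_MXaddC fpsDE fpsM0E t0 mulr0 add0r.
by rewrite hornerMXaddC mulr0 add0r.
Qed.

Lemma eqfps_peval n t t' P : eqfps n t t' -> eqfps n (peval t P) (peval t' P).
Proof.
move=> e; elim/poly_ind: P => [|P c IH]; first by rewrite !rmorph0.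
rewrite !peval_MXaddC; apply: eqfpsD => //.
exact: eqfpsM.
Qed.

(** Linearization at q^n: when the factors agree below n, only the two extreme terms of the
    convolution differ. *)
Lemma fpsM_diff n (f f' g g' : fps K) : (0 < n)%N -> eqfps n f f' -> eqfps n g g' ->
  (f * g) n - (f' * g') n = f 0%N * (g n - g' n) + (f n - f' n) * g 0%N.
Proof.
case: n => [//|n] _ ef eg; rewrite !fpsME ![\sum_(_ < n.+2) _]big_ord_recl ![\sum_(_ < n.+1) _]big_ord_recr /=.
rewrite !subnn !subn0 -(ef 0%N) // -(eg 0%N) //.
have -> : \sum_(i < n) f (bump 0 i) * g (n.+1 - bump 0 i)%N =
          \sum_(i < n) f' (bump 0 i) * g' (n.+1 - bump 0 i)%N.
  by apply: eq_bigr => -[i /= lt] _; rewrite ef ?eg // /bump /=; lia.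
by rewrite /bump /= add1n; ring.
Qed.

End PolynomialEvaluation.

Section ModularSystem.
Variable K : numFieldType.
Variables (R p8 : {poly K}).
Hypothesis R0 : R.[0] = 1.
Hypothesis p80 : p8.[0] = 0.

(** A triple closed under D: L is the quasimodular logarithmic derivative of W, and D L - L^2, being
    modular of weight 4, is W^4 times a polynomial in t. *)
Record modular_system (t W L : fps K) : Prop := ModularSystem {
  msys_t : fpsD t = t * W ^+ 2 * peval t R;
  msys_W : fpsD W = W * L;
  msys_L : fpsD L = L ^+ 2 + W ^+ 4 * peval t p8;
  msys_t0 : t 0%N = 0;
  msys_t1 : t 1%N = 1;
  msys_W0 : W 0%N = 1;
  msys_L0 : L 0%N = 0 }.

Let trunc (s : nat -> K * K * K) n : fps K * fps K * fps K :=
  (Fps (fun m => if (m < n)%N then (s m).1.1 else 0),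
   Fps (fun m => if (m < n)%N then (s m).1.2 else 0),
   Fps (fun m => if (m < n)%N then (s m).2 else 0)).

Lemma modular_system_exists : exists t W L, modular_system t W L.
Proof.
(* With t = q u, the n-th coefficients are found in the order L, W, u: n L_n depends on smaller
   indices only (as p8(0) = 0), n W_n also on L_n, and n u_n also on 2 W_n. *)
pose step (s : nat -> K * K * K) n : K * K * K :=
  let: (u, W, L) := trunc s n in let t := fpsX * u in
  let l := (L ^+ 2 + W ^+ 4 * peval t p8) n / n%:R in
  let w := ((W * L) n + l) / n%:R in
  if n is 0 then (1, 1, 0) else
  (((u * (W ^+ 2 * peval t R - 1)) n + 2 * w) / n%:R, w, l).
have [|s sE] := @strong_recursion (K * K * K) (0, 0, 0) step _.
  move=> n f h e; rewrite /step.
  suff -> : trunc f n = trunc h n by [].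
  by congr (_, _, _); apply: fpsP => m /=; case: ifP => // /e ->.
pose u : fps K := Fps (fun n => (s n).1.1); pose W : fps K := Fps (fun n => (s n).1.2).
pose L : fps K := Fps (fun n => (s n).2); pose t := fpsX * u.
pose u' n : fps K := (trunc s n).1.1; pose W' n : fps K := (trunc s n).1.2.
pose L' n : fps K := (trunc s n).2.
have eu n : eqfps n u (u' n) by move=> m /= ->.
have eW n : eqfps n W (W' n) by move=> m /= ->.
have eL n : eqfps n L (L' n) by move=> m /= ->.
have et n : eqfps n.+1 t (fpsX * u' n) by apply: eqfpsXM.
have u'n n : u' n n = 0 by rewrite /= ltnn.
have W'n n : W' n n = 0 by rewrite /= ltnn.
have L'n n : L' n n = 0 by rewrite /= ltnn.
have u0 : u 0%N = 1 by rewrite /= sE.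
have W0 : W 0%N = 1 by rewrite /= sE.
have L0 : L 0%N = 0 by rewrite /= sE.
have t0 : t 0%N = 0 by rewrite fpsX_mulE.
have n0 n : n.+1%:R != 0 :> K by rewrite pnatr_eq0.
have Ln n : n.+1%:R * L n.+1 = (L' n.+1 ^+ 2 + W' n.+1 ^+ 4 * peval (fpsX * u' n.+1) p8) n.+1.
  by rewrite [L _]/= sE /step /= -/(L' n.+1) mulrC divfK.
have Wn n : n.+1%:R * W n.+1 = (W' n.+1 * L' n.+1) n.+1 + L n.+1.
  by rewrite [W _]/= [L _]/= sE /step /= mulrC divfK.
have un n : n.+1%:R * u n.+1 = (u' n.+1 * (W' n.+1 ^+ 2 * peval (fpsX * u' n.+1) R - 1)) n.+1 + 2 * W n.+1.
  by rewrite [u _]/= [W _]/= sE /step /= mulrC divfK.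
have DL : fpsD L = L ^+ 2 + W ^+ 4 * peval t p8.
  apply: fpsP => -[|n]; rewrite fpsDerE.
    by rewrite mul0r fpsDE fpsM0E peval0E // p80 fpsX0E L0 expr0n mulr0 addr0.
  rewrite Ln; apply/esym/subr0_eq; rewrite !fpsDE opprD addrACA.
  rewrite !expr2 fpsM_diff // fpsM_diff //; last 2 first.
  - by apply: eqfpsX.
  - by move=> m lt; apply: eqfps_peval (et n.+1) _ _; apply: leq_trans lt _.
  by rewrite L0 peval0E // p80 (eqfps_peval p8 (et n.+1)) // subrr; ring.
have DW : fpsD W = W * L.
  apply: fpsP => -[|n]; rewrite fpsDerE; first by rewrite mul0r fpsM0E L0 mulr0.
  rewrite Wn; apply/esym/subr0_eq; rewrite opprD addrA fpsM_diff // L'n W'n W0 L0; ring.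
have Du : fpsD u = u * (W ^+ 2 * peval t R - 1).
  apply: fpsP => -[|n]; rewrite fpsDerE.
    by rewrite mul0r fpsM0E fpsBE fpsM0E peval0E // R0 fpsX0E W0 expr1n mulr1 subrr mulr0.
  have eR : eqfps n.+2 (peval t R) (peval (fpsX * u' n.+1) R) by apply: eqfps_peval.
  have eW2 : eqfps n.+1 (W ^+ 2) (W' n.+1 ^+ 2) by apply: eqfpsX.
  have eR' : eqfps n.+1 (peval t R) (peval (fpsX * u' n.+1) R).
    by move=> m lt; apply: eR; apply: leq_trans lt _.
  have eH : eqfps n.+1 (W ^+ 2 * peval t R - 1) (W' n.+1 ^+ 2 * peval (fpsX * u' n.+1) R - 1).
    by apply: eqfpsD => //; apply: eqfpsM.
  rewrite un; apply/esym/subr0_eq; rewrite opprD addrA fpsM_diff // !fpsBE.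
  have -> a b c : (a - b) - (c - b) = a - c :> K by ring.
  rewrite fpsM_diff // (eR n.+1) // !expr2 fpsM_diff // !fpsM0E.
  by rewrite fps1E peval0E // R0 W0 u0 W'n /=; ring.
exists t, W, L; split=> //; last by rewrite fpsX_mulE.
by rewrite fpsDM fpsDX Du /t; ring.
Qed.

End ModularSystem.

(** * Ramanujan's differential system *)

Section Ramanujan.
Variable K : numFieldType.

(* Ramanujan's differential system, normalized so that it does not depend on
   the level: it is satisfied by [r E2(q^r) / 12, r^2 E4(q^r) / 144,
   r^3 E6(q^r) / 432] for every [r]. *)
Record ramanujan_system (y2 y4 y6 : fps K) : Prop := RamanujanSystem {
  ramanujan2 : fpsD y2 = y2 ^+ 2 - y4;
  ramanujan4 : fpsD y4 = 4 * y2 * y4 - y6;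
  ramanujan6 : fpsD y6 = 6 * y2 * y6 - 24 * y4 ^+ 2 }.

(* The only resonance is at [n = r], where the discriminant decides. *)
Lemma ramanujan_unique (r : nat) (y2 y4 y6 z2 z4 z6 : fps K) : (0 < r)%N ->
    ramanujan_system y2 y4 y6 -> ramanujan_system z2 z4 z6 ->
    y2 0%N = r%:R / 12 -> y4 0%N = (r%:R / 12) ^+ 2 -> y6 0%N = 4 * (r%:R / 12) ^+ 3 ->
    z2 0%N = y2 0%N -> z4 0%N = y4 0%N -> z6 0%N = y6 0%N ->
    (16 * y4 ^+ 3 - y6 ^+ 2) r = (16 * z4 ^+ 3 - z6 ^+ 2) r ->
  [/\ y2 = z2, y4 = z4 & y6 = z6].
Proof.
move=> r0 [Dy2 Dy4 Dy6] [Dz2 Dz4 Dz6] y20 y40 y60 z20 z40 z60 disc.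
suff IH n : [/\ eqfps n y2 z2, eqfps n y4 z4 & eqfps n y6 z6].
  by split; apply: eqfps_all => n; have [] := IH n.
elim: n => [|n [e2 e4 e6]]; first by [].
have ext (f g : fps K) : eqfps n f g -> f n - g n = 0 -> eqfps n.+1 f g.
  by move=> e /subr0_eq en m; rewrite ltnS leq_eqVlt => /orP[/eqP->|/e].
case: (posnP n) => [n0|n_gt0].
  by subst n; split; apply: ext => //; rewrite (z20, z40, z60) subrr.
have [a aE] : exists a : K, a = r%:R / 12 by exists (r%:R / 12).
have [d2 d2E] : exists d, d = y2 n - z2 n by exists (y2 n - z2 n).
have [d4 d4E] : exists d, d = y4 n - z4 n by exists (y4 n - z4 n).
have [d6 d6E] : exists d, d = y6 n - z6 n by exists (y6 n - z6 n).
have natE (m : nat) (f : fps K) : (m%:R * f) n = m%:R * f n := fps_natME m f n.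
(* The differences at q^n satisfy the system linearized at the constant terms a, a^2, 4 a^3. *)
have q2 : n%:R * d2 = 2 * a * d2 - d4.
  have := congr1 (fun f : fps K => f n) Dy2; have := congr1 (fun f : fps K => f n) Dz2.
  rewrite !fpsDerE !fpsBE !expr2 => e e'; rewrite d2E d4E mulrBr e e'.
  have := fpsM_diff n_gt0 e2 e2; rewrite y20 -d2E -aE => p.
  have -> : (y2 * y2) n = (z2 * z2) n + (a * d2 + d2 * a) by rewrite -p; ring.
  ring.
have q4 : n%:R * d4 = 4 * (a * d4 + d2 * a ^+ 2) - d6.
  have := congr1 (fun f : fps K => f n) Dy4; have := congr1 (fun f : fps K => f n) Dz4.
  rewrite !fpsDerE !fpsBE -!mulrA !natE => e e'; rewrite d4E d6E mulrBr e e'.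
  have := fpsM_diff n_gt0 e2 e4; rewrite y20 y40 -d2E -d4E -aE => p.
  have -> : (y2 * y4) n = (z2 * z4) n + (a * d4 + d2 * a ^+ 2) by rewrite -p; ring.
  ring.
have q6 : n%:R * d6 = 6 * (a * d6 + d2 * (4 * a ^+ 3)) - 48 * a ^+ 2 * d4.
  have := congr1 (fun f : fps K => f n) Dy6; have := congr1 (fun f : fps K => f n) Dz6.
  rewrite !fpsDerE !fpsBE -!mulrA !natE !expr2 => e e'; rewrite d6E mulrBr e e'.
  have := fpsM_diff n_gt0 e2 e6; rewrite y20 y60 -d2E -d6E -aE => p.
  have -> : (y2 * y6) n = (z2 * z6) n + (a * d6 + d2 * (4 * a ^+ 3)) by rewrite -p; ring.
  have := fpsM_diff n_gt0 e4 e4; rewrite y40 -d4E -aE => p'.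
  have -> : (y4 * y4) n = (z4 * z4) n + (a ^+ 2 * d4 + d4 * a ^+ 2) by rewrite -p'; ring.
  ring.
have d4' : d4 = (2 * a - n%:R) * d2 by apply: (eq_lincomb (c := 1) q2); ring.
have d6' : d6 = 4 * (a * d4 + d2 * a ^+ 2) - n%:R * d4 by apply: (eq_lincomb (c := 1) q4); ring.
(* Elimination of d4 and d6 leaves the characteristic polynomial of the linearized system. *)
have char : n%:R ^+ 2 * (n%:R - r%:R) * d2 = 0.
  move: q6; rewrite d6' d4' => e; by apply: (eq_lincomb (c := 1) e); rewrite aE; field.
have d20 : d2 = 0.
  move/eqP: char; rewrite !mulf_eq0 !pnatr_eq0 eqn0Ngt n_gt0 /=.
  (* At n = r = 12 a the differences form a multiple of one vector, d2 (1, - 10 a, 84 a^2), along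
     which 16 y4^3 - y6^2 varies by - 1152 a^5 d2, so equal discriminants force d2 = 0. *)
  rewrite subr_eq0 eqr_nat => /orP[/eqP nr|/eqP //]; subst r.
  have X3 (f : fps K) : f ^+ 3 = f * (f * f) by rewrite exprS expr2.
  move: disc; rewrite !fpsBE !natE !X3 !expr2.
  have e44 : eqfps n (y4 * y4) (z4 * z4) by apply: eqfpsM.
  have := fpsM_diff n_gt0 e4 e44; rewrite (fpsM_diff n_gt0 e4 e4) !fpsM0E y40 -d4E -aE => p.
  have := fpsM_diff n_gt0 e6 e6; rewrite y60 -d6E -aE => p'.
  have -> : (y4 * (y4 * y4)) n = (z4 * (z4 * z4)) n + (a ^+ 2 * (a ^+ 2 * d4 + d4 * a ^+ 2) + d4 * (a ^+ 2 * a ^+ 2)).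
    by rewrite -p; ring.
  have -> : (y6 * y6) n = (z6 * z6) n + (4 * a ^+ 3 * d6 + d6 * (4 * a ^+ 3)) by rewrite -p'; ring.
  have na : n%:R = 12 * a by rewrite aE; field.
  move=> e; have : a ^+ 5 * d2 = 0.
    by apply: (eq_lincomb (c := - 1 / 1152) e); rewrite d6' d4' na; field.
  move/eqP; rewrite mulf_eq0 expf_eq0 /= => /orP[|/eqP //].
  by rewrite aE mulf_eq0 invr_eq0 !pnatr_eq0 orbF => /eqP n0; rewrite n0 in n_gt0.
by split; apply: ext => //; rewrite -?d2E -?d4E -?d6E ?d6' ?d4' d20; ring.
Qed.

Definition eisq2 (r : nat) : fps K := fpsC (r%:R / 12) * fps_subst r (1 - 24 * sigmaq K 1).
Definition eisq4 (r : nat) : fps K := fpsC ((r%:R / 12) ^+ 2) * fps_subst r (1 + 240 * sigmaq K 3).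
Definition eisq6 (r : nat) : fps K := fpsC (4 * (r%:R / 12) ^+ 3) * fps_subst r (1 - 504 * sigmaq K 5).

(** The divisor sum identities are Ramanujan's equations at r = 1; substituting q^r multiplies D by
    r = 12 a, which the powers of a absorb. *)
Lemma eisq_ramanujan r : (0 < r)%N -> ramanujan_system (eisq2 r) (eisq4 r) (eisq6 r).
Proof.
move=> r0; set a : fps K := fpsC (r%:R / 12).
have e2 : eisq2 r = a * fps_subst r (1 - 24 * sigmaq K 1) by [].
have e4 : eisq4 r = a ^+ 2 * fps_subst r (1 + 240 * sigmaq K 3) by rewrite /eisq4 rmorphXn.
have e6 : eisq6 r = 4 * a ^+ 3 * fps_subst r (1 - 504 * sigmaq K 5).
  by rewrite /eisq6 rmorphM rmorphXn rmorph_nat.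
have Da : fpsD a = 0 by rewrite fpsDC.
have ra : r%:R = 12 * a.
  rewrite -(rmorph_nat fpsC r) -(rmorph_nat fpsC 12) /a -rmorphM; congr fpsC; by field.
have D1 (c : fps K) f : fpsD c = 0 -> fpsD (c * f) = c * fpsD f.
  by move=> Dc; rewrite fpsDM Dc mul0r add0r.
have DE c n : fpsD (fps_subst r (1 + c%:R * sigmaq K n)) = 12 * a * fps_subst r (c%:R * fpsD (sigmaq K n)).
  by rewrite fpsD_subst // raddfD /= fpsD1 add0r D1 ?fpsD_nat // ra.
have DE' c n : fpsD (fps_subst r (1 - c%:R * sigmaq K n)) = 12 * a * fps_subst r (- c%:R * fpsD (sigmaq K n)).
  by rewrite fpsD_subst // raddfB /= fpsD1 sub0r D1 ?fpsD_nat // ra mulNr.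
have s1 := sigmaq1_sqr K; have s13 := sigmaq1_sigmaq3 K; have s15 := sigmaq1_sigmaq5 K.
have s33 := sigmaq3_sqr K.
split.
- rewrite e2 e4 D1 // DE' expr2.
  have e : 12 * (- 24 * fpsD (sigmaq K 1)) = (1 - 24 * sigmaq K 1) ^+ 2 - (1 + 240 * sigmaq K 3).
    by apply: (eq_lincomb (c := - 48) s1); ring.
  have := congr1 (fps_subst r) e; rewrite rmorphM rmorph_nat rmorphB rmorphXn => q.
  by apply: (eq_lincomb (c := a ^+ 2) q); ring.
- rewrite e2 e4 e6 D1 ?fpsDXn ?Da ?mulr0 // DE.
  have e : 12 * (240 * fpsD (sigmaq K 3)) =
     4 * (1 - 24 * sigmaq K 1) * (1 + 240 * sigmaq K 3) - 4 * (1 - 504 * sigmaq K 5).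
    by apply: (eq_lincomb (c := 96) s13); ring.
  have := congr1 (fps_subst r) e; rewrite rmorphB !rmorphM !rmorph_nat => q.
  by apply: (eq_lincomb (c := a ^+ 3) q); ring.
- have Da3 : fpsD (4 * a ^+ 3) = 0 by rewrite D1 ?fpsD_nat // fpsDXn Da !mulr0.
  rewrite e2 e4 e6 D1 // DE'.
  have e : 2 * (- 504 * fpsD (sigmaq K 5)) =
     (1 - 24 * sigmaq K 1) * (1 - 504 * sigmaq K 5) - (1 + 240 * sigmaq K 3) ^+ 2.
    apply: (@eq_lincomb _ (- 24) (504 * (sigmaq K 1 * sigmaq K 5) + 840 * sigmaq K 3 ^+ 2
       - 27 * 120 * sigmaq K 3 ^+ 2)
     (27 * sigmaq K 7 + 21 * sigmaq K 5 - 7 * sigmaq K 3 + sigmaq K 1 - 42 * fpsD (sigmaq K 5)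
       - 27 * (sigmaq K 7 - sigmaq K 3))); first by rewrite s15 -s33; ring.
    by ring.
  have := congr1 (fps_subst r) e; rewrite rmorphB rmorphXn !rmorphM !rmorph_nat => q.
  by apply: (eq_lincomb (c := 24 * a ^+ 4) q); ring.
Qed.

End Ramanujan.

Section PolyLists.
Variable K : numFieldType.
Implicit Types (s : seq K) (x : K).

(** Explicit polynomials are kept as coefficient lists. Their identities are checked at every point
    of the infinite field K ([poly_ext]), where these fixpoints unfold to expressions that [ring]
    can handle. *)
Fixpoint horner_list s x := if s is c :: s' then c + x * horner_list s' x else 0.

Fixpoint horner_list_deriv s x :=
  if s is c :: s' then horner_list s' x + x * horner_list_deriv s' x else 0.

Lemma horner_Poly_list s x : (Poly s).[x] = horner_list s x.
Proof.
by elim: s => [|c s IH] /=; rewrite ?horner0 // horner_cons IH addrC mulrC.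
Qed.

Lemma horner_deriv_Poly_list s x : (Poly s)^`().[x] = horner_list_deriv s x.
Proof.
elim: s => [|c s IH] /=; first by rewrite deriv0 horner0.
rewrite cons_poly_def derivD derivM derivX derivC mulr1 addr0 !hornerE IH.
by rewrite horner_Poly_list addrC mulrC.
Qed.

Lemma poly_ext (p q : {poly K}) : (forall x, p.[x] = q.[x]) -> p = q.
Proof.
move=> e; apply/eqP; rewrite -subr_eq0; apply/negP => /negP nz.
pose rs := [seq (i%:R : K) | i <- iota 0 (size (p - q))].
have := @max_poly_roots _ (p - q) rs nz; rewrite size_map size_iota ltnn.
have -> : all (root (p - q)) rs.
  by apply/allP => x _; rewrite /root !hornerE e subrr.
rewrite map_inj_uniq ?iota_uniq; last by move=> i j /eqP; rewrite eqr_nat => /eqP.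
by move=> /(_ isT isT).
Qed.

End PolyLists.

(** * Explicit polynomials of level 12 *)

Definition levels : seq nat := [:: 1; 2; 3; 4; 6; 12]%N.

Section LevelTwelve.
Variable K : numFieldType.

(* The series [12 L + ... ], E4(q^r) and E6(q^r) expressed by the Hauptmodul
   [t] and the weight one form [W] of Gamma_0(12). *)
Definition level_e2_list (r : nat) : seq K :=
  match r with
  | 1 => [:: 1; 60; 552; 1728; 1728]
  | 2 => [:: 2; 96; 840; 2592; 2592]
  | 3 => [:: 3; 108; 936; 2880; 2880]
  | 4 => [:: 4; 120; 984; 3024; 3024]
  | 6 => [:: 6; 144; 1080; 3168; 3168]
  | _ => [:: 12; 216; 1368; 3600; 3312]
  end.

(** Large coefficients are written in base 1000, to keep the natural numbers behind the numerals
    small. The lists carry no proof of their own: they are justified by the three differential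
    identities and the discriminants below. *)
Definition level_e4_list (r : nat) : seq K :=
  match r with
  | 1 => [:: 1; 264; 7440; 89 * 1000 + 856; 587 * 1000 + 520; 2239 * 1000 + 488;
      4976 * 1000 + 640; 5971 * 1000 + 968; 2985 * 1000 + 984]
  | 2 => [:: 1; 24; 480; 5616; 36 * 1000 + 720; 139 * 1000 + 968; 311 * 1000 +
      40; 373 * 1000 + 248; 186 * 1000 + 624]
  | 3 => [:: 1; 24; 240; 1536; 7680; 27 * 1000 + 648; 61 * 1000 + 440; 73 * 1000
      + 728; 36 * 1000 + 864]
  | 4 => [:: 1; 24; 240; 1296; 4320; 10 * 1000 + 368; 19 * 1000 + 440; 23 * 1000
      + 328; 11 * 1000 + 664]
  | 6 => [:: 1; 24; 240; 1296; 4080; 7488; 7680; 4608; 2304]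
  | _ => [:: 1; 24; 240; 1296; 4080; 7488; 7440; 3168; 144]
  end.

Definition level_e6_list (r : nat) : seq K :=
  match r with
  | 1 => [:: 1; - 468; - (32 * 1000 + 688); - (857 * 1000 + 952); - ((12 * 1000 +
      350) * 1000 + 880); - ((111 * 1000 + 787) * 1000 + 776); - ((677 * 1000
      + 693) * 1000 + 952); - ((2830 * 1000 + 712) * 1000 + 832); - ((8187 *
      1000 + 568) * 1000 + 128); - (((16 * 1000 + 124) * 1000 + 313) * 1000 +
      600); - (((20 * 1000 + 639) * 1000 + 121) * 1000 + 408); - (((15 * 1000
      + 479) * 1000 + 341) * 1000 + 56); - ((5159 * 1000 + 780) * 1000 + 352)]
  | 2 => [:: 1; 36; 72; - 9720; - (180 * 1000 + 792); - (1726 * 1000 + 272); -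
      ((10 * 1000 + 575) * 1000 + 360); - ((44 * 1000 + 229) * 1000 + 888); -
      ((127 * 1000 + 930) * 1000 + 752); - ((251 * 1000 + 942) * 1000 + 400);
      - ((322 * 1000 + 486) * 1000 + 272); - ((241 * 1000 + 864) * 1000 +
      704); - ((80 * 1000 + 621) * 1000 + 568)]
  | 3 => [:: 1; 36; 576; 4896; 19 * 1000 + 296; - (20 * 1000 + 736); - (640 *
      1000 + 512); - (3538 * 1000 + 944); - ((11 * 1000 + 59) * 1000 + 200); -
      ((22 * 1000 + 118) * 1000 + 400); - ((28 * 1000 + 311) * 1000 + 552); -
      ((21 * 1000 + 233) * 1000 + 664); - (7077 * 1000 + 888)]
  | 4 => [:: 1; 36; 576; 5400; 32 * 1000 + 400; 124 * 1000 + 416; 270 * 1000 +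
      216; 104 * 1000 + 976; - (1172 * 1000 + 232); - (3569 * 1000 + 184); -
      (5038 * 1000 + 848); - (3779 * 1000 + 136); - (1259 * 1000 + 712)]
  | 6 => [:: 1; 36; 576; 5400; 32 * 1000 + 904; 136 * 1000 + 512; 391 * 1000 +
      680; 767 * 1000 + 232; 964 * 1000 + 224; 622 * 1000 + 80; - (55 * 1000 +
      296); - (331 * 1000 + 776); - (110 * 1000 + 592)]
  | _ => [:: 1; 36; 576; 5400; 32 * 1000 + 904; 136 * 1000 + 512; 392 * 1000 +
      184; 776 * 1000 + 304; 1029 * 1000 + 240; 857 * 1000 + 952; 392 * 1000 +
      256; 67 * 1000 + 392; - 1728]
  end.

(** The polynomial (D L - L^2) / W^4. Any one of the six instances of [level_ode2] determines it;
    that all six agree expresses that L is common to them. *)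
Definition level_p8_list : seq K :=
    [:: 0; - 6; - 186; - 2352; - (15 * 1000 + 816); - (61 * 1000 + 344); - (137
  * 1000 + 664); - (165 * 1000 + 888); - (82 * 1000 + 944)].

Definition level_R_list : seq K :=
  [:: 1; 15; 80; 180; 144].

Definition level_e2 r : {poly K} := Poly (level_e2_list r).
Definition level_e4 r : {poly K} := Poly (level_e4_list r).
Definition level_e6 r : {poly K} := Poly (level_e6_list r).
Definition level_p8 : {poly K} := Poly level_p8_list.
Definition level_R : {poly K} := Poly level_R_list.

Let horner_nat (n : nat) (x : K) : (n%:R : {poly K}).[x] = n%:R.
Proof. by rewrite hornerMn hornerC. Qed.

Let hornerPE := (horner_nat, horner_Poly_list, horner_deriv_Poly_list,
  hornerX, hornerD, hornerN, hornerM, horner_exp, hornerC).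

Ltac unfold_level := cbn [horner_list horner_list_deriv level_e2_list level_e4_list
  level_e6_list level_p8_list level_R_list].

(** As D t = t W^2 R(t), this identity and the next two are Ramanujan's equations for the polynomial
    candidates, divided by powers of W; the terms in L cancel. *)
Lemma level_ode2 r : r \in levels ->
  144 * level_p8 + 12 * 'X * (level_e2 r)^`() * level_R =
  level_e2 r ^+ 2 - r%:R ^+ 2 * level_e4 r.
Proof.
move=> hr; apply: poly_ext => x; rewrite !hornerPE.
by move: hr; rewrite !inE => /or4P[|||/or3P[||]] /eqP -> {r}; unfold_level; ring.
Qed.

Lemma level_ode4 r : r \in levels ->
  3 * 'X * (level_e4 r)^`() * level_R = level_e2 r * level_e4 r - r%:R * level_e6 r.
Proof.
move=> hr; apply: poly_ext => x; rewrite !hornerPE.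
by move: hr; rewrite !inE => /or4P[|||/or3P[||]] /eqP -> {r}; unfold_level; ring.
Qed.

Lemma level_ode6 r : r \in levels ->
  2 * 'X * (level_e6 r)^`() * level_R =
  level_e2 r * level_e6 r - r%:R * level_e4 r ^+ 2.
Proof.
move=> hr; apply: poly_ext => x; rewrite !hornerPE.
by move: hr; rewrite !inE => /or4P[|||/or3P[||]] /eqP -> {r}; unfold_level; ring.
Qed.

(** The difference represents 1728 eta(rz)^24, which vanishes only at cusps: to the order r at t =
    0, and at t = -1/2, -1/3, -1/4, -1/6 to the orders that are the exponents in [G]. *)
Lemma level_discriminant r : r \in levels -> exists2 G : {poly K}, G.[0] = 1 &
  level_e4 r ^+ 3 - level_e6 r ^+ 2 = 1728 * 'X ^+ r * G.
Proof.
move=> hr.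
pose G (A : comNzRingType) (r : nat) (x : A) : A := match r with
  | 1 => (1 + 2 * x) ^+ 1 * (1 + 3 * x) ^+ 3 * (1 + 4 * x) ^+ 4 * (1 + 6 * x) ^+ 3
  | 2 => (1 + 2 * x) ^+ 2 * (1 + 3 * x) ^+ 6 * (1 + 4 * x) ^+ 2 * (1 + 6 * x) ^+ 6
  | 3 => (1 + 2 * x) ^+ 3 * (1 + 3 * x) ^+ 1 * (1 + 4 * x) ^+ 12 * (1 + 6 * x) ^+ 1
  | 4 => (1 + 2 * x) ^+ 1 * (1 + 3 * x) ^+ 12 * (1 + 4 * x) ^+ 1 * (1 + 6 * x) ^+ 3
  | 6 => (1 + 2 * x) ^+ 6 * (1 + 3 * x) ^+ 2 * (1 + 4 * x) ^+ 6 * (1 + 6 * x) ^+ 2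
  | _ => (1 + 2 * x) ^+ 3 * (1 + 3 * x) ^+ 4 * (1 + 4 * x) ^+ 3 * (1 + 6 * x) ^+ 1
  end.
have GE x : (G {poly K} r 'X).[x] = G K r x.
  by move: hr; rewrite /G !inE => /or4P[|||/or3P[||]] /eqP -> {r}; cbn iota; rewrite !hornerPE.
exists (G {poly K} r 'X).
  by rewrite GE; move: hr {GE}; rewrite /G !inE => /or4P[|||/or3P[||]] /eqP -> {r}; cbn iota; ring.
apply: poly_ext => x; rewrite [in RHS]hornerM GE {GE} !hornerPE.
by move: hr; rewrite /G !inE => /or4P[|||/or3P[||]] /eqP -> {r}; cbn iota; unfold_level; ring.
Qed.

End LevelTwelve.

Section LevelTheorem.
Variables (K : numFieldType) (t W L : fps K).
Hypothesis sys : modular_system (level_R K) (level_p8 K) t W L.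

Let c12 : fps K := fpsC 12^-1.

Let c12E : 12 * c12 = 1.
Proof. by rewrite -(rmorph_nat fpsC 12) -rmorphM divff ?rmorph1 // pnatr_eq0. Qed.

Let Dc12 : fpsD c12 = 0. Proof. exact: fpsDC. Qed.

Let fpsD_const (c f : fps K) : fpsD c = 0 -> fpsD (c * f) = c * fpsD f.
Proof. by move=> Dc; rewrite fpsDM Dc mul0r add0r. Qed.

Let Dpeval P : fpsD (peval t P) = W ^+ 2 * peval t (P^`() * 'X * level_R K).
Proof. by rewrite fpsD_peval (msys_t sys) !rmorphM /= pevalX; ring. Qed.

Lemma level_R0 : (level_R K).[0] = 1.
Proof. by rewrite horner_Poly_list; cbn [horner_list level_R_list]; ring. Qed.

Lemma level_p80 : (level_p8 K).[0] = 0.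
Proof. by rewrite horner_Poly_list; cbn [horner_list level_p8_list]; rewrite mul0r addr0. Qed.

Lemma level_e20 r : r \in levels -> (level_e2 K r).[0] = r%:R.
Proof.
rewrite horner_Poly_list !inE => /or4P[|||/or3P[||]] /eqP ->;
cbn [horner_list level_e2_list]; ring.
Qed.

Lemma level_e40 r : r \in levels -> (level_e4 K r).[0] = 1.
Proof.
rewrite horner_Poly_list !inE => /or4P[|||/or3P[||]] /eqP ->;
cbn [horner_list level_e4_list]; ring.
Qed.

Lemma level_e60 r : r \in levels -> (level_e6 K r).[0] = 1.
Proof.
rewrite horner_Poly_list !inE => /or4P[|||/or3P[||]] /eqP ->;
cbn [horner_list level_e6_list]; ring.
Qed.

Let t0 := msys_t0 sys.

Let peval_eq (P Q : {poly K}) : P = Q -> peval t P = peval t Q.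
Proof. by move->. Qed.

Let t_order r : (fpsX ^+ r : fps K) r = 1.
Proof. by rewrite fpsXnE eqxx. Qed.

Let level_candidate r : r \in levels ->
  let a := r%:R * c12 in
  ramanujan_system (L + c12 * (W ^+ 2 * peval t (level_e2 K r)))
    (a ^+ 2 * (W ^+ 4 * peval t (level_e4 K r)))
    (4 * a ^+ 3 * (W ^+ 6 * peval t (level_e6 K r))).
Proof.
move=> hr a.
have Da n : fpsD (a ^+ n) = 0 by rewrite fpsDXn fpsDM fpsD_nat Dc12; ring.
have D4a : fpsD (4 * a ^+ 3) = 0 by rewrite fpsDM fpsD_nat Da; ring.
have DW := msys_W sys; have DL := msys_L sys.
set e2 := peval t (level_e2 K r); set e4 := peval t (level_e4 K r).
set e6 := peval t (level_e6 K r).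
have o2 : 144 * peval t (level_p8 K) + 12 * peval t ((level_e2 K r)^`() * 'X * level_R K) =
    e2 ^+ 2 - r%:R ^+ 2 * e4.
  have := peval_eq (level_ode2 K hr); rewrite rmorphB rmorphD rmorphXn !rmorphM /= !rmorph_nat.
  by rewrite -/e2 -/e4 => <-; ring.
have o4 : 3 * peval t ((level_e4 K r)^`() * 'X * level_R K) = e2 * e4 - r%:R * e6.
  have := peval_eq (level_ode4 K hr); rewrite rmorphB !rmorphM /= !rmorph_nat.
  by rewrite -/e2 -/e4 -/e6 => <-; ring.
have o6 : 2 * peval t ((level_e6 K r)^`() * 'X * level_R K) = e2 * e6 - r%:R * e4 ^+ 2.
  have := peval_eq (level_ode6 K hr); rewrite rmorphB !rmorphM /= !rmorph_nat.
  by rewrite -/e2 -/e4 -/e6 => <-; ring.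
have r12 : r%:R = 12 * a by rewrite /a mulrCA c12E mulr1.
have q2 : peval t (level_p8 K) + c12 * peval t ((level_e2 K r)^`() * 'X * level_R K) =
    c12 ^+ 2 * e2 ^+ 2 - a ^+ 2 * e4.
  set p := peval t (level_p8 K) in o2 *; set q := peval t (_ * _) in o2 *.
  transitivity (c12 ^+ 2 * (144 * p + 12 * q) + (1 - 12 * c12) * (p * (1 + 12 * c12) + c12 * q)).
    ring.
  by rewrite o2 c12E subrr mul0r addr0 /a; ring.
have q4 : peval t ((level_e4 K r)^`() * 'X * level_R K) = 4 * (c12 * e2 * e4 - a * e6).
  set q := peval t (_ * _) in o4 *.
  transitivity (4 * c12 * (3 * q) + (1 - 12 * c12) * q); first by ring.
  by rewrite o4 c12E subrr mul0r addr0 /a; ring.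
have q6 : peval t ((level_e6 K r)^`() * 'X * level_R K) = 6 * (c12 * e2 * e6 - a * e4 ^+ 2).
  set q := peval t (_ * _) in o6 *.
  transitivity (6 * c12 * (2 * q) + (1 - 12 * c12) * q); first by ring.
  by rewrite o6 c12E subrr mul0r addr0 /a; ring.
split.
- rewrite raddfD /= fpsD_const // (fpsDM (W ^+ 2)) Dpeval fpsDXn DW DL -/e2 -/e4.
  by move: q2; set p := peval t (level_p8 K); set q := peval t (_ * _) => e;
    apply: (eq_lincomb (c := W ^+ 4) e); ring.
- rewrite fpsD_const // (fpsDM (W ^+ 4)) Dpeval fpsDXn DW q4 -/e2 -/e4 -/e6; ring.
- rewrite fpsD_const // (fpsDM (W ^+ 6)) Dpeval fpsDXn DW q6 -/e2 -/e4 -/e6; ring.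
Qed.

Let X_factor : exists2 u : fps K, t = fpsX * u & u 0%N = 1.
Proof.
exists (Fps (fun n => t n.+1)); last exact: msys_t1 sys.
by apply: fpsP => -[|n]; rewrite fpsX_mulE // t0.
Qed.

Let ME0 (c : fps K) P n : (c * (W ^+ n * peval t P)) 0%N = c 0%N * P.[0].
Proof. by rewrite !fpsM0E fpsX0E (msys_W0 sys) expr1n mul1r peval0E. Qed.

Let nat0E (m : nat) : (m%:R : fps K) 0%N = m%:R. Proof. exact: fps_natE. Qed.

Let subst0E r (f : fps K) : fps_subst r f 0%N = f 0%N. Proof. by []. Qed.

(** Both triples solve Ramanujan's system with the same constant terms, so only the coefficients of
    q^r in the discriminants remain to be compared; on the polynomial side it comes from t^r = q^r +
    ... and G(0) = 1. *)
Theorem level_eisenstein r : r \in levels ->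
  [/\ eisq2 K r = L + c12 * (W ^+ 2 * peval t (level_e2 K r)),
      fps_subst r (1 + 240 * sigmaq K 3) = W ^+ 4 * peval t (level_e4 K r) &
      fps_subst r (1 - 504 * sigmaq K 5) = W ^+ 6 * peval t (level_e6 K r)].
Proof.
move=> hr; have r0 : (0 < r)%N by move: hr; rewrite !inE => /or4P[|||/or3P[||]] /eqP ->.
have rn0 : r%:R != 0 :> K by rewrite pnatr_eq0 -lt0n.
have cand := level_candidate hr; have act := eisq_ramanujan K r0.
set a := r%:R * c12 in cand.
have aE : a = fpsC (r%:R / 12) by rewrite rmorphM rmorph_nat.
have a0 : a 0%N = r%:R / 12 by rewrite aE.
have a20 : (a ^+ 2) 0%N = (r%:R / 12) ^+ 2 by rewrite fpsX0E a0.
have a30 : (4 * a ^+ 3) 0%N = 4 * (r%:R / 12) ^+ 3 by rewrite fpsM0E nat0E fpsX0E a0.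
have sg0 c n : (c%:R * sigmaq K n) 0%N = 0 by rewrite fps_natME sigmaq0E mulr0.
have e4E : eisq4 K r = a ^+ 2 * fps_subst r (1 + 240 * sigmaq K 3) by rewrite /eisq4 aE rmorphXn.
have e6E : eisq6 K r = 4 * a ^+ 3 * fps_subst r (1 - 504 * sigmaq K 5).
  by rewrite /eisq6 aE rmorphM rmorphXn rmorph_nat.
have [|||||||E2 E4 E6] := ramanujan_unique r0 act cand.
- by rewrite fpsM0E subst0E fpsBE sg0 subr0 mulr1.
- by rewrite fpsM0E subst0E fpsDE sg0 addr0 mulr1.
- by rewrite fpsM0E subst0E fpsBE sg0 subr0 mulr1.
- rewrite fpsDE (msys_L0 sys) add0r ME0 level_e20 // fpsM0E subst0E fpsBE sg0 subr0 mulr1.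
  by rewrite mulrC.
- by rewrite e4E ME0 level_e40 // [RHS]fpsM0E subst0E fpsDE sg0 addr0.
- by rewrite e6E ME0 level_e60 // [RHS]fpsM0E subst0E fpsBE sg0 subr0.
- have [G G0 GE] := level_discriminant K hr; have [u tE u0] := X_factor.
  have -> : 16 * (a ^+ 2 * (W ^+ 4 * peval t (level_e4 K r))) ^+ 3 -
      (4 * a ^+ 3 * (W ^+ 6 * peval t (level_e6 K r))) ^+ 2 =
      fpsX ^+ r * (16 * a ^+ 6 * 1728 * (u ^+ r * (W ^+ 12 * peval t G))).
    transitivity (16 * a ^+ 6 * W ^+ 12 * peval t (level_e4 K r ^+ 3 - level_e6 K r ^+ 2)).
      by rewrite rmorphB !rmorphXn; ring.
    rewrite GE !rmorphM rmorphXn /= rmorph_nat pevalX tE (exprMn r fpsX); ring.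
  rewrite fpsXn_mulE leqnn subnn.
  have -> : 16 * eisq4 K r ^+ 3 - eisq6 K r ^+ 2 = 16 * a ^+ 6 * fps_subst r
      ((1 + 240 * sigmaq K 3) ^+ 3 - (1 - 504 * sigmaq K 5) ^+ 2).
    by rewrite e4E e6E [fps_subst r (_ ^+ 3 - _)]rmorphB !rmorphXn; ring.
  have -> : 16 * a ^+ 6 = fpsC (16 * (r%:R / 12) ^+ 6).
    by rewrite rmorphM rmorph_nat rmorphXn aE.
  rewrite -[in RHS]mulrA !fpsC_mulE; congr (_ * _).
  rewrite fps_substE // dvdnn divnn r0 fps_natME fpsM0E fpsX0E u0 expr1n mul1r.
  rewrite fpsM0E fpsX0E (msys_W0 sys) expr1n mul1r peval0E // G0 mulr1.
  have s1 n : sigmaq K n 1%N = 1 by rewrite sigmaqE (_ : divs 1 = [:: 1%N]) // big_seq1 expr1n.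
  (* The linear part contributes 720 + 1008 = 1728 to the coefficient of q, and the rest is
     divisible by q^2. *)
  have -> : (1 + 240 * sigmaq K 3) ^+ 3 - (1 - 504 * sigmaq K 5) ^+ 2 =
    720 * sigmaq K 3 + 1008 * sigmaq K 5 + (sigmaq K 3 * sigmaq K 3) * (3 * 240 ^+ 2 + 240 ^+ 3 * sigmaq K 3)
     - 504 ^+ 2 * (sigmaq K 5 * sigmaq K 5) by ring.
  have M1E (f h : fps K) : (f * h) 1%N = f 0%N * h 1%N + f 1%N * h 0%N.
    by rewrite fpsME !big_ord_recr big_ord0 /= add0r subnn subn0.
  have sq n : (sigmaq K n * sigmaq K n) 1%N = 0 by rewrite M1E !sigmaq0E; ring.
  have s33 : (sigmaq K 3 * sigmaq K 3 * (3 * 240 ^+ 2 + 240 ^+ 3 * sigmaq K 3)) 1%N = 0.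
    by rewrite M1E sq !fpsM0E sigmaq0E; ring.
  have s55 : (504 ^+ 2 * (sigmaq K 5 * sigmaq K 5)) 1%N = 0.
    by rewrite M1E sq !fpsM0E sigmaq0E; ring.
  by rewrite !(fpsDE, fpsNE) s33 s55 !fps_natME !s1; ring.
have cancel_a (c : K) (f h : fps K) : c != 0 -> fpsC c * f = fpsC c * h -> f = h.
  move=> c0 /(congr1 (fun y => fpsC c^-1 * y)).
  by rewrite !mulrA -rmorphM mulVf // rmorph1 !mul1r.
have an0 : r%:R / 12 != 0 :> K by rewrite mulf_neq0 // invr_eq0 pnatr_eq0.
have a2 : fpsC ((r%:R / 12) ^+ 2) = a ^+ 2 by rewrite aE rmorphXn.
have a3 : fpsC (4 * (r%:R / 12) ^+ 3) = 4 * a ^+ 3 by rewrite aE rmorphM rmorphXn rmorph_nat.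
split=> //.
  by apply: (cancel_a ((r%:R / 12) ^+ 2)); rewrite ?expf_neq0 // a2 -e4E.
apply: (cancel_a (4 * (r%:R / 12) ^+ 3)); first by rewrite mulf_neq0 ?expf_neq0 ?pnatr_eq0.
by rewrite a3 -e6E.
Qed.

End LevelTheorem.

(** * Eta quotients in terms of t and W *)

Section EtaQuotients.
Variable K : numFieldType.
Implicit Types s : seq (nat * int).

(* The logarithmic derivative of [prod_(r, e) prod_n (1 - q^(r n))^e]. *)
Definition eta_log s : fps K :=
  - \sum_(x <- s) x.2%:~R * (x.1%:R * fps_subst x.1 (sigmaq K 1)).

(** The power of q in front is left out, so that the constant term is 1. *)
Definition eta_quotient s : fps K := expint (eta_log s).

Lemma eta_log0E s : eta_log s 0%N = 0.
Proof.
rewrite fpsNE fps_sumE big1 ?oppr0 // => x _.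
by rewrite !fpsM0E [fps_subst _ _ _]sigmaq0E !mulr0.
Qed.

Lemma eta_quotient0E s : eta_quotient s 0%N = 1. Proof. exact: expint0E. Qed.

Lemma fpsD_eta_quotient s : fpsD (eta_quotient s) = eta_quotient s * eta_log s.
Proof. exact/fpsD_expint/eta_log0E. Qed.

Lemma eta_quotient_cat s s' :
  eta_quotient (s ++ s') = eta_quotient s * eta_quotient s'.
Proof. by rewrite /eta_quotient -expintD ?eta_log0E // /eta_log big_cat opprD. Qed.

Lemma eta_quotient_unique s (y : fps K) :
  y 0%N = 1 -> 24 * fpsD y = y * (24 * eta_log s) -> y = eta_quotient s.
Proof.
move=> y0 e; apply: expint_unique => //; first exact: eta_log0E.
by apply: (@fps_nat_inj _ 24) => //; rewrite e; ring.
Qed.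

Variables (t W L : fps K).
Hypothesis sys : modular_system (level_R K) (level_p8 K) t W L.

Let t0 := msys_t0 sys.

Definition eta_weight s : int := \sum_(x <- s) x.2.
Definition eta_order s : int := \sum_(x <- s) x.2 * x.1%:Z.
Definition eta_level_e2 s : {poly K} := \sum_(x <- s) x.2%:~R * level_e2 K x.1.

(** From r E_2(q^r) = 12 L + W^2 e2_r(t). Here [eta_weight] is twice the weight and [eta_order] 24
    times the order in q. *)
Lemma eta_log_level s : {subset [seq x.1 | x <- s] <= levels} ->
  24 * eta_log s = 12 * (eta_weight s)%:~R * L + W ^+ 2 * peval t (eta_level_e2 s)
    - (eta_order s)%:~R.
Proof.
elim: s => [|[r e] s IH] hs.
  by rewrite /eta_log /eta_weight /eta_order /eta_level_e2 !big_nil rmorph0; ring.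
have hr : r \in levels by apply: hs; rewrite inE eqxx.
have hs' : {subset [seq x.1 | x <- s] <= levels}.
  by move=> x xs; apply: hs; rewrite inE xs orbT.
have {}IH := IH hs'.
have -> : eta_log ((r, e) :: s) = - (e%:~R * (r%:R * fps_subst r (sigmaq K 1))) + eta_log s.
  by rewrite /eta_log big_cons opprD.
have -> : eta_weight ((r, e) :: s) = e + eta_weight s by rewrite /eta_weight big_cons.
have -> : eta_order ((r, e) :: s) = e * r%:Z + eta_order s by rewrite /eta_order big_cons.
have -> : eta_level_e2 ((r, e) :: s) = e%:~R * level_e2 K r + eta_level_e2 s.
  by rewrite /eta_level_e2 big_cons.
rewrite mulrDr IH !rmorphD !rmorphM /= rmorph_int.
have [e2 _ _] := level_eisenstein sys hr.
have c12 : 12 * fpsC 12^-1 = 1 :> fps K.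
  by rewrite -(rmorph_nat fpsC 12) -rmorphM divff ?rmorph1 // pnatr_eq0.
have r12 : 12 * fpsC (r%:R / 12) = r%:R :> fps K.
  by rewrite rmorphM rmorph_nat mulrCA c12 mulr1.
have : 12 * eisq2 K r = r%:R * (1 - 24 * fps_subst r (sigmaq K 1)).
  by rewrite /eisq2 mulrA r12 rmorphB rmorphM rmorph1 rmorph_nat.
rewrite e2 mulrDr mulrA c12 mul1r => q; apply: (eq_lincomb (c := - e%:~R) q).
by rewrite -[(r%:Z)%:~R]pmulrn; ring.
Qed.

Let Dpeval P : fpsD (peval t P) = W ^+ 2 * peval t (P^`() * 'X * level_R K).
Proof. by rewrite fpsD_peval (msys_t sys) !rmorphM /= pevalX; ring. Qed.

(** For a quotient of weight m and order 0 it suffices that W^m P(t) has the same logarithmic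
    derivative; this is the last hypothesis, after multiplication by P. *)
Lemma eta_quotient_level s m P : {subset [seq x.1 | x <- s] <= levels} ->
    eta_weight s = (2 * m)%:Z -> eta_order s = 0 -> P.[0] = 1 ->
    24 * 'X * P^`() * level_R K = P * eta_level_e2 s ->
  W ^+ m * peval t P = eta_quotient s.
Proof.
move=> hs sw so P0 e; apply: eta_quotient_unique.
  by rewrite fpsM0E fpsX0E (msys_W0 sys) expr1n mul1r peval0E.
rewrite eta_log_level // sw so fpsDM fpsDXn (msys_W sys) Dpeval.
have := congr1 (peval t) e; rewrite [RHS]rmorphM /=.
have -> : 24 * 'X * P^`() * level_R K = 24 * (P^`() * 'X * level_R K) by ring.
rewrite rmorphM /= rmorph_nat => q.
have -> : m%:R * W ^+ m.-1 * (W * L) = m%:R * W ^+ m * L.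
  by case: m {sw} => [|m] /=; rewrite ?mul0r // exprS; ring.
apply: (eq_lincomb (c := W ^+ m * W ^+ 2) q).
rewrite -[((2 * m)%N%:Z)%:~R]pmulrn natrM.
by set q1 := peval t (_ * _); ring.
Qed.

(** The logarithmic derivative of t is W^2 R(t). Its constant term 1 makes the equation resonant at
    index 1, so the coefficients of q^0 and of q are both compared. *)
Lemma eta_quotient_hauptmodul s : {subset [seq x.1 | x <- s] <= levels} ->
    eta_weight s = 0 -> eta_order s = 24 ->
    24 * level_R K = eta_level_e2 s ->
  t = fpsX * eta_quotient s.
Proof.
move=> hs sw so e; apply: (@linear_ode_unique _ (1 + eta_log s) _ _ 2).
- move=> n n2; rewrite fpsDE eta_log0E addr0 fps1E /= -[1]/(1%:R) eqr_nat.
  by case: n n2 => [|[|n]].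
- case=> [|[|//]] _; first by rewrite fpsX_mulE t0.
  by rewrite fpsX_mulE eta_quotient0E (msys_t1 sys).
- rewrite (msys_t sys); apply: (@fps_nat_inj _ 24) => //.
  have := eta_log_level hs; rewrite sw so -e rmorphM /= rmorph_nat => q.
  apply: (eq_lincomb (c := - t) q).
  by rewrite -[24%:~R]pmulrn; ring.
- by rewrite fpsDM fpsDX fpsD_eta_quotient; ring.
Qed.

(** [eta_R], [eta_t] and [eta_W] are the three factors in the definition of C_(j,k), which is
    thereby R(t) t^j W^k. *)
Definition eta_W : seq (nat * int) := [:: (1, 6%Z); (6, 1%Z); (2, (-3)%Z); (3, (-2)%Z)]%N.
Definition eta_t : seq (nat * int) :=
  [:: (2, 2%Z); (3, 1%Z); (12, 3%Z); (1, (-3)%Z); (4, (-1)%Z); (6, (-2)%Z)]%N.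
Definition eta_R : seq (nat * int) :=
  [:: (2, 10%Z); (3, 5%Z); (4, 1%Z); (6, 2%Z); (1, (-15)%Z); (12, (-3)%Z)]%N.
(** By Gauss's product, the lists A, B, C stand for phi(z)^4, phi(z)^2 phi(3z)^2 and phi(3z)^4, the
    building blocks of weight 2 of all the theta products considered. *)
Definition eta_A : seq (nat * int) := [:: (2, 20%Z); (1, (-8)%Z); (4, (-8)%Z)]%N.
Definition eta_B : seq (nat * int) :=
  [:: (2, 10%Z); (1, (-4)%Z); (4, (-4)%Z); (6, 10%Z); (3, (-4)%Z); (12, (-4)%Z)]%N.
Definition eta_C : seq (nat * int) := [:: (6, 20%Z); (3, (-8)%Z); (12, (-8)%Z)]%N.

(** The expanded forms of (1 + 2t)(1 + 6t)^3, (1 + 2t)^2 (1 + 6t)^2 and (1 + 2t)^3 (1 + 6t): theta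
    series vanish only at the cusps t = -1/2 and t = -1/6. *)
Definition level_A_list : seq K := [:: 1; 20; 144; 432; 432].
Definition level_B_list : seq K := [:: 1; 16; 88; 192; 144].
Definition level_C_list : seq K := [:: 1; 12; 48; 80; 48].
Definition level_A : {poly K} := Poly level_A_list.
Definition level_B : {poly K} := Poly level_B_list.
Definition level_C : {poly K} := Poly level_C_list.

Let horner_nat (n : nat) (x : K) : (n%:R : {poly K}).[x] = n%:R.
Proof. by rewrite hornerMn hornerC. Qed.

Let horner_int (n : int) (x : K) : (n%:~R : {poly K}).[x] = n%:~R.
Proof. by case: n => n; rewrite ?NegzE ?rmorphN /= ?hornerN -?pmulrn horner_nat. Qed.

Let hornerPE := (horner_nat, horner_int, horner_Poly_list, horner_deriv_Poly_list,
  hornerX, hornerD, hornerN, hornerM).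

Ltac unfold_level := cbn [fst snd horner_list horner_list_deriv level_e2_list level_e4_list
  level_e6_list level_p8_list level_R_list level_A_list level_B_list level_C_list].

Let horner_eta s (x : K) : (eta_level_e2 s).[x] =
  \sum_(y <- s) y.2%:~R * horner_list (level_e2_list K y.1) x.
Proof.
rewrite /eta_level_e2 horner_sum; apply: eq_bigr => y _.
by rewrite hornerM horner_int horner_Poly_list.
Qed.

Let eta_ode (P Q R : seq K) s :
    (forall x, 24 * x * horner_list_deriv P x * horner_list R x =
       horner_list Q x * \sum_(y <- s) y.2%:~R * horner_list (level_e2_list K y.1) x) ->
  24 * 'X * (Poly P)^`() * Poly R = Poly Q * eta_level_e2 s.
Proof.
by move=> e; apply: poly_ext => x; rewrite !hornerM horner_eta !hornerPE e.
Qed.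

Ltac solve_eta_ode := apply: eta_ode => x; rewrite !big_cons big_nil; unfold_level; ring.

Ltac eta_val := rewrite horner_Poly_list; unfold_level; ring.

Lemma eta_quotient_W : eta_quotient eta_W = W.
Proof.
rewrite -(@eta_quotient_level eta_W 1 1) //.
- by rewrite expr1 rmorph1 mulr1.
- exact/allP.
- by rewrite /eta_weight !big_cons big_nil.
- by rewrite /eta_order !big_cons big_nil.
- by rewrite hornerE.
- rewrite -[1]/(1%:P) derivC mulr0 mul0r mul1r; apply: poly_ext => x.
  rewrite horner0 horner_eta !big_cons big_nil.
  by unfold_level; ring.
Qed.

Lemma eta_quotient_t : fpsX * eta_quotient eta_t = t.
Proof.
symmetry; apply: eta_quotient_hauptmodul => //.
- exact/allP.
- by rewrite /eta_weight !big_cons big_nil.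
- by rewrite /eta_order !big_cons big_nil.
- apply: poly_ext => x; rewrite hornerM horner_nat horner_eta horner_Poly_list.
  rewrite !big_cons big_nil.
  by unfold_level; ring.
Qed.

Lemma eta_quotient_R : eta_quotient eta_R = peval t (level_R K).
Proof.
rewrite -(@eta_quotient_level eta_R 0 (level_R K)) //.
- by rewrite expr0 mul1r.
- exact/allP.
- by rewrite /eta_weight !big_cons big_nil.
- by rewrite /eta_order !big_cons big_nil.
- by eta_val.
- by solve_eta_ode.
Qed.

Lemma eta_quotient_A : eta_quotient eta_A = W ^+ 2 * peval t level_A.
Proof.
rewrite -(@eta_quotient_level eta_A 2 level_A) //.
- exact/allP.
- by rewrite /eta_weight !big_cons big_nil.
- by rewrite /eta_order !big_cons big_nil.
- by eta_val.
- by solve_eta_ode.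
Qed.

Lemma eta_quotient_B : eta_quotient eta_B = W ^+ 2 * peval t level_B.
Proof.
rewrite -(@eta_quotient_level eta_B 2 level_B) //.
- exact/allP.
- by rewrite /eta_weight !big_cons big_nil.
- by rewrite /eta_order !big_cons big_nil.
- by eta_val.
- by solve_eta_ode.
Qed.

Lemma eta_quotient_C : eta_quotient eta_C = W ^+ 2 * peval t level_C.
Proof.
rewrite -(@eta_quotient_level eta_C 2 level_C) //.
- exact/allP.
- by rewrite /eta_weight !big_cons big_nil.
- by rewrite /eta_order !big_cons big_nil.
- by eta_val.
- by solve_eta_ode.
Qed.

End EtaQuotients.

(** * Values at the cusps *)

Section CuspValues.
Variable K : numFieldType.
Implicit Types (P Q : {poly K}) (c : option K).

(* The value at a point of the projective line of a polynomial of degree at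
   most [d], seen as a section of O(d). *)
Definition cusp_value c d Q : K := if c is Some x then Q.[x] else Q`_d.

Lemma cusp_valueD c d P Q :
  cusp_value c d (P + Q) = cusp_value c d P + cusp_value c d Q.
Proof. by case: c => [x|] /=; rewrite ?hornerD ?coefD. Qed.

Lemma cusp_valueZ c d a Q : cusp_value c d (a *: Q) = a * cusp_value c d Q.
Proof. by case: c => [x|] /=; rewrite ?hornerZ ?coefZ. Qed.

Lemma cusp_valueM c d e P Q : (size P <= d.+1)%N -> (size Q <= e.+1)%N ->
  cusp_value c (d + e) (P * Q) = cusp_value c d P * cusp_value c e Q.
Proof.
case: c => [x|] sP sQ /=; first by rewrite hornerM.
rewrite coefM (bigD1 (inord d)) //= inordK ?ltnS ?leq_addr // addKn big1 ?addr0 //.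
move=> i; rewrite -val_eqE /= inordK ?ltnS ?leq_addr // => ne_id.
have [lt_id|le_di] := ltnP i d.
  by rewrite [Q`__]nth_default ?mulr0 // (leq_trans sQ) //; lia.
by rewrite nth_default ?mul0r // (leq_trans sP) // ltn_neqAle eq_sym ne_id.
Qed.

(* The cusps of Gamma_0(12), as values of the Hauptmodul. *)
Definition cusp (j : nat) : option K :=
  match j with
  | 0 => Some 0
  | 1 => Some (- 1 / 2)
  | 2 => Some (- 1 / 3)
  | 3 => Some (- 1 / 4)
  | 4 => Some (- 1 / 6)
  | _ => None
  end.

(* The ratio of [E_2k(r z)] to the k-th power of [W z ^ 2] at the j-th cusp is
   the k-th power of this constant, times the constant term of [E_2k]. *)
Definition cusp_ratio (r j : nat) : K :=
  match j with
  | 0 => 1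
  | 1 => match r with 4 | 12 => 1 / 4 | _ => 1 end
  | 2 => match r with 1 | 2 | 4 => - 1 / 3 | _ => - 1 / 27 end
  | 3 => match r with 1 | 3 => 1 / 4 | 2 | 6 => 1 / 16 | _ => 1 / 64 end
  | 4 => match r with 1 | 2 => - 1 / 3 | 3 | 6 => - 1 / 27 | 4 => - 1 / 12
         | _ => - 1 / 108 end
  | _ => match r with 1 => - 1728 | 2 => - 432 | 3 => - 192 | 4 => - 108
         | 6 => - 48 | _ => - 12 end
  end.

Ltac cusp_cases j :=
  case: j => [|[|[|[|[|j]]]]]; cbn [cusp_value cusp cusp_ratio];
  rewrite ?horner_Poly_list ?coef_Poly;
  cbn [horner_list level_e4_list level_e6_list level_A_list level_B_list level_C_list nth].

(** E_4^3 - E_6^2 vanishes at the cusps, so the values of E_4 and E_6 are the square and the cube of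
    a single number; this is how [cusp_ratio] arises. *)
Lemma cusp_value_e4 r j : r \in levels ->
  cusp_value (cusp j) 8 (level_e4 K r) = cusp_ratio r j ^+ 2.
Proof.
by rewrite !inE => /or4P[|||/or3P[||]] /eqP ->; cusp_cases j; field.
Qed.

Lemma cusp_value_e6 r j : r \in levels ->
  cusp_value (cusp j) 12 (level_e6 K r) = cusp_ratio r j ^+ 3.
Proof.
by rewrite !inE => /or4P[|||/or3P[||]] /eqP ->; cusp_cases j; field.
Qed.

Definition cusp_A (j : nat) : K :=
  match j with 0 => 1 | 1 => 0 | 2 => - 1 / 3 | 3 => - 1 / 16 | 4 => 0 | _ => 432 end.
Definition cusp_B (j : nat) : K :=
  match j with 0 => 1 | 1 => 0 | 2 => 1 / 9 | 3 => 1 / 16 | 4 => 0 | _ => 144 end.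
Definition cusp_C (j : nat) : K :=
  match j with 0 => 1 | 1 => 0 | 2 => - 1 / 27 | 3 => - 1 / 16 | 4 => 0 | _ => 48 end.

Lemma cusp_value_A j : cusp_value (cusp j) 4 (level_A K) = cusp_A j.
Proof. by rewrite /cusp_A; cusp_cases j; field. Qed.
Lemma cusp_value_B j : cusp_value (cusp j) 4 (level_B K) = cusp_B j.
Proof. by rewrite /cusp_B; cusp_cases j; field. Qed.
Lemma cusp_value_C j : cusp_value (cusp j) 4 (level_C K) = cusp_C j.
Proof. by rewrite /cusp_C; cusp_cases j; field. Qed.

End CuspValues.

Section ModularForms.
Variables (K : numFieldType) (t W L : fps K).
Hypothesis sys : modular_system (level_R K) (level_p8 K) t W L.

(* [f] is [W^M] times a polynomial in the Hauptmodul of degree at most [2 M],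
   with the values [v j] at the six cusps. *)
Definition modform (M : nat) (f : fps K) (v : nat -> K) : Prop :=
  exists Q : {poly K}, [/\ (size Q <= (2 * M).+1)%N, f = W ^+ M * peval t Q &
    forall j, cusp_value (cusp K j) (2 * M) Q = v j].

Lemma eq_modform M f v v' : v =1 v' -> modform M f v -> modform M f v'.
Proof. by move=> e [Q [sQ fQ vQ]]; exists Q; split=> // j; rewrite vQ. Qed.

Lemma modform0 M : modform M 0 (fun=> 0).
Proof.
exists 0; split; rewrite ?size_poly0 ?rmorph0 ?mulr0 // => j.
by case: (cusp K j) => [x|] /=; rewrite ?horner0 ?coef0.
Qed.

Lemma modform1 : modform 0 1 (fun=> 1).
Proof.
exists 1; split; rewrite ?size_poly1 ?rmorph1 ?mulr1 // => j.
by case: (cusp K j) => [x|] /=; rewrite ?hornerE ?coef1.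
Qed.

Lemma modformD M f f' v v' : modform M f v -> modform M f' v' ->
  modform M (f + f') (fun j => v j + v' j).
Proof.
move=> [Q [sQ fQ vQ]] [Q' [sQ' fQ' vQ']]; exists (Q + Q'); split.
- by rewrite (leq_trans (size_polyD _ _)) // geq_max sQ.
- by rewrite rmorphD mulrDr fQ fQ'.
- by move=> j; rewrite cusp_valueD vQ vQ'.
Qed.

Lemma modformZ M f v a : modform M f v -> modform M (fpsC a * f) (fun j => a * v j).
Proof.
move=> [Q [sQ fQ vQ]]; exists (a *: Q); split.
- by rewrite (leq_trans (size_scale_leq _ _)).
- by rewrite -mul_polyC rmorphM /= pevalC fQ mulrCA.
- by move=> j; rewrite cusp_valueZ vQ.
Qed.

Lemma modformM M N f h v u : modform M f v -> modform N h u ->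
  modform (M + N) (f * h) (fun j => v j * u j).
Proof.
move=> [Q [sQ fQ vQ]] [Q' [sQ' fQ' vQ']]; exists (Q * Q'); split.
- rewrite (leq_trans (size_polyMleq _ _)) // mulnDr.
  by move: sQ sQ'; lia.
- by rewrite rmorphM exprD fQ fQ'; ring.
- by move=> j; rewrite mulnDr cusp_valueM // vQ vQ'.
Qed.

Lemma modformX M f v n : modform M f v ->
  modform (M * n) (f ^+ n) (fun j => v j ^+ n).
Proof.
move=> mf; elim: n => [|n IH]; first by rewrite muln0; apply: modform1.
rewrite mulnS exprS; apply: eq_modform (modformM mf IH) => j.
by rewrite exprS.
Qed.

Lemma modform_sum (I : eqType) (s : seq I) M (F : I -> fps K) (v : I -> nat -> K) :
    (forall i, i \in s -> modform M (F i) (v i)) ->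
  modform M (\sum_(i <- s) F i) (fun j => \sum_(i <- s) v i j).
Proof.
elim: s => [|i s IH] mF.
  by rewrite big_nil; apply: eq_modform (modform0 M) => j; rewrite big_nil.
rewrite big_cons; apply: eq_modform (modformD _ _).
- by move=> j; rewrite big_cons.
- by apply: mF; rewrite inE eqxx.
- by apply: IH => i' i's; apply: mF; rewrite inE i's orbT.
Qed.

Variables (g w : fps K).
Hypothesis w_def : w = cosh2 K 1 - 2.
Hypothesis gE : g * w = fpsX ^+ 2.

Let G := wpq g.

Let coshsum0E n : coshsum K n 0%N = 0. Proof. exact: divsum0E. Qed.

Lemma wpq0E n : wpq g n 0%N = g n.
Proof.
rewrite wpqE fpsDE; case: n => [|[|n]]; rewrite ?addr0 //.
by rewrite coshsum0E addr0.
Qed.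

(** The constant terms in q of the recursion [wpq_rec]. *)
Lemma sinh_rec n : (0 < n)%N ->
  (n.+4%:R - 6) * (n.+4%:R + 1) * g n.+4 =
  6 * \sum_(3 <= i < n.+2) g i * g (n.+4 - i)%N.
Proof.
move=> n0; have := congr1 (fun y : fps K => y 0%N) (wpq_rec w_def gE n0).
have c0 : ((n.+4%:R - 6) * (n.+4%:R + 1) : fps K) 0%N = (n.+4%:R - 6) * (n.+4%:R + 1).
  by rewrite fpsM0E (fpsBE n.+4%:R 6) (fpsDE n.+4%:R 1) !fps_natE fps1E.
rewrite fpsM0E c0 fps_natME wpq0E fps_sumE => ->.
by congr (_ * _); apply: eq_bigr => i _; rewrite fpsM0E !wpq0E.
Qed.

(** The recursion is homogeneous: at a cusp all products carry the same power of [cusp_ratio], the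
    odd indices contributing zero, and what remains is the recursion [sinh_rec] of g. The bound 3 <=
    M excludes the quasimodular weight 2. *)
Lemma wpq_modform r M : r \in levels -> (3 <= M)%N ->
  modform M (fps_subst r (wpq g M)) (fun j => g M * cusp_ratio K r j ^+ M./2).
Proof.
move=> hr; elim/ltn_ind: M => M IH M3.
have [E2 E4 E6] := level_eisenstein sys hr.
have [g0 g2 g4 g6] := sinh_values w_def gE.
have [odd_M|even_M] := boolP (odd M).
  rewrite (wpq_odd w_def gE odd_M) rmorph0; apply: eq_modform (modform0 M) => j.
  by rewrite (sinh_odd w_def gE odd_M) mul0r.
have [M4|M4] := eqVneq M 4%N.
  have -> : wpq g M = fpsC (1 / 240) * (1 + 240 * sigmaq K 3).
    rewrite M4 wpqE g4 coshsum_sigmaq /= mulrDr mulr1 mulrA; congr (_ + _ * _).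
    by rewrite -(rmorph_nat fpsC 240) -rmorphM; congr fpsC; rewrite -[2`!]/2%N; field.
  rewrite rmorphM /= fps_substC E4 M4 g4; apply: modformZ.
  exists (level_e4 K r); split=> //; last by move=> j; apply: (cusp_value_e4 K j hr).
  rewrite (leq_trans (size_Poly _)) //.
  by move: hr; rewrite !inE => /or4P[|||/or3P[||]] /eqP ->.
(* Weight 6 is a second starting value, because the factor n.+4 - 6 of the recursion vanishes
   there. *)
have [M6|M6] := eqVneq M 6%N.
  have -> : wpq g M = fpsC (- 1 / 6048) * (1 - 504 * sigmaq K 5).
    rewrite M6 wpqE g6 coshsum_sigmaq [odd 4]/= mulrBr mulr1 mulrA -mulNr; congr (_ + _ * _).
    rewrite -(rmorph_nat fpsC 504) -rmorphM -rmorphN; congr fpsC.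
    by rewrite -[4`!]/24%N; field.
  rewrite rmorphM /= fps_substC E6 M6 g6; apply: modformZ.
  exists (level_e6 K r); split=> //; last by move=> j; apply: (cusp_value_e6 K j hr).
  rewrite (leq_trans (size_Poly _)) //.
  by move: hr; rewrite !inE => /or4P[|||/or3P[||]] /eqP ->.
have [n [n0 nE]] : exists n, (2 < n)%N /\ M = n.+4.
  by case: M {IH} M3 M4 M6 even_M => [|[|[|[|[|[|[|M]]]]]]] // *; exists M.+3.
subst M; have n_gt0 : (0 < n)%N by lia.
have nz : (n.+4%:R - 6) * (n.+4%:R + 1) != 0 :> K.
  have n5 : n.+4%:R + 1 != 0 :> K by rewrite natr1 pnatr_eq0.
  have n6 : n.+4%:R - 6 != 0 :> K by rewrite subr_eq0 eqr_nat.
  by rewrite mulf_neq0.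
pose a := 6 / ((n.+4%:R - 6) * (n.+4%:R + 1)) : K.
have -> : wpq g n.+4 = fpsC a * \sum_(3 <= i < n.+2) wpq g i * wpq g (n.+4 - i)%N.
  have := wpq_rec w_def gE n_gt0 => /(congr1 (fun y => fpsC ((n.+4%:R - 6) * (n.+4%:R + 1))^-1 * y)).
  have -> : (n.+4%:R - 6) * (n.+4%:R + 1) = fpsC ((n.+4%:R - 6) * (n.+4%:R + 1)) :> fps K.
    by rewrite rmorphM rmorphB !rmorph_nat rmorphD rmorph_nat rmorph1.
  rewrite mulrA -rmorphM mulVf // rmorph1 mul1r => ->.
  by rewrite mulrA; congr (_ * _); rewrite /a rmorphM rmorph_nat mulrC.
rewrite rmorphM /= fps_substC rmorph_sum /=.
have -> : (fun j => g n.+4 * cusp_ratio K r j ^+ n.+4./2) =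
    (fun j => a * \sum_(3 <= i < n.+2) (g i * g (n.+4 - i)%N) * cusp_ratio K r j ^+ n.+4./2).
  apply: funext => j; rewrite -mulr_suml mulrA; congr (_ * _).
  apply: (mulfI nz); rewrite sinh_rec // /a mulrA; congr (_ * _).
  by rewrite mulrC divfK.
apply: modformZ; apply: modform_sum => i; rewrite mem_index_iota => /andP[i3 lt_in].
rewrite rmorphM /=.
have lt_in4 : (i < n.+4)%N by rewrite (ltn_trans lt_in) // ltnS leqW.
have mi := IH i lt_in4 i3.
have mj : modform (n.+4 - i) (fps_subst r (wpq g (n.+4 - i)%N))
   (fun j => g (n.+4 - i)%N * cusp_ratio K r j ^+ (n.+4 - i)./2).
  by apply: IH; rewrite ?ltn_subRL ?ltn_subLR; clear -i3 lt_in; lia.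
have := modformM mi mj; rewrite (subnKC (ltnW lt_in4)).
apply: eq_modform => j /=.
have [odd_i|even_i] := boolP (odd i).
  by rewrite (sinh_odd w_def gE odd_i) !mul0r.
rewrite mulrACA -exprD; congr (_ * _ ^+ _).
have := halfD i (n.+4 - i)%N; rewrite (negPf even_i) add0n => <-.
by rewrite subnKC // ltnW.
Qed.

End ModularForms.

(** * Forms vanishing at all cusps *)

Section CuspidalPart.
Variables (K : numFieldType) (t W L : fps K).
Hypothesis sys : modular_system (level_R K) (level_p8 K) t W L.

(** Vanishing at the five finite cusps makes the polynomial divisible by t R(t), and vanishing at
    infinity lowers its degree below 4k; hence the quotient has at most 4k - 5 coefficients. *)
Lemma cuspidal_expansion k f : (1 < k)%N -> modform t W (2 * k) f (fun=> 0) ->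
  exists y : nat -> K, f = \sum_(1 <= j < (4 * k - 5).+1)
    fpsC (y j) * (t ^+ j * peval t (level_R K) * W ^+ (2 * k)).
Proof.
move=> k2 [P [sP fP vP]].
pose rs : seq K := [:: 0; - 1 / 2; - 1 / 3; - 1 / 4; - 1 / 6].
have rsP : all (root P) rs.
  rewrite /rs /= /root.
  have v0 : P.[0] = 0 := vP 0%N.
  have v1 : P.[- 1 / 2] = 0 := vP 1%N.
  have v2 : P.[- 1 / 3] = 0 := vP 2%N.
  have v3 : P.[- 1 / 4] = 0 := vP 3%N.
  have v4 : P.[- 1 / 6] = 0 := vP 4%N.
  by rewrite v0 v1 v2 v3 v4 eqxx.
have rs_uniq : uniq_roots rs.
  rewrite uniq_rootsE /rs /= !inE !negb_or.
  have ne (a b : nat) : (0 < a)%N -> (0 < b)%N -> a != b -> (- 1 / a%:R : K) != - 1 / b%:R.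
    move=> a0 b0 ab; rewrite !mulN1r eqr_opp; apply: contraNneq ab => /invr_inj /eqP.
    by rewrite eqr_nat.
  have nz (a : nat) : (0 < a)%N -> (0 : K) != - 1 / a%:R.
    by move=> a0; rewrite eq_sym mulf_neq0 ?oppr_eq0 ?oner_eq0 // invr_eq0 pnatr_eq0 -lt0n.
  by rewrite !nz // !ne.
have [Q PQ] := uniq_roots_prod_XsubC rsP rs_uniq.
have prod_rs : \prod_(z <- rs) ('X - z%:P) = 144^-1 *: ('X * level_R K).
  apply: poly_ext => x; rewrite hornerZ hornerM hornerX horner_Poly_list horner_prod.
  rewrite !big_cons big_nil !hornerXsubC; cbn [horner_list level_R_list].
  by field.
have monic_rs : \prod_(z <- rs) ('X - z%:P) \is monic by apply: monic_prod_XsubC.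
have sQ : (size Q <= 4 * k - 5)%N.
  have [->|Q0] := eqVneq Q 0; first by rewrite size_poly0.
  have sPQ : size P = (size Q + 5)%N.
    by rewrite PQ size_Mmonic // size_prod_XsubC /= addnS.
  have top : P`_(4 * k) = 0 by have := vP 5%N; rewrite mulnA.
  have : size P != (4 * k).+1.
    apply/eqP => s4; have P0 : P != 0 by rewrite -size_poly_gt0 s4.
    by move: P0; rewrite -lead_coef_eq0 lead_coefE s4 top eqxx.
  by move: sP; rewrite mulnA -[(2 * 2)%N]/4%N sPQ; lia.
(* The index is shifted by the factor t, and 144 is the leading coefficient of R. *)
exists (fun j => Q`_j.-1 / 144).
have QE : Q = \sum_(0 <= j < 4 * k - 5) Q`_j *: 'X^j.
  rewrite big_mkord -poly_def; apply/polyP => j; rewrite coef_poly.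
  by case: ltnP => // le_j; rewrite nth_default // (leq_trans sQ).
rewrite fP PQ prod_rs big_add1 /= {1}QE mulr_suml rmorph_sum mulr_sumr.
apply: eq_bigr => j _; rewrite -!mul_polyC !rmorphM /= !pevalC rmorphXn /= pevalX.
by rewrite exprS; ring.
Qed.

End CuspidalPart.

Section CuspIdentity.
Variable K : numFieldType.

(* [bcoef] of the statement, with an arbitrary factor instead of [alpha]. *)
Definition eis_coef (a : K) (r i k : nat) : K :=
  let s : K := (-1) ^+ (i + 1) in
  let t : K := 1 + (-1) ^+ (i + k) in
  match r with
  | 1 => (-1) ^+ k * (3 ^+ (2 * k - i) + s) * a
  | 2 => s * t * (3 ^+ (2 * k - i) + s) * a
  | 3 => (-1) ^+ (i + k) * 3 ^+ (2 * k - i) * (3 ^+ i + s) * a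
  | 4 => (-1) ^+ i * 2 ^+ (2 * k) * (3 ^+ (2 * k - i) + s) * a
  | 6 => - t * 3 ^+ (2 * k - i) * (3 ^+ i + s) * a
  | 12 => 2 ^+ (2 * k) * 3 ^+ (2 * k - i) * (3 ^+ i + s) * a
  | _ => 0
  end.

(* The value at the j-th cusp of [phi(z)^(4k-2i) phi(3z)^(2i)]. *)
Definition theta_value (i k j : nat) : K :=
  match j with
  | 0 => 1
  | 2 => (-1) ^+ i * (-1) ^+ k * 3 ^+ (2 * k - i) / (3 ^+ k) ^+ 3
  | 3 => (-1) ^+ i * (-1) ^+ k / (2 ^+ k) ^+ 4
  | 1 | 4 => 0
  | _ => (2 ^+ k) ^+ 4 * 3 ^+ k * 3 ^+ (2 * k - i)
  end.

(** At each cusp the sum is rational in 2^k, 3^k, 3^(2k-i) and the signs (-1)^i, (-1)^k. The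
    coefficients solve this linear system, with a c as common factor. *)
Lemma cusp_identity (a c : K) i k j : (i <= 2 * k)%N ->
    a * c * ((2 ^+ (2 * k) - 1) * (3 ^+ (2 * k) - 1)) = 1 ->
  \sum_(r <- levels) eis_coef a r i k * (c * cusp_ratio K r j ^+ k) = theta_value i k j.
Proof.
move=> hi ac; rewrite /levels !big_cons big_nil.
have nz (n m : nat) : (0 < n)%N -> (n%:R : K) ^+ m != 0.
  by move=> n0; rewrite expf_neq0 // pnatr_eq0 -lt0n.
have p2 : 2 ^+ (2 * k) = (2 ^+ k) ^+ 2 :> K by rewrite mulnC exprM.
have p3 : 3 ^+ (2 * k) = (3 ^+ k) ^+ 2 :> K by rewrite mulnC exprM.
have v_def : 3 ^+ i = (3 ^+ k) ^+ 2 / 3 ^+ (2 * k - i) :> K.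
  by rewrite -p3 -{1}(subnK hi) exprD mulrAC divff ?mul1r // nz.
have := nz 2 k isT; have := nz 3 k isT; have := nz 3 (2 * k - i)%N isT.
have pw (x y : K) n : (x / y) ^+ n = x ^+ n / y ^+ n by rewrite exprMn exprVn.
have e2 n : (2 ^+ n : K) ^+ k = (2 ^+ k) ^+ n by rewrite -!exprM mulnC.
have e3 n : (3 ^+ n : K) ^+ k = (3 ^+ k) ^+ n by rewrite -!exprM mulnC.
have e1 : (1 : K) ^+ k = 1 by rewrite expr1n.
have e23 (m n : nat) : (2 ^+ m * 3 ^+ n) ^+ k = (2 ^+ k) ^+ m * (3 ^+ k) ^+ n :> K.
  by rewrite exprMn e2 e3.
have pos (x : K) m n : x = 2 ^+ m * 3 ^+ n -> (1 / x) ^+ k = 1 / ((2 ^+ k) ^+ m * (3 ^+ k) ^+ n).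
  by move=> ->; rewrite pw e1 e23.
have neg (x : K) m n : x = 2 ^+ m * 3 ^+ n ->
    (- 1 / x) ^+ k = (-1) ^+ k / ((2 ^+ k) ^+ m * (3 ^+ k) ^+ n).
  by move=> ->; rewrite pw e23.
have inf (x : K) m n : x = 2 ^+ m * 3 ^+ n ->
    (- x) ^+ k = (-1) ^+ k * ((2 ^+ k) ^+ m * (3 ^+ k) ^+ n).
  by move=> ->; rewrite -e23 -exprMn mulN1r.
have r4 := @pos 4 2 0 ltac:(ring). have r16 := @pos 16 4 0 ltac:(ring).
have r64 := @pos 64 6 0 ltac:(ring). have s3 := @neg 3 0 1 ltac:(ring).
have s27 := @neg 27 0 3 ltac:(ring). have s12 := @neg 12 2 1 ltac:(ring).
have s108 := @neg 108 2 3 ltac:(ring). have i1728 := @inf 1728 6 3 ltac:(ring).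
have i432 := @inf 432 4 3 ltac:(ring). have i192 := @inf 192 6 1 ltac:(ring).
have i108 := @inf 108 2 3 ltac:(ring). have i48 := @inf 48 4 1 ltac:(ring).
have i12 := @inf 12 2 1 ltac:(ring).
move: ac; rewrite /eis_coef p2 p3 v_def !exprD expr1.
have [e eE] : exists e : bool, (-1) ^+ i = (-1) ^+ e :> K by exists (odd i); rewrite signr_odd.
have [f fE] : exists f : bool, (-1) ^+ k = (-1) ^+ f :> K by exists (odd k); rewrite signr_odd.
case: j => [|[|[|[|[|j]]]]]; cbn [cusp_ratio theta_value];
[ rewrite e1 | rewrite e1 r4 | rewrite s3 s27 | rewrite r4 r16 r64
| rewrite s3 s27 s12 s108 | rewrite i1728 i432 i192 i108 i48 i12 ]; rewrite eE fE;
move: (2 ^+ k) (3 ^+ k) (3 ^+ (2 * k - i)%N) => X s u ac u0 s0 X0;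
(* Multiplying the right side by the normalization of a c avoids solving for a. *)
rewrite -[RHS]mulr1 -[X in _ = _ * X]ac;
case: e {eE}; case: f {fE}; rewrite ?expr0 ?expr1.
all: time (by field; rewrite ?u0 ?s0 ?X0).
Qed.

End CuspIdentity.

(** * The theta product, the Eisenstein part and their difference as formal series *)

Section FormalTheorem.
Variable K : numFieldType.

(** Gauss's product eta(2rz)^5 / (eta(rz)^2 eta(4rz)^2) for phi(rz). *)
Definition theta_eta (r : nat) : seq (nat * int) :=
  [:: (2 * r, 5%Z); (r, (- 2)%Z); (4 * r, (- 2)%Z)]%N.

Lemma eta_quotientX s n :
  eta_quotient K s ^+ n = eta_quotient K [seq (x.1, x.2 *+ n) | x <- s].
Proof.
rewrite /eta_quotient -expintMn ?eta_log0E //; congr expint.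
rewrite /eta_log mulNrn -sumrMnl big_map; congr (- _); apply: eq_bigr => x _ /=.
have -> : (x.2 *+ n)%:~R = x.2%:~R *+ n :> fps K by rewrite -mulr_natr intrM natz mulrC -pmulrn mulr_natl.
by rewrite [RHS]mulrnAl.
Qed.

Let thetaq r : fps K := eta_quotient K (theta_eta r).

(** E_2k, with its constant term expressed by g as the recursion produces it; from g (2k) = (1 - 2k)
    B_2k / (2k)! it is -B_2k/(4k). *)
Definition eis (g : fps K) (k : nat) : fps K :=
  fpsC ((2 * k - 2)`!%:R / 2 * g (2 * k)%N) + sigmaq K (2 * k - 1).

Section Forms.
Variables (t W L g w : fps K).
Hypothesis sys : modular_system (level_R K) (level_p8 K) t W L.
Hypothesis w_def : w = cosh2 K 1 - 2.
Hypothesis gE : g * w = fpsX ^+ 2.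

Lemma eis_wpq k : (0 < k)%N ->
  eis g k = fpsC ((2 * k - 2)`!%:R / 2) * wpq g (2 * k)%N.
Proof.
case: k => [//|k] _; rewrite /eis.
have -> : (2 * k.+1 = (2 * k).+2)%N by rewrite mulnS.
rewrite wpqE; cbn iota; rewrite mulrDr -rmorphM.
rewrite coshsum_sigmaq oddM andFb !subSS subn0 mulrA -rmorphM; congr (_ + _).
have -> : (2 * k)`!%:R / 2 * (2 / (2 * k)`!%:R) = 1 :> K.
  by field; rewrite pnatr_eq0 -lt0n fact_gt0.
by rewrite rmorph1 mul1r.
Qed.

Lemma eis_modform r k : r \in levels -> (1 < k)%N ->
  modform t W (2 * k) (fps_subst r (eis g k))
    (fun j => (2 * k - 2)`!%:R / 2 * g (2 * k)%N * cusp_ratio K r j ^+ k).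
Proof.
move=> hr k1; rewrite eis_wpq 1?ltnW // rmorphM /= fps_substC.
apply: eq_modform (modformZ _ (wpq_modform sys w_def gE hr _)); last by lia.
by move=> j /=; rewrite mul2n doubleK mulrA.
Qed.

Let size4 (s : seq K) : size s = 5%N -> (size (Poly s) <= (2 * 2).+1)%N.
Proof. by move=> e; rewrite (leq_trans (size_Poly _)) // e. Qed.

(** For i = 2h the product is A^m C^h with k = m + h, and for i = 2h + 1 it is A^m B C^h with k = m
    + h + 1. *)
Lemma theta_modform i k : (0 < k)%N -> (i <= 2 * k)%N ->
  modform t W (2 * k) (thetaq 1 ^+ (4 * k - 2 * i) * thetaq 3 ^+ (2 * i))
    (theta_value K i k).
Proof.
move=> k0 hi.
have A4 : thetaq 1 ^+ 4 = W ^+ 2 * peval t (level_A K).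
  by rewrite -(eta_quotient_A sys) /thetaq eta_quotientX.
have C4 : thetaq 3 ^+ 4 = W ^+ 2 * peval t (level_C K).
  by rewrite -(eta_quotient_C sys) /thetaq eta_quotientX.
have B4 : thetaq 1 ^+ 2 * thetaq 3 ^+ 2 = W ^+ 2 * peval t (level_B K).
  by rewrite -(eta_quotient_B sys) /thetaq !eta_quotientX -eta_quotient_cat.
have mA : modform t W 2 (thetaq 1 ^+ 4) (cusp_A K).
  by exists (level_A K); split=> //; [apply: size4|move=> j; apply: cusp_value_A].
have mC : modform t W 2 (thetaq 3 ^+ 4) (cusp_C K).
  by exists (level_C K); split=> //; [apply: size4|move=> j; apply: cusp_value_C].
have mB : modform t W 2 (thetaq 1 ^+ 2 * thetaq 3 ^+ 2) (cusp_B K).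
  by exists (level_B K); split=> //; [apply: size4|move=> j; apply: cusp_value_B].
have e2 n m : (2 ^+ n : K) ^+ m = (2 ^+ m) ^+ n by rewrite -!exprM mulnC.
have e3 n m : (3 ^+ n : K) ^+ m = (3 ^+ m) ^+ n by rewrite -!exprM mulnC.
have frac (x : K) a b m : x = 2 ^+ a * 3 ^+ b ->
    (- 1 / x) ^+ m = (-1) ^+ m / ((2 ^+ m) ^+ a * (3 ^+ m) ^+ b).
  by move=> ->; rewrite !exprMn exprVn !exprMn e2 e3.
have prodE (x : K) a b m : x = 2 ^+ a * 3 ^+ b ->
    x ^+ m = (2 ^+ m) ^+ a * (3 ^+ m) ^+ b.
  by move=> ->; rewrite exprMn e2 e3.
have nz2 m : (2 : K) ^+ m != 0 by rewrite expf_neq0 // pnatr_eq0.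
have nz3 m : (3 : K) ^+ m != 0 by rewrite expf_neq0 // pnatr_eq0.
have r3 := @frac 3 0 1 _ ltac:(ring). have r16 := @frac 16 4 0 _ ltac:(ring).
have r27 := @frac 27 0 3 _ ltac:(ring). have p432 := @prodE 432 4 3 _ ltac:(ring).
have p48 := @prodE 48 4 1 _ ltac:(ring).
have [even_i|odd_i] : (exists h, i = 2 * h)%N \/ (exists h, i = (2 * h).+1)%N.
- by case/boolP: (odd i) => oi; [right|left]; exists i./2; rewrite mul2n -[LHS]odd_double_half
    ?(negPf oi) ?oi.
- case: even_i => h ih; have [m km] : exists m, k = (m + h)%N by exists (k - h)%N; lia.
  have -> : (4 * k - 2 * i = 4 * m)%N by lia.
  have -> : (2 * i = 4 * h)%N by lia.
  rewrite !exprM; have -> : (2 * k = 2 * m + 2 * h)%N by lia.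
  apply: eq_modform (modformM (modformX m mA) (modformX h mC)) => j.
  have ui : (2 * k - i = m + m)%N by lia.
  have e1 : (-1) ^+ i = 1 :> K by rewrite ih exprM sqrrN !expr1n.
  rewrite /theta_value ui km !exprD e1.
  case: j => [|[|[|[|[|j]]]]]; cbn [cusp_A cusp_C].
  + by rewrite !expr1n mulr1.
  (* At t = -1/2 the value is 0^(m + h), which is zero since m + h = k > 0. *)
  + by rewrite -exprD expr0n; case: (m + h)%N k0 km => // k0 km; rewrite km in k0.
  + by rewrite r3 r27; field; rewrite !(nz2, nz3).
  + by rewrite !r16; field; rewrite !nz2.
  + by rewrite -exprD expr0n; case: (m + h)%N k0 km => // k0 km; rewrite km in k0.
  + by rewrite p432 p48; ring.
- case: odd_i => h ih; have [m km] : exists m, k = (m + h).+1 by exists (k - h).-1; lia.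
  have -> : (4 * k - 2 * i = 4 * m + 2)%N by lia.
  have -> : (2 * i = 2 + 4 * h)%N by lia.
  rewrite (exprD _ (4 * m) 2) (exprD _ 2 (4 * h)) !exprM mulrA -[X in modform _ _ _ (X * _)]mulrA.
  have -> : (2 * k = 2 * m + 2 + 2 * h)%N by lia.
  apply: eq_modform (modformM (modformM (modformX m mA) mB) (modformX h mC)) => j.
  have ui : (2 * k - i = (m + m).+1)%N by lia.
  have e1 : (-1) ^+ i = -1 :> K by rewrite ih exprS exprM sqrrN !expr1n mulr1.
  rewrite /theta_value ui km !exprS !exprD e1.
  case: j => [|[|[|[|[|j]]]]]; cbn [cusp_A cusp_B cusp_C].
  + by rewrite !expr1n !mulr1.
  + by rewrite mulr0 mul0r.
  + by rewrite r3 r27; field; rewrite !(nz2, nz3).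
  + by rewrite !r16; field; rewrite !nz2.
  + by rewrite mulr0 mul0r.
  + by rewrite p432 p48; ring.
Qed.

Lemma eis_theta_identity (a : K) i k : (1 < k)%N -> (i <= 2 * k)%N ->
    a * ((2 * k - 2)`!%:R / 2 * g (2 * k)%N) *
      ((2 ^+ (2 * k) - 1) * (3 ^+ (2 * k) - 1)) = 1 ->
  exists y : nat -> K,
  thetaq 1 ^+ (4 * k - 2 * i) * thetaq 3 ^+ (2 * i) =
    \sum_(r <- levels) fpsC (eis_coef a r i k) * fps_subst r (eis g k)
    + \sum_(1 <= j < (4 * k - 5).+1) fpsC (y j) *
       (fpsX ^+ j * (eta_quotient K eta_R * eta_quotient K eta_t ^+ j
         * eta_quotient K eta_W ^+ (2 * k))).
Proof.
move=> k1 hi ha; have mth := theta_modform (ltnW k1) hi.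
have meis : modform t W (2 * k)
    (\sum_(r <- levels) fpsC (eis_coef a r i k) * fps_subst r (eis g k))
    (theta_value K i k).
  apply: eq_modform (modform_sum _) => [j|r hr].
    by rewrite -(cusp_identity j hi ha).
  exact: modformZ (eis_modform hr k1).
have mdiff : modform t W (2 * k)
    (thetaq 1 ^+ (4 * k - 2 * i) * thetaq 3 ^+ (2 * i)
     + fpsC (-1) * (\sum_(r <- levels) fpsC (eis_coef a r i k) * fps_subst r (eis g k)))
    (fun=> 0).
  apply: eq_modform (modformD mth (modformZ (-1) meis)) => j /=.
  by rewrite mulN1r subrr.
have [y yE] := cuspidal_expansion k1 mdiff; exists y.
rewrite rmorphN1 mulN1r in yE; apply/eqP; rewrite addrC -subr_eq yE; apply/eqP.
apply: eq_bigr => j _; congr (_ * _).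
rewrite (eta_quotient_W sys) (eta_quotient_R sys) -{1}(eta_quotient_t sys) exprMn; ring.
Qed.

End Forms.
End FormalTheorem.

(** * Gauss's product for the theta series *)

Section FinitePochhammer.
Variable K : numFieldType.
Implicit Types f g u : fps K.

Lemma eqfps_expint n g g' : eqfps n g g' -> eqfps n (expint g) (expint g').
Proof.
move=> e m; elim/ltn_ind: m => m IH lt_mn.
case: (posnP m) => [->|m0]; first by rewrite !expint0E.
have mn0 : m%:R != 0 :> K by rewrite pnatr_eq0 -lt0n.
apply: (mulfI mn0); rewrite !expint_recE //; apply: eq_bigr => -[i /= lt_im] _.
have lt' : (m - i < n)%N by apply: leq_ltn_trans lt_mn; apply: leq_subr.
by rewrite IH ?e // (ltn_trans lt_im).
Qed.

Lemma eqfps_subst n r f g : (0 < r)%N -> eqfps n f g ->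
  eqfps n (fps_subst r f) (fps_subst r g).
Proof.
move=> r0 e m lt; rewrite !fps_substE //; case: ifP => // dvd.
by apply: e; apply: leq_ltn_trans lt; apply: leq_div.
Qed.

Lemma fps_substX r : (0 < r)%N -> fps_subst r fpsX = fpsX ^+ r :> fps K.
Proof.
move=> r0; apply: fpsP => n; rewrite fps_substE // fpsXnE.
case: ifP => [/dvdnP[m ->]|ndvd].
  by rewrite mulnK //= -{2}[r]mul1n eqn_pmul2r.
by case: eqP => // e; rewrite e dvdnn in ndvd.
Qed.

Lemma fps_subst_comp r r' f : (0 < r)%N -> (0 < r')%N ->
  fps_subst r (fps_subst r' f) = fps_subst (r * r') f.
Proof.
move=> r0 r'0; apply: fpsP => n; rewrite !fps_substE ?muln_gt0 ?r0 //.
case: ifP => [/dvdnP[m ->]|ndvd].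
  by rewrite mulnK // [(m * r)%N]mulnC dvdn_pmul2l // divnMl.
by case: ifP => // dvd; rewrite (dvdn_trans (dvdn_mulr _ (dvdnn r)) dvd) in ndvd.
Qed.

Lemma fps_subst_eta r s : (0 < r)%N -> all (fun x => 0 < x.1)%N s ->
  fps_subst r (eta_quotient K s) = eta_quotient K [seq ((r * x.1)%N, x.2) | x <- s].
Proof.
move=> r0 /allP s0; apply: expint_unique; first exact: eta_log0E.
  by rewrite fps_substE // dvdn0 div0n eta_quotient0E.
rewrite fpsD_subst // fpsD_eta_quotient rmorphM /= mulrCA; congr (_ * _).
rewrite /eta_log rmorphN rmorph_sum mulrN mulr_sumr big_map; congr (- _).
rewrite big_seq [RHS]big_seq; apply: eq_bigr => x /s0 x0 /=.
rewrite !rmorphM /= rmorph_int rmorph_nat fps_subst_comp //; ring.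
Qed.

(* [n |-> sum_(d | n, 1 <= d <= N) d], the logarithmic derivative of
   [prod_(1 <= j <= N) (1 - q^j)] up to sign *)
Definition sigma_upto N : fps K :=
  Fps (fun n => \sum_(1 <= j < N.+1) (if (0 < n)%N && (j %| n)%N then j%:R else 0)).

Definition pochhammer N u : fps K := \prod_(1 <= j < N.+1) (1 - u ^+ j).

Lemma sigma_upto0E N : sigma_upto N 0%N = 0.
Proof. by rewrite /sigma_upto /= big1. Qed.

Lemma pochhammer_expint N : pochhammer N fpsX = expint (- sigma_upto N).
Proof.
apply: expint_unique; first by rewrite fpsNE sigma_upto0E oppr0.
  rewrite /pochhammer big_nat; elim/big_ind: _ => [//|f g f0 g0|j /andP[j0 _]].
    by rewrite fpsM0E f0 g0 mulr1.
  by rewrite fpsBE fpsXnE; case: j j0 => // j _; rewrite subr0.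
elim: N => [|N IH].
  rewrite /pochhammer big_geq // fpsD1 mul1r; apply/esym/eqP; rewrite oppr_eq0; apply/eqP.
  by apply: fpsP => n /=; rewrite big_geq.
have -> : pochhammer N.+1 fpsX = pochhammer N fpsX * (1 - fpsX ^+ N.+1).
  by rewrite /pochhammer big_nat_recr.
(* The series q^(N+1) / (1 - q^(N+1)), from the logarithmic derivative of the new factor. *)
pose geo : fps K := Fps (fun n => ((0 < n) && (N.+1 %| n))%N%:R).
have geoE : (1 - fpsX ^+ N.+1) * geo = fpsX ^+ N.+1.
  apply: fpsP => n; rewrite mulrBl mul1r fpsBE fpsXn_mulE fpsXnE /=.
  case: (leqP N.+1 n) => [le_n|lt_n]; last first.
    rewrite subr0; case: (posnP n) => [->|n0] //=.
    by rewrite (gtnNdvd n0 lt_n) ltn_eqF.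
  rewrite subn_gt0 dvdn_subl //.
  have -> : (0 < n)%N by apply: leq_trans le_n.
  move: le_n; rewrite leq_eqVlt => /orP[/eqP <-|lt_n] /=.
    by rewrite ltnn dvdnn eqxx subr0.
  by rewrite lt_n [n == _]gtn_eqF // subrr.
have -> : sigma_upto N.+1 = sigma_upto N + N.+1%:R * geo.
  apply: fpsP => n; rewrite fpsDE fps_natME /= big_nat_recr //=; congr (_ + _).
  by case: ifP; rewrite ?mulr1 ?mulr0.
rewrite fpsDM IH raddfB /= fpsD1 fpsDXn /= fpsDX.
have -> : N.+1%:R * fpsX ^+ N * fpsX = N.+1%:R * ((1 - fpsX ^+ N.+1) * geo) :> fps K.
  by rewrite geoE exprS; ring.
by ring.
Qed.

Lemma sigma_upto_sigmaq N : eqfps N.+1 (sigma_upto N) (sigmaq K 1).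
Proof.
move=> n lt_nN; case: (posnP n) => [->|n0]; first by rewrite sigma_upto0E sigmaq0E.
rewrite sigmaqE /= n0 /= -big_mkcond /= /divs big_filter.
rewrite /index_iota subn1 /= (_ : iota 1 N = iota 1 n ++ iota n.+1 (N - n)); last first.
  by rewrite -[in LHS](subnKC (_ : n <= N)%N) // iotaD add1n.
rewrite big_cat /= [X in _ + X]big1_seq ?addr0 //.
move=> j /andP[dvd]; rewrite mem_iota => /andP[lt_nj _].
by rewrite (gtnNdvd n0 lt_nj) in dvd.
Qed.

Lemma eta_log1 r : eta_log K [:: (r, 1%Z)] = - (r%:R * fps_subst r (sigmaq K 1)).
Proof. by rewrite /eta_log big_seq1 mul1r. Qed.

Lemma pochhammer_eta1 N : eqfps N.+1 (pochhammer N fpsX) (eta_quotient K [:: (1%N, 1%Z)]).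
Proof.
rewrite pochhammer_expint; apply: eqfps_expint; rewrite eta_log1; apply: eqfpsN.
have -> : 1%:R * fps_subst 1 (sigmaq K 1) = sigmaq K 1.
  by rewrite mul1r; apply: fpsP => n; rewrite fps_substE // dvd1n divn1.
exact: sigma_upto_sigmaq.
Qed.

Lemma pochhammer_eta r N : (0 < r)%N ->
  eqfps N.+1 (pochhammer N (fpsX ^+ r)) (eta_quotient K [:: (r, 1%Z)]).
Proof.
move=> r0; have := eqfps_subst r0 (@pochhammer_eta1 N).
rewrite fps_subst_eta //= muln1 /pochhammer rmorph_prod.
suff -> : \prod_(1 <= j < N.+1) fps_subst r (1 - fpsX ^+ j) =
  \prod_(1 <= j < N.+1) (1 - fpsX ^+ r ^+ j) :> fps K by [].
by apply: eq_bigr => j _; rewrite rmorphB rmorph1 rmorphXn /= fps_substX.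
Qed.

(* Sharper, as needed to compare truncations at [M] and [2 M]. *)
Lemma pochhammer_eta_double r M : (1 < r)%N ->
  eqfps (2 * M).+1 (pochhammer M (fpsX ^+ r)) (eta_quotient K [:: (r, 1%Z)]).
Proof.
move=> r1; have r0 := ltnW r1 => m lt_m.
have -> : pochhammer M (fpsX ^+ r) = fps_subst r (pochhammer M fpsX).
  rewrite /pochhammer rmorph_prod.
  by apply: eq_bigr => j _; rewrite rmorphB rmorph1 rmorphXn /= fps_substX.
have -> : eta_quotient K [:: (r, 1%Z)] = fps_subst r (eta_quotient K [:: (1%N, 1%Z)]).
  by rewrite fps_subst_eta //= muln1.
rewrite !fps_substE //; case: ifP => // dvd; apply: pochhammer_eta1.
by rewrite ltnS leq_divLR //; nia.
Qed.

End FinitePochhammer.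

Section Gauss.
Variable K : numFieldType.
Implicit Types u : fps K.

Section Shanks.
Variable u : fps K.
Hypothesis u0 : u 0%N = 0.

(** The condition is put inside the existential so that the inverse [I s] is a total function of
    s. *)
Let inv_exists s : exists I : fps K, (0 < s)%N -> (1 + u ^+ s) * I = 1.
Proof.
case: (posnP s) => [->|s0]; first by exists 0.
have [|I IE] := @fps_inv_exists K (1 + u ^+ s); last by exists I.
by rewrite fpsDE fpsX0E u0 expr0n eqn0Ngt s0 addr0 oner_neq0.
Qed.

Let I s : fps K := projT1 (cid (inv_exists s)).
Let IE s : (0 < s)%N -> (1 + u ^+ s) * I s = 1.
Proof. by rewrite /I; case: cid. Qed.

Let r s := (1 - u ^+ s) * I s.

(** The terms of Shanks's finite form of Gauss's identity; for s = 0 the factor 2 / (1 + u^s) is 1,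
    whence the separate case. [U] is a discrete primitive in s of the increment of [T] in n. *)
Let T n s : fps K := if s is 0 then \prod_(1 <= j < n.+1) r j else
  (-1) ^+ s * (\prod_(s.+1 <= j < n.+1) r j) * u ^+ (s * n.+1) * (2 * I s).

Let U n s : fps K := if s is 0 then 0 else
  (-1) ^+ s * 2 * (\prod_(s <= j < n) r j) * u ^+ (s * n) * I n.

Let telescope_step n s : (s < n)%N -> T n s - T n.-1 s = U n s.+1 - U n s.
Proof.
case: n => [//|n] /=; rewrite ltnS => le_sn; have En := IE (ltn0Sn n).
case: s le_sn => [|s] le_sn; rewrite /T /U.
  rewrite subr0 big_nat_recr //= !mul1n expr1 {2}/r.
  set p := \prod_(_ <= _ < _) _; set b := u ^+ _ in En *; set J := I _ in En *.
  by apply: (eq_lincomb (c := p) En); ring.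
rewrite big_nat_recr //= [\prod_(s.+1 <= j < n.+1) _]big_ltn // {2}/r.
have Es := IE (ltn0Sn s).
have -> : (s.+1 * n.+2 = s.+1 * n.+1 + s.+1)%N by rewrite [in LHS]mulnS addnC.
have -> : (s.+2 * n.+1 = s.+1 * n.+1 + n.+1)%N by rewrite mulSn addnC.
rewrite !exprD [(-1) ^+ s.+2]exprS.
set p := \prod_(_ <= _ < _) _; set b := u ^+ n.+1 in En *; set J := I n.+1 in En *.
set a := u ^+ s.+1 in Es *; set H := I s.+1 in Es *; set x := u ^+ _; set e := (-1) ^+ _.
transitivity (e * p * x * 2 * (a * H * ((1 - b) * J) - H * 1)); first by ring.
rewrite -[X in H * X]En.
rewrite (_ : r s.+1 = (1 - a) * H) //.
transitivity (e * 2 * p * x * (- (b * J * 1) - (1 - a) * H * J)); last by ring.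
by rewrite -[X in b * J * X]Es; ring.
Qed.

(** Increasing n changes the right side by a telescoping sum, whose end value [U] adds up with the
    new term [T] to 2 (-1)^s u^(s^2) at s = n + 1. *)
Lemma shanks n : 1 + 2 * \sum_(1 <= s < n.+1) (-1) ^+ s * u ^+ (s * s) =
  \sum_(0 <= s < n.+1) T n s.
Proof.
elim: n => [|n IH].
  by rewrite big_geq // big_nat1 /T big_geq // mulr0 addr0.
rewrite big_nat_recr //= mulrDr addrA IH [RHS]big_nat_recr //=.
have -> : \sum_(0 <= s < n.+1) T n.+1 s = \sum_(0 <= s < n.+1) T n s + U n.+1 n.+1.
  have -> : U n.+1 n.+1 = \sum_(0 <= s < n.+1) (U n.+1 s.+1 - U n.+1 s).
    by rewrite telescope_sumr // subr0.
  rewrite -big_split /= !big_mkord; apply: eq_bigr => s _.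
  by rewrite -(telescope_step (ltn_ord s)) /= addrC subrK.
rewrite -addrA; congr (_ + _); rewrite /U /T !big_geq //.
have En := IE (ltn0Sn n).
have -> : (n.+1 * n.+2 = n.+1 * n.+1 + n.+1)%N by rewrite [in LHS]mulnS addnC.
rewrite exprD; set x := u ^+ (_ * _); set e := (-1) ^+ _.
transitivity (2 * (e * x) * 1); first by rewrite mulr1.
by rewrite -[X in _ * X]En; ring.
Qed.

Let expu_small m : eqfps m (u ^+ m) 0.
Proof.
have -> : u = fpsX * Fps (fun n => u n.+1).
  by apply: fpsP => -[|n]; rewrite fpsX_mulE ?u0.
by move=> n lt_nm; rewrite exprMn fpsXn_mulE leqNgt lt_nm.
Qed.

(** A term with s > 0 contains u^(s(n+1)) and disappears modulo q^(n+1); the product of the 1 + u^j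
    clears the denominators of the remaining one. *)
Lemma shanks_mod n : eqfps n.+1
  ((1 + 2 * \sum_(1 <= s < n.+1) (-1) ^+ s * u ^+ (s * s)) *
    \prod_(1 <= j < n.+1) (1 + u ^+ j)) (pochhammer n u).
Proof.
rewrite shanks [\sum_(_ <= _ < _) _]big_ltn //.
have -> : pochhammer n u = (T n 0 + 0) * \prod_(1 <= j < n.+1) (1 + u ^+ j).
  rewrite addr0 /T -big_split /=; apply: eq_big_nat => j /andP[j0 _].
  by rewrite /r -mulrA [I j * _]mulrC IE // mulr1.
apply: eqfpsM => //; apply: eqfpsD => // m lt_m; rewrite fps_sumE big1_seq ?fps0E //.
move=> s /andP[_]; rewrite mem_index_iota => /andP[s0 _]; case: s s0 => // s _.
have -> : T n s.+1 = u ^+ (s.+1 * n.+1) *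
    ((-1) ^+ s.+1 * (\prod_(s.+2 <= j < n.+1) r j) * (2 * I s.+1)) by rewrite /T; ring.
apply: (@eqfps_mull0 K n.+1) => // k lt_k.
by apply: expu_small; apply: leq_trans lt_k _; rewrite leq_pmull.
Qed.

End Shanks.

Definition theta_series : fps K :=
  Fps (fun n => (n == 0%N)%:R + 2 * \sum_(1 <= s < n.+1) (n == s * s)%N%:R).

(** At u = -q the signs in Shanks's identity cancel, as s + s^2 is even. *)
Lemma theta_trunc N : eqfps N.+1 theta_series
  (1 + 2 * \sum_(1 <= s < N.+1) (-1) ^+ s * (- fpsX) ^+ (s * s)).
Proof.
move=> n lt_nN; rewrite fpsDE fps_natME fps_sumE fps1E.
rewrite [in RHS](@big_cat_nat _ _ _ n.+1) //.
rewrite [X in _ + _ * (X + _)](eq_bigr (fun s => (n == s * s)%N%:R)); last first.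
  move=> s _; rewrite (exprNn fpsX) mulrA -exprD -fpsXnE -signr_odd oddD oddM andbb addbb expr0.
  by rewrite mul1r.
congr (_ + _ * _); rewrite [X in _ + X]big1_seq ?addr0 // => s /andP[_].
rewrite mem_index_iota => /andP[lt_ns _].
rewrite (exprNn fpsX) mulrA -exprD -signr_odd oddD oddM andbb addbb expr0 mul1r fpsXnE.
by rewrite ltn_eqF // (leq_trans lt_ns) // leq_pmull // (leq_trans _ lt_ns).
Qed.

Let E r : fps K := eta_quotient K [:: (r, 1%Z)].

(** The finite form of (-v; -v) (v; v) (v^4; v^4) = (v^2; v^2)^3. It is exact because the lengths 2M
    and M make the exponents of all factors match. *)
Let pochhammer_neg M (v : fps K) :
  pochhammer (2 * M) (- v) * pochhammer (2 * M) v * pochhammer M (v ^+ 4)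
  = pochhammer (2 * M) (v ^+ 2) * pochhammer M (v ^+ 2) ^+ 2.
Proof.
have P0 z : pochhammer 0 z = 1 :> fps K by rewrite /pochhammer big_geq.
have PS N (z : fps K) : pochhammer N.+1 z = pochhammer N z * (1 - z ^+ N.+1).
  by rewrite /pochhammer big_nat_recr.
elim: M => [|M IH]; first by rewrite muln0 !P0; ring.
have -> : (2 * M.+1 = (2 * M).+2)%N by rewrite mulnS.
rewrite !PS.
have n1 : (- v) ^+ (2 * M).+1 = - v ^+ (2 * M).+1.
  by rewrite exprNn -signr_odd /= oddM mulN1r.
have n2 : (- v) ^+ (2 * M).+2 = v ^+ (2 * M).+2.
  by rewrite exprNn -signr_odd /= oddM mul1r.
have p4 : (v ^+ 4) ^+ M.+1 = (v ^+ (2 * M).+2) ^+ 2.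
  by rewrite -!exprM; congr (_ ^+ _); lia.
have p1 : (v ^+ 2) ^+ (2 * M).+1 = (v ^+ (2 * M).+1) ^+ 2 by rewrite -!exprM mulnC.
have p2 : (v ^+ 2) ^+ (2 * M).+2 = (v ^+ (2 * M).+2) ^+ 2 by rewrite -!exprM mulnC.
have p3 : (v ^+ 2) ^+ M.+1 = v ^+ (2 * M).+2.
  by rewrite -!exprM; congr (_ ^+ _); lia.
rewrite n1 n2 p4 p1 p2 p3.
move: (v ^+ (2 * M).+1) (v ^+ (2 * M).+2) => x y.
move: IH; move: (pochhammer _ (- v)) (pochhammer (2 * M) v) (pochhammer M (v ^+ 4)) => a b c.
move: (pochhammer (2 * M) (v ^+ 2)) (pochhammer M (v ^+ 2)) => d e IH.
by apply: (eq_lincomb (c := (1 - x ^+ 2) * (1 - y) ^+ 2 * (1 - y ^+ 2)) IH); ring.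
Qed.

(** Modulo q^(2M+1), Shanks's identity at u = -q is theta Q = Pu. As Q Pu = E 2, it follows that
    theta E 2 = Pu^2, and Pu is eliminated by Pu (E 1) (E 4) = (E 2)^3. *)
Theorem gauss_theta : theta_series = eta_quotient K (theta_eta 1).
Proof.
have key : theta_series * E 2 * (E 1 ^+ 2 * E 4 ^+ 2) = E 2 ^+ 6.
  apply: eqfps_all => N; pose M := N.
  suff : eqfps (2 * M).+1 (theta_series * E 2 * (E 1 ^+ 2 * E 4 ^+ 2)) (E 2 ^+ 6).
    by move=> e m lt; apply: e; rewrite /M; lia.
  have X0 : (- fpsX : fps K) 0%N = 0 by rewrite fpsNE oppr0.
  set Q : fps K := \prod_(1 <= j < (2 * M).+1) (1 + (- fpsX) ^+ j).
  set Pu : fps K := pochhammer (2 * M) (- fpsX).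
  have e1 : eqfps (2 * M).+1 (theta_series * Q) Pu.
    have h := @shanks_mod _ X0 (2 * M)%N.
    have h' := eqfpsM (@theta_trunc (2 * M)%N) (@eqfps_refl _ _ Q).
    exact: eqfps_trans h' h.
  have e2 : eqfps (2 * M).+1 (Q * Pu) (E 2).
    have -> : Q * Pu = pochhammer (2 * M) (fpsX ^+ 2).
      rewrite /Q /Pu /pochhammer -big_split /=; apply: eq_bigr => j _.
      have -> : (fpsX ^+ 2) ^+ j = ((- fpsX) ^+ j) ^+ 2 :> fps K.
        by rewrite -!exprM [(j * 2)%N]mulnC [in RHS]exprM sqrrN -exprM.
      by ring.
    exact: pochhammer_eta.
  have e3 : eqfps (2 * M).+1 (theta_series * E 2) (Pu ^+ 2).
    have h : eqfps (2 * M).+1 (theta_series * E 2) (theta_series * Q * Pu).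
      by rewrite -mulrA; apply: eqfpsM => //; apply: eqfps_sym.
    have h' : eqfps (2 * M).+1 (theta_series * Q * Pu) (Pu ^+ 2).
      by rewrite expr2; apply: eqfpsM.
    exact: eqfps_trans h h'.
  have e4 : eqfps (2 * M).+1 (Pu * E 1 * E 4) (E 2 ^+ 3).
    have h : eqfps (2 * M).+1 (Pu * E 1 * E 4)
        (Pu * pochhammer (2 * M) fpsX * pochhammer M (fpsX ^+ 4)).
      apply: eqfps_sym; apply: eqfpsM; last exact: pochhammer_eta_double.
      by apply: eqfpsM => //; exact: pochhammer_eta1.
    apply: eqfps_trans h _; rewrite pochhammer_neg (exprS (E 2) 2).
    apply: eqfpsM; first exact: pochhammer_eta.
    by apply: eqfpsX; apply: pochhammer_eta_double.
  have h : eqfps (2 * M).+1 (theta_series * E 2 * (E 1 ^+ 2 * E 4 ^+ 2))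
      (Pu ^+ 2 * (E 1 ^+ 2 * E 4 ^+ 2)) by exact: eqfpsM.
  apply: eqfps_trans h _.
  have -> : Pu ^+ 2 * (E 1 ^+ 2 * E 4 ^+ 2) = (Pu * E 1 * E 4) ^+ 2 by ring.
  by have -> : E 2 ^+ 6 = (E 2 ^+ 3) ^+ 2; [ring|exact: eqfpsX].
pose s : seq (nat * int) := [:: (2, 1%Z); (1, 2%Z); (4, 2%Z)]%N.
pose s' : seq (nat * int) := [:: (2, (-1)%Z); (1, (-2)%Z); (4, (-2)%Z)]%N.
have sE : E 2 * (E 1 ^+ 2 * E 4 ^+ 2) = eta_quotient K s.
  by rewrite !eta_quotientX -!eta_quotient_cat.
have ss' : eta_quotient K s * eta_quotient K s' = 1.
  rewrite -eta_quotient_cat /eta_quotient -[RHS](expint0 K); congr expint.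
  by rewrite /eta_log /s /s' !big_cons big_nil /=; ring.
rewrite -[LHS]mulr1 -ss' mulrA -sE [theta_series * _]mulrA key eta_quotientX -eta_quotient_cat.
congr expint.
by rewrite /eta_log /s' !big_cons big_nil /=; ring.
Qed.

Corollary gauss_theta_subst r : (0 < r)%N ->
  fps_subst r theta_series = eta_quotient K (theta_eta r).
Proof.
move=> r0; rewrite gauss_theta fps_subst_eta //=.
by rewrite /theta_eta !muln1 mulnC [(r * 4)%N]mulnC.
Qed.

End Gauss.

(** * Evaluation of power series on a disk *)

(* Instantiating [cvgD] and [cvgM] directly at [R[i]] makes unification
   extremely slow. *)
Lemma cvg_seqD (K : numFieldType) (u v : nat -> K) (a b : K) :
  u @ \oo --> a -> v @ \oo --> b -> (fun n => u n + v n) @ \oo --> a + b.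
Proof. exact: cvgD. Qed.

Lemma cvg_seqM (K : numFieldType) (u v : nat -> K) (a b : K) :
  u @ \oo --> a -> v @ \oo --> b -> (fun n => u n * v n) @ \oo --> a * b.
Proof. exact: cvgM. Qed.

Section Modulus.
Variable R : realType.
Local Notation C := R[i].
Implicit Types (x y : C) (r e : R).

(** The norm of R[i] takes values in R[i]; estimates are carried out in the ordered field R. *)
Definition modulus x : R := complex.Re `|x|.

Lemma modulusE x : `|x| = (modulus x)%:C.
Proof. by rewrite /modulus normc_def. Qed.

Lemma modulus_ge0 x : 0 <= modulus x.
Proof. by rewrite -(lecR 0) -modulusE normr_ge0. Qed.

Lemma modulusM x y : modulus (x * y) = modulus x * modulus y.
Proof. by apply: complexI; rewrite rmorphM /= -!modulusE normrM. Qed.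

Lemma modulusX x n : modulus (x ^+ n) = modulus x ^+ n.
Proof. by apply: complexI; rewrite rmorphXn /= -!modulusE normrX. Qed.

Lemma modulusD x y : modulus (x + y) <= modulus x + modulus y.
Proof. by rewrite -lecR rmorphD /= -!modulusE ler_normD. Qed.

Lemma modulusN x : modulus (- x) = modulus x.
Proof. by apply: complexI; rewrite -!modulusE normrN. Qed.

Lemma modulus_real r : modulus r%:C = `|r|.
Proof. by rewrite /modulus normc_def /= expr0n addr0 sqrtr_sqr. Qed.

Lemma modulus_nat n : modulus n%:R = n%:R.
Proof.
have -> : n%:R = (n%:R : R)%:C by rewrite rmorph_nat.
by rewrite modulus_real normr_nat.
Qed.

Lemma modulus0 : modulus 0 = 0. Proof. exact: (modulus_nat 0). Qed.
Lemma modulus1 : modulus 1 = 1. Proof. exact: (modulus_nat 1). Qed.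

Lemma modulus_eq0 x : modulus x = 0 -> x = 0.
Proof. by move=> e; apply/eqP; rewrite -normr_eq0 modulusE e. Qed.

Lemma modulus_sum (I : Type) (s : seq I) (P : pred I) (F : I -> C) :
  modulus (\sum_(i <- s | P i) F i) <= \sum_(i <- s | P i) modulus (F i).
Proof.
elim/big_rec2: _ => [|i a b _ IH]; first by rewrite modulus0.
by apply: le_trans (modulusD _ _) _; rewrite lerD2l.
Qed.

Lemma modulus_Re x : `|complex.Re x| <= modulus x.
Proof. by rewrite -lecR -modulusE normc_ge_Re. Qed.

Lemma modulus_Im x : `|complex.Im x| <= modulus x.
Proof.
have := modulus_Re (x * - 'i); rewrite modulusM modulusN.
have -> : modulus 'i = 1 by rewrite /modulus normc_def /= expr0n expr1n add0r sqrtr1.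
by rewrite mulr1; case: x => a b /=; rewrite oppr0 mulr0 sub0r mulrN1 opprK.
Qed.

Lemma cvgC_le (u : nat -> C) l : (forall e, 0 < e ->
    \forall n \near \oo, modulus (l - u n) <= e) -> u @ \oo --> l.
Proof.
move=> H; apply/cvgrPdist_le => e; rewrite ltcE /= => /andP[/eqP ei e0].
have eE : e = (complex.Re e)%:C by case: e ei {e0} => a b /= ->.
near=> n; rewrite modulusE eE lecR; near: n; exact: H.
Unshelve. all: by end_near. Qed.

Lemma cvgCP (u : nat -> C) l : u @ \oo --> l ->
  forall e, 0 < e -> \forall n \near \oo, modulus (l - u n) <= e.
Proof.
move=> /cvgrPdist_le H e e0; have e0' : 0 < e%:C :> C by rewrite ltcR.
by near=> n; rewrite -lecR -modulusE; near: n; apply: H.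
Unshelve. all: by end_near. Qed.

Lemma cvg_Re (u : nat -> C) a b :
    (fun n => complex.Re (u n)) @ \oo --> a -> (fun n => complex.Im (u n)) @ \oo --> b ->
  u @ \oo --> a +i* b.
Proof.
move=> ua ub; apply: cvgC_le => e e0; near=> n.
have -> : a +i* b - u n = (a - complex.Re (u n))%:C + 'i * (b - complex.Im (u n))%:C.
  by case: (u n) => c d; apply/eqP; rewrite eq_complex /=; apply/andP; split; apply/eqP; ring.
apply: le_trans (modulusD _ _) _; rewrite modulusM !modulus_real.
have -> : modulus 'i = 1 by rewrite /modulus normc_def /= expr0n expr1n add0r sqrtr1.
rewrite mul1r [leRHS]splitr lerD //; near: n.
- by move/cvgrPdist_le : ua; apply; rewrite divr_gt0.
- by move/cvgrPdist_le : ub; apply; rewrite divr_gt0.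
Unshelve. all: by end_near. Qed.

End Modulus.

Local Open Scope ring_scope.

Section Radius.
Variable R : realType.
Local Notation C := R[i].
Local Notation modulus := (@modulus R).
Implicit Types (f g : fps C) (x : C) (r rho : R).

Lemma geometric_cvg0 (A b : R) : 0 <= b < 1 ->
  forall e, 0 < e -> \forall n \near \oo, A * b ^+ n <= e.
Proof.
move=> /andP[b0 b1] e e0; have nb : `|b| < 1 by rewrite ger0_norm.
have /cvgrPdist_le/(_ e e0) := @cvg_geometric R A b nb.
apply: filterS => n; rewrite sub0r normrN; apply: le_trans; exact: ler_norm.
Qed.

Lemma cvgC_geometric (u : nat -> C) l (A b : R) : 0 <= b < 1 ->
  (forall n, modulus (l - u n) <= A * b ^+ n) -> u @ \oo --> l.
Proof.
move=> b01 H; apply: cvgC_le => e e0; near=> n.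
by apply: le_trans (H n) _; near: n; apply: geometric_cvg0.
Unshelve. all: by end_near. Qed.

(** Each of the n + 1 terms b^i with i <= n is at least b^n. This absorbs the polynomial factors
    caused by products and derivatives. *)
Lemma natr_mul_geometric (b : R) n : 0 <= b < 1 -> n.+1%:R * b ^+ n <= (1 - b)^-1.
Proof.
move=> /andP[b0 b1]; have b1' : 0 < 1 - b by rewrite subr_gt0.
rewrite -[leRHS]mul1r ler_pdivlMr //.
have e : (\sum_(i < n.+1) b ^+ i) * (1 - b) = 1 - b ^+ n.+1.
  have := subrX1 b n.+1; rewrite -[b - 1]opprB mulNr => /eqP.
  by rewrite -eqr_oppLR opprB mulrC => /eqP ->.
apply: (@le_trans _ _ ((\sum_(i < n.+1) b ^+ i) * (1 - b))); last first.
  by rewrite e gerBl exprn_ge0.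
rewrite ler_wpM2r ?(ltW b1') // mulr_natl -[X in _ *+ X](card_ord n.+1) -sumr_const.
apply: ler_sum => i _; apply: ler_wiXn2l => //; first exact: ltW.
by rewrite -ltnS ltn_ord.
Qed.

(* [f] converges on the open disk of radius [r]. *)
Definition conv_radius r f : Prop := forall rho, 0 <= rho < r ->
  exists A, forall n, modulus (f n) * rho ^+ n <= A.

Lemma radius_weaken r r' f : r' <= r -> conv_radius r f -> conv_radius r' f.
Proof.
by move=> le_r rf rho /andP[rho0 lt]; apply: rf; rewrite rho0 (lt_le_trans lt).
Qed.

Lemma radius_majorant r f g : (forall n, modulus (f n) <= modulus (g n)) ->
  conv_radius r g -> conv_radius r f.
Proof.
move=> H rg rho hrho; have [A HA] := rg rho hrho; exists A => n.
apply: le_trans (HA n); apply: ler_wpM2r => //.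
by rewrite exprn_ge0 //; case/andP: hrho.
Qed.

Lemma radius_pos r f rho : 0 <= rho < r -> conv_radius r f ->
  exists2 A, 0 <= A & forall n, modulus (f n) * rho ^+ n <= A.
Proof.
move=> hrho /(_ rho hrho)[A HA]; exists A => //; apply: le_trans (HA 0%N).
by rewrite expr0 mulr1 modulus_ge0.
Qed.

(* A radius strictly between [rho] and [r], and the ratio. *)
Lemma between (rho r : R) : 0 <= rho < r -> exists rho' b,
  [/\ 0 <= rho' < r, 0 <= b < 1, rho < rho' & rho = rho' * b].
Proof.
move=> /andP[rho0 lt_r]; pose rho' := (rho + r) / 2.
have h1 : rho < rho' by rewrite midf_lt.
have h2 : rho' < r by rewrite midf_lt.
have h0 : 0 < rho' by apply: le_lt_trans h1.
exists rho', (rho / rho'); split=> //.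
- by rewrite h2 ltW.
- by rewrite divr_ge0 ?(ltW h0) //= ltr_pdivrMr // mul1r.
- by rewrite mulrC divfK // gt_eqF.
Qed.

Lemma radius_geometric r f rho : 0 <= rho < r -> conv_radius r f ->
  exists A b, [/\ 0 <= A, 0 <= b < 1 & forall n, modulus (f n) * rho ^+ n <= A * b ^+ n].
Proof.
move=> /between[rho' [b [hrho' hb lt rhoE]]] rf.
have [A A0 HA] := radius_pos hrho' rf; exists A, b; split=> // n.
rewrite rhoE exprMn mulrA ler_wpM2r ?exprn_ge0 //; by case/andP: hb.
Qed.

Lemma radiusC r c : conv_radius r (fpsC c).
Proof.
move=> rho /andP[rho0 _]; exists (modulus c) => -[|n]; first by rewrite expr0 mulr1.
by rewrite modulus0 mul0r modulus_ge0.
Qed.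

Lemma radiusXn r m : conv_radius r (fpsX ^+ m).
Proof.
move=> rho /andP[rho0 _]; exists (rho ^+ m) => n; rewrite fpsXnE.
by case: eqP => [->|_]; rewrite (modulus1, modulus0) ?mul1r // mul0r exprn_ge0.
Qed.

Lemma radiusD r f g : conv_radius r f -> conv_radius r g -> conv_radius r (f + g).
Proof.
move=> rf rg rho hrho; have [A HA] := rf rho hrho; have [B HB] := rg rho hrho.
exists (A + B) => n; apply: le_trans (lerD (HA n) (HB n)).
rewrite -mulrDl ler_wpM2r ?modulusD // exprn_ge0 //; by case/andP: hrho.
Qed.

Lemma radiusN r f : conv_radius r f -> conv_radius r (- f).
Proof. by apply: radius_majorant => n; rewrite fpsNE modulusN. Qed.

Lemma radiusB r f g : conv_radius r f -> conv_radius r g -> conv_radius r (f - g).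
Proof. by move=> rf rg; apply: radiusD => //; apply: radiusN. Qed.

Lemma radiusM r f g : conv_radius r f -> conv_radius r g -> conv_radius r (f * g).
Proof.
move=> rf rg rho /between[rho' [b [hrho' hb lt rhoE]]].
have [A A0 HA] := radius_pos hrho' rf; have [B B0 HB] := radius_pos hrho' rg.
have rho'0 : 0 <= rho' by case/andP: hrho'.
exists (A * B / (1 - b)) => n; rewrite rhoE exprMn mulrA.
apply: (@le_trans _ _ ((A * B * n.+1%:R) * b ^+ n)).
  rewrite ler_wpM2r ?exprn_ge0 //; first by case/andP: hb.
  apply: (@le_trans _ _ (\sum_(i < n.+1) A * B)).
    apply: le_trans (ler_wpM2r (exprn_ge0 _ rho'0) (modulus_sum _ _ _)) _.
    rewrite mulr_suml; apply: ler_sum => -[i /= lt_in] _.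
    rewrite modulusM -{2}(subnKC (lt_in : (i <= n)%N)) exprD mulrACA.
    by rewrite ler_pM // mulr_ge0 ?modulus_ge0 ?exprn_ge0.
  by rewrite sumr_const card_ord mulr_natr.
by rewrite -mulrA ler_wpM2l ?mulr_ge0 // natr_mul_geometric.
Qed.

Lemma radiusX r f n : conv_radius r f -> conv_radius r (f ^+ n).
Proof.
move=> rf; elim: n => [|n IH]; last by rewrite exprS; apply: radiusM.
by rewrite expr0 -(rmorph1 fpsC); apply: radiusC.
Qed.

Lemma radius_sum r (I : eqType) (s : seq I) (F : I -> fps C) :
  (forall i, i \in s -> conv_radius r (F i)) -> conv_radius r (\sum_(i <- s) F i).
Proof.
elim: s => [|i s IH] H; first by rewrite big_nil -(rmorph0 fpsC); apply: radiusC.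
rewrite big_cons; apply: radiusD; first by apply: H; rewrite inE eqxx.
by apply: IH => j js; apply: H; rewrite inE js orbT.
Qed.

Lemma radiusDer r f : conv_radius r f -> conv_radius r (fpsD f).
Proof.
move=> rf rho /between[rho' [b [hrho' hb lt rhoE]]].
have [A A0 HA] := radius_pos hrho' rf; have b0 : 0 <= b by case/andP: hb.
exists (A / (1 - b)) => n; rewrite fpsDerE modulusM modulus_nat rhoE exprMn.
apply: (@le_trans _ _ (A * (n.+1%:R * b ^+ n))); last first.
  by rewrite ler_wpM2l // natr_mul_geometric.
have -> : n%:R * modulus (f n) * (rho' ^+ n * b ^+ n) = (modulus (f n) * rho' ^+ n) * (n%:R * b ^+ n).
  by ring.
rewrite ler_pM ?mulr_ge0 ?modulus_ge0 ?exprn_ge0 //; first by case/andP: hrho'.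
by rewrite ler_wpM2r ?exprn_ge0 // ler_nat.
Qed.

Lemma radius_subst (m : nat) f : (0 < m)%N -> conv_radius 1 f -> conv_radius 1 (fps_subst m f).
Proof.
move=> m0 rf rho /andP[rho0 rho1].
have hr : 0 <= rho ^+ m < 1 by rewrite exprn_ge0 //= exprn_ilt1 // -lt0n.
have [A A0 HA] := radius_pos hr rf; exists A => n; rewrite fps_substE //.
case: ifP => [/dvdnP[k ->]|_]; last by rewrite modulus0 mul0r.
by rewrite mulnK // [(k * m)%N]mulnC exprM.
Qed.

Lemma sum_geometric_le (b : R) n : 0 <= b < 1 -> \sum_(i < n) b ^+ i <= 1 / (1 - b).
Proof.
move=> /andP[b0 b1]; have b1' : 0 < 1 - b by rewrite subr_gt0.
rewrite ler_pdivlMr //.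
have -> : (\sum_(i < n) b ^+ i) * (1 - b) = 1 - b ^+ n.
  have := subrX1 b n; rewrite -[b - 1]opprB mulNr => /eqP.
  by rewrite -eqr_oppLR opprB mulrC => /eqP ->.
by rewrite gerBl exprn_ge0.
Qed.

(** The weighted coefficients a_n satisfy n a_n <= S max a_i over i < n, where S bounds a geometric
    sum. Once n >= S no new maximum can occur, so the finitely many first coefficients bound them
    all. *)
Lemma radius_expint r g : conv_radius r g -> conv_radius r (expint g).
Proof.
move=> rg rho hrho; have rho0 : 0 <= rho by case/andP: hrho.
have [B [b [B0 hb HB]]] := radius_geometric hrho rg.
pose a n := modulus (expint g n) * rho ^+ n.
have a0 n : 0 <= a n by rewrite mulr_ge0 ?modulus_ge0 ?exprn_ge0.
have step n : (0 < n)%N -> n%:R * a n <= \sum_(i < n) a i * (B * b ^+ (n - i)).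
  move=> n0; rewrite /a mulrA -modulus_nat -modulusM expint_recE //.
  apply: le_trans (ler_wpM2r (exprn_ge0 _ rho0) (modulus_sum _ _ _)) _.
  rewrite mulr_suml; apply: ler_sum => -[i /= lt_in] _.
  rewrite modulusM -{2}(subnKC (ltnW lt_in)) exprD mulrACA.
  by rewrite ler_wpM2l ?mulr_ge0 ?modulus_ge0 ?exprn_ge0.
pose S := B * (1 / (1 - b)).
have [m mS] : exists m : nat, S <= m%:R.
  exists (Num.Def.archi_bound S); apply/ltW/archi_boundP.
  by rewrite mulr_ge0 // div1r invr_ge0 subr_ge0 ltW //; case/andP: hb.
pose M := \sum_(i < m.+1) a i.
have aM i : (i <= m)%N -> a i <= M.
  move=> le_im; have lt_im : (i < m.+1)%N by [].
  by rewrite /M (bigD1 (Ordinal lt_im)) //= lerDl sumr_ge0.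
exists M => n; rewrite -/(a n); elim/ltn_ind: n => n IH.
have [le_nm|lt_mn] := leqP n m; first exact: aM.
have n0 : (0 < n)%N by apply: leq_ltn_trans lt_mn.
have M0 : 0 <= M by apply: le_trans (aM 0%N _).
have nR : 0 < n%:R :> R by rewrite ltr0n.
rewrite -(ler_pM2l nR); apply: le_trans (step n n0) _.
apply: (@le_trans _ _ (\sum_(i < n) M * (B * b ^+ (n - i)))).
  apply: ler_sum => -[i lt_in] _; rewrite ler_wpM2r ?IH //.
  by rewrite mulr_ge0 // exprn_ge0 //; case/andP: hb.
rewrite -!mulr_sumr mulrC ler_wpM2r // (le_trans _ (_ : S <= n%:R)) //; last first.
  by rewrite (le_trans mS) // ler_nat ltnW.
rewrite ler_wpM2l //; apply: le_trans (sum_geometric_le n hb).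
rewrite (reindex_inj rev_ord_inj) /=; apply: ler_sum => -[i lt_in] _ /=.
rewrite subKn //; case/andP: hb => b0 b1.
by rewrite exprS -[leRHS]mul1r ler_wpM2r ?exprn_ge0 // ltW.
Qed.

Lemma radius_natX k : conv_radius 1 (Fps (fun n => n%:R ^+ k)).
Proof.
elim: k => [|k IH].
  move=> rho /andP[rho0 rho1]; exists 1 => n; rewrite [coefs _ n]/= expr0 modulus1 mul1r.
  by rewrite exprn_ile1 // ltW.
have -> : Fps (fun n => n%:R ^+ k.+1) = fpsD (Fps (fun n => n%:R ^+ k)) :> fps C.
  by apply: fpsP => n; rewrite /= exprS.
exact: radiusDer.
Qed.

Definition fps_eval f x : C := limn (series (fun n => f n * x ^+ n) : nat -> C).

Definition evals_to f x (l : C) : Prop :=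
  (series (fun n => f n * x ^+ n) : nat -> C) @ \oo --> l.

Lemma evals_to_eval f x l : evals_to f x l -> fps_eval f x = l.
Proof. by move/cvg_lim; apply. Qed.

Let seriesE (V : zmodType) (u : nat -> V) n : series u n = \sum_(i < n) u i.
Proof. by rewrite /series /= big_mkord. Qed.

Let Re_sum n (F : nat -> C) :
  complex.Re (\sum_(i < n) F i) = \sum_(i < n) complex.Re (F i).
Proof. by elim/big_rec2: _ => // i y1 y2 _ <-; rewrite raddfD. Qed.

Let Im_sum n (F : nat -> C) :
  complex.Im (\sum_(i < n) F i) = \sum_(i < n) complex.Im (F i).
Proof. by elim/big_rec2: _ => // i y1 y2 _ <-; rewrite raddfD. Qed.

(** Real and imaginary parts converge absolutely, each being dominated by a real geometric
    series. *)
Lemma evals_to_exists r f x : modulus x < r -> conv_radius r f -> exists l, evals_to f x l.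
Proof.
move=> xr rf; have hx : 0 <= modulus x < r by rewrite modulus_ge0.
have [A [b [A0 hb HA]]] := radius_geometric hx rf.
have bn : `|b| < 1 by case/andP: hb => b0 b1; rewrite ger0_norm.
have cv (u : nat -> R) : (forall n, `|u n| <= modulus (f n * x ^+ n)) -> cvgn (series u).
  move=> H; apply: normed_cvg; apply: (@series_le_cvg _ _ (fun n => A * b ^+ n)).
  - by move=> n; apply: normr_ge0.
  - by move=> n; rewrite mulr_ge0 // exprn_ge0 //; case/andP: hb.
  - by move=> n; rewrite (le_trans (H n)) // modulusM modulusX.
  - exact: is_cvg_geometric_series.
have /cv cR : forall n, `|complex.Re (f n * x ^+ n)| <= modulus (f n * x ^+ n).
  by move=> n; apply: modulus_Re.
have /cv cI : forall n, `|complex.Im (f n * x ^+ n)| <= modulus (f n * x ^+ n).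
  by move=> n; apply: modulus_Im.
exists (limn (series (fun n => complex.Re (f n * x ^+ n))) +i*
        limn (series (fun n => complex.Im (f n * x ^+ n)))).
apply: cvg_Re.
- have -> : (fun n => complex.Re (series (fun n => f n * x ^+ n) n)) =
     series (fun n => complex.Re (f n * x ^+ n)).
    by apply: funext => n; rewrite !seriesE; exact: (Re_sum n (fun k => f k * x ^+ k)).
  exact: cR.
- have -> : (fun n => complex.Im (series (fun n => f n * x ^+ n) n)) =
     series (fun n => complex.Im (f n * x ^+ n)).
    by apply: funext => n; rewrite !seriesE; exact: (Im_sum n (fun k => f k * x ^+ k)).
  exact: cI.
Qed.

Lemma evalP r f x : modulus x < r -> conv_radius r f -> evals_to f x (fps_eval f x).
Proof.
by move=> xr rf; have [l fl] := evals_to_exists xr rf; rewrite (evals_to_eval fl).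
Qed.

Lemma evals_toD f g x a b : evals_to f x a -> evals_to g x b -> evals_to (f + g) x (a + b).
Proof.
move=> fa gb; rewrite /evals_to.
have -> : (series (fun n => (f + g) n * x ^+ n) : nat -> C) =
    series (fun n => f n * x ^+ n) \+ series (fun n => g n * x ^+ n).
  by apply: funext => n; rewrite /= !seriesE -big_split /=; apply: eq_bigr => i _; rewrite mulrDl.
by apply: (@cvg_seqD C); [exact: fa|exact: gb].
Qed.

(** The partial sum of the product and the product of the partial sums agree below x^N; the terms
    from N on in the product of the truncated polynomials are O(d^N). *)
Lemma evals_toM r f g x a b0 : modulus x < r -> conv_radius r f -> conv_radius r g ->
  evals_to f x a -> evals_to g x b0 -> evals_to (f * g) x (a * b0).
Proof.
move=> xr rf rg fa gb; have hx : 0 <= modulus x < r by rewrite modulus_ge0.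
have [rho [c [hrho hc lt xE]]] := between hx.
have [A A0 HA] := radius_pos hrho rf; have [B B0 HB] := radius_pos hrho rg.
(* The ratio c is split as d b: the powers of b absorb the number n + 1 of terms in a convolution,
   and those of d remain for the decay. *)
have [d [b [hd hb _ cE]]] := between hc.
have fg : (fun n => series (fun n => f n * x ^+ n) n * series (fun n => g n * x ^+ n) n) @ \oo --> a * b0.
  by apply: (@cvg_seqM C); [exact: fa|exact: gb].
have d0 : 0 <= d by case/andP: hd.
have b_ge0 : 0 <= b by case/andP: hb.
have c0 : 0 <= c by case/andP: hc.
have rho0 : 0 <= rho by case/andP: hrho.
pose M := A * B / (1 - b).
have M0 : 0 <= M by rewrite !mulr_ge0 // invr_ge0 subr_ge0 ltW //; case/andP: hb.
suff diff : (fun n => series (fun n => (f * g) n * x ^+ n) n -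
   series (fun n => f n * x ^+ n) n * series (fun n => g n * x ^+ n) n) @ \oo --> (0 : C).
  rewrite /evals_to -[a * b0]add0r.
  have -> : (series (fun n => (f * g) n * x ^+ n) : nat -> C) =
    (fun n => series (fun n => (f * g) n * x ^+ n) n -
       series (fun n => f n * x ^+ n) n * series (fun n => g n * x ^+ n) n)
    \+ (fun n => series (fun n => f n * x ^+ n) n * series (fun n => g n * x ^+ n) n).
    by apply: funext => n /=; rewrite subrK.
  by apply: (@cvg_seqD C); [exact: diff|exact: fg].
apply: (@cvgC_geometric _ 0 (M * (1 / (1 - d))) d) => // N.
rewrite sub0r modulusN /= !seriesE.
pose P : {poly C} := \poly_(i < N) f i; pose Q : {poly C} := \poly_(i < N) g i.
have PE : \sum_(i < N) f i * x ^+ i = P.[x].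
  rewrite (horner_coef_wide _ (size_poly _ _)).
  by apply: eq_bigr => i _; rewrite coef_poly ltn_ord.
have QE : \sum_(i < N) g i * x ^+ i = Q.[x].
  rewrite (horner_coef_wide _ (size_poly _ _)).
  by apply: eq_bigr => i _; rewrite coef_poly ltn_ord.
have sPQ : (size (P * Q)%R <= N + N)%N.
  apply: leq_trans (size_polyMleq P Q) _; apply: leq_trans (leq_pred _) _.
  by apply: leq_add; apply: size_poly.
have coefPQ n : modulus (P * Q)`_n * modulus x ^+ n <= M * d ^+ n.
  rewrite xE exprMn coefM.
  apply: (@le_trans _ _ (A * B * n.+1%:R * c ^+ n)).
    rewrite mulrA ler_wpM2r ?exprn_ge0 //.
    apply: (@le_trans _ _ (\sum_(i < n.+1) A * B)); last first.
      by rewrite sumr_const card_ord mulr_natr.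
    apply: le_trans (ler_wpM2r (exprn_ge0 _ rho0) (modulus_sum _ _ _)) _.
    rewrite mulr_suml; apply: ler_sum => -[i /= lt_in] _.
    rewrite modulusM -{2}(subnKC (lt_in : (i <= n)%N)) exprD mulrACA.
    have pc (h : fps C) D k : 0 <= D -> (forall k, modulus (h k) * rho ^+ k <= D) ->
        modulus (\poly_(i < N) h i)`_k * rho ^+ k <= D.
      by move=> D0 H; rewrite coef_poly; case: ifP; rewrite // modulus0 mul0r.
    by rewrite ler_pM ?pc // mulr_ge0 ?modulus_ge0 ?exprn_ge0.
  have -> : A * B * n.+1%:R * c ^+ n = A * B * d ^+ n * (n.+1%:R * b ^+ n).
    by rewrite cE exprMn; move: n.+1%:R => m; ring.
  have -> : M * d ^+ n = A * B * d ^+ n * (1 - b)^-1 by rewrite /M; ring.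
  rewrite ler_wpM2l ?mulr_ge0 ?exprn_ge0 //.
  exact: natr_mul_geometric.
rewrite PE QE -hornerM (horner_coef_wide _ sPQ) big_split_ord /=.
have -> : \sum_(i < N) (f * g) i * x ^+ i = \sum_(i < N) (P * Q)`_i * x ^+ i.
  apply: eq_bigr => i _; congr (_ * _); rewrite coefM fpsME; case: i => i lt_iN.
  apply: eq_bigr => -[k lt_ki] _; rewrite !coef_poly /=.
  by rewrite (leq_trans lt_ki lt_iN) (leq_ltn_trans (leq_subr _ _) lt_iN).
rewrite opprD addrA subrr sub0r modulusN; apply: le_trans (modulus_sum _ _ _) _.
apply: (@le_trans _ _ (\sum_(i < N) M * d ^+ N * d ^+ i)).
  apply: ler_sum => i _; rewrite modulusM modulusX -mulrA -exprD; exact: coefPQ.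
by rewrite -mulr_sumr mulrAC ler_wpM2r ?exprn_ge0 // ler_wpM2l // sum_geometric_le.
Qed.

End Radius.

Section Evaluation.
Variable R : realType.
Local Notation C := R[i].
Local Notation modulus := (@modulus R).
Implicit Types (f g h : fps C) (x : C) (r rho : R).

Lemma evals_toE f x n : series (fun n => f n * x ^+ n) n = \sum_(i < n) f i * x ^+ i.
Proof. by rewrite /series /= big_mkord. Qed.

Lemma cvgC_subseq (u : nat -> C) (l : C) (phi : nat -> nat) :
  (forall n, (n <= phi n)%N) -> u @ \oo --> l -> (fun n => u (phi n)) @ \oo --> l.
Proof.
move=> le_phi ul; apply: cvgC_le => e /(cvgCP ul)[N _ HN]; exists N => // n /= leNn.
by apply: HN; rewrite /= (leq_trans leNn).
Qed.

Lemma cvgC_unique (u : nat -> C) (l l' : C) : u @ \oo --> l -> u @ \oo --> l' -> l = l'.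
Proof.
move=> ul ul'; apply/eqP; rewrite -subr_eq0; apply/eqP/modulus_eq0/eqP.
rewrite eq_le modulus_ge0 andbT; apply/ler_addgt0Pr => e e0; rewrite add0r.
have e20 : 0 < e / 2 by rewrite divr_gt0.
have [N _ HN] := cvgCP ul e20; have [N' _ HN'] := cvgCP ul' e20.
have {}HN := HN (maxn N N') (leq_maxl _ _); have {}HN' := HN' (maxn N N') (leq_maxr _ _).
rewrite [e]splitr -(subrKA (u (maxn N N'))) (le_trans (modulusD _ _)) //.
by rewrite lerD // -opprB modulusN.
Qed.

Lemma cvgC_eventually (u v : nat -> C) (l : C) N :
  (forall n, (N <= n)%N -> u n = v n) -> v @ \oo --> l -> u @ \oo --> l.
Proof.
move=> uv vl; apply: cvgC_le => e /(cvgCP vl)[N' _ HN']; exists (maxn N N') => // n.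
rewrite /= geq_max => /andP[le le']; rewrite uv //; exact: HN'.
Qed.

Lemma cvgC_cst (l : C) : (fun _ : nat => l) @ \oo --> l.
Proof.
by apply: cvgC_le => e e0; exists 0%N => // n _; rewrite /= subrr modulus0 ltW.
Qed.

Lemma modulus_lim (u : nat -> C) (l : C) (B : R) N : u @ \oo --> l ->
  (forall n, modulus (u (N + n)%N) <= B) -> modulus l <= B.
Proof.
move=> ul uB; apply/ler_addgt0Pr => e /(cvgCP ul)[N' _ HN'].
have le := HN' (N + N')%N (leq_addl _ _).
by rewrite -(subrK (u (N + N')%N) l) (le_trans (modulusD _ _)) // addrC lerD.
Qed.

Lemma evals_to_finite f x N : (forall n, (N <= n)%N -> f n = 0) ->
  evals_to f x (\sum_(i < N) f i * x ^+ i).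
Proof.
move=> fN; apply: (cvgC_eventually (N := N)); last exact: cvgC_cst.
move=> n le_Nn; rewrite evals_toE -(subnKC le_Nn) big_split_ord /=.
by rewrite [X in _ + X]big1 ?addr0 // => i _; rewrite fN ?mul0r // leq_addr.
Qed.

Lemma evals_toC c x : evals_to (fpsC c) x c.
Proof.
have := @evals_to_finite (fpsC c) x 1 _; rewrite big_ord_recl big_ord0 addr0 expr0 mulr1.
by apply; case.
Qed.

Lemma evals_toXn m x : evals_to (fpsX ^+ m) x (x ^+ m).
Proof.
have := @evals_to_finite (fpsX ^+ m) x m.+1 _; rewrite big_ord_recr big1 /=.
  rewrite add0r fpsXnE eqxx mul1r; apply=> n lt; rewrite fpsXnE.
  by rewrite gtn_eqF.
by move=> i _; rewrite fpsXnE ltn_eqF ?mul0r.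
Qed.

Lemma eval_bound h x l rho (c A : R) N : 0 <= rho -> 0 <= c < 1 ->
    modulus x = rho * c -> (forall i, modulus (h i) * rho ^+ i <= A) ->
    (forall i, (i < N)%N -> h i = 0) -> evals_to h x l ->
  modulus l <= A * (c ^+ N / (1 - c)).
Proof.
move=> rho0 hc xE hA h0 /(modulus_lim (N := N)); apply=> n; have c0 : 0 <= c by case/andP: hc.
have A0 : 0 <= A by apply: le_trans (hA 0%N); rewrite expr0 mulr1 modulus_ge0.
rewrite evals_toE big_split_ord /= big1 ?add0r; last first.
  by move=> i _; rewrite h0 ?mul0r.
apply: le_trans (modulus_sum _ _ _) _.
apply: (@le_trans _ _ (\sum_(i < n) (A * c ^+ N) * c ^+ i)).
  apply: ler_sum => i _; rewrite modulusM modulusX xE exprMn mulrA -[leRHS]mulrA -exprD.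
  by rewrite ler_wpM2r // exprn_ge0.
by rewrite -mulr_sumr -mulrA ler_wpM2l // ler_wpM2l ?exprn_ge0 // -div1r sum_geometric_le.
Qed.

(** Dominated convergence: f - F N starts at x^N and is bounded by twice the majorant, hence takes a
    value O(c^N). Infinite products and theta sums are obtained in this way. *)
Lemma evals_to_limit (F : nat -> fps C) f g x (y : nat -> C) (l : C) r :
    modulus x < r -> conv_radius r g -> (forall n, modulus (f n) <= modulus (g n)) ->
    (forall N n, modulus (F N n) <= modulus (g n)) ->
    (forall N, eqfps N (F N) f) -> (forall N, evals_to (F N) x (y N)) ->
    evals_to f x l ->
  y @ \oo --> l.
Proof.
move=> xr rg fg Fg Ff Fy fl; have hx : 0 <= modulus x < r by rewrite modulus_ge0.
have [rho [c [hrho hc _ xE]]] := between hx.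
have rho0 : 0 <= rho by case/andP: hrho.
have [A A0 HA] := radius_pos hrho rg.
apply: (@cvgC_geometric R y l (2 * A / (1 - c)) c) => // N.
have e : evals_to (f + fpsC (-1) * F N) x (l - y N).
  have FN : conv_radius r (F N) by apply: radius_majorant rg.
  rewrite -[X in evals_to _ _ (_ + X)]mulN1r; apply: evals_toD fl _; apply: (evals_toM xr) => //.
    exact: radiusC.
  exact: evals_toC.
have := @eval_bound _ _ _ rho c (2 * A) N rho0 hc xE _ _ e.
have -> : 2 * A / (1 - c) * c ^+ N = 2 * A * (c ^+ N / (1 - c)) by ring.
apply=> [i|i lt_iN]; rewrite fpsDE fpsC_mulE mulN1r; last by rewrite Ff // subrr.
apply: le_trans (ler_wpM2r (exprn_ge0 _ rho0) (modulusD _ _)) _.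
rewrite modulusN mulrDl mulrDl mul1r lerD // (le_trans _ (HA i)) // ler_wpM2r //.
  exact: exprn_ge0.
exact: exprn_ge0.
Qed.

(** Abel's lemma: a term is a difference of two partial sums, so the terms of a convergent series
    are bounded. *)
Lemma evals_to_radius f x l : evals_to f x l -> conv_radius (modulus x) f.
Proof.
move=> fl; have [N _ HN] := cvgCP fl (ltr01 : 0 < 1 :> R).
pose A := 2 + \sum_(i < N) modulus (f i * x ^+ i).
have HA n : modulus (f n * x ^+ n) <= A.
  have [le_Nn|lt_nN] := leqP N n; last first.
    rewrite /A (bigD1 (Ordinal lt_nN)) //= addrCA lerDl addr_ge0 //.
    by apply: sumr_ge0 => i _; apply: modulus_ge0.
  apply: (@le_trans _ _ 2); last first.
    by rewrite /A lerDl; apply: sumr_ge0 => i _; apply: modulus_ge0.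
  have -> : f n * x ^+ n = (l - series (fun n => f n * x ^+ n) n) -
       (l - series (fun n => f n * x ^+ n) n.+1).
    by rewrite !evals_toE big_ord_recr /=; ring.
  apply: le_trans (modulusD _ _) _; rewrite modulusN.
  by apply: (@le_trans _ _ (1 + 1)) => //; rewrite lerD //; apply: HN => //=; apply: leqW.
move=> rho /andP[rho0 lt]; exists A => n; apply: le_trans (HA n).
rewrite modulusM modulusX ler_wpM2l ?modulus_ge0 //.
by apply: lerXn2r; rewrite ?nnegrE ?modulus_ge0 // ltW.
Qed.

(** If f n is the first nonzero coefficient, its term dominates the tail of order x^(n+1) for small
    x. Positive real points suffice; they are values of the nome, and the domain of the Bernoulli
    series. *)
Lemma fps_eq0 r f : 0 < r -> conv_radius r f ->
  (forall x : R, 0 < x < r -> evals_to f x%:C 0) -> f = 0.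
Proof.
move=> r0 rf H; apply: fpsP => n; rewrite fps0E; elim/ltn_ind: n => n IH.
apply/eqP; apply: contraT => fn0.
have hrho : 0 <= r / 2 < r by rewrite divr_ge0 ?ltW //= ltr_pdivrMr // mulr2n mulrDr mulr1 ltrDl.
move: (r / 2) (hrho) (divr_gt0 r0 (ltr0n R 2)) => rho /andP[_ rho_r] rho0.
have [A A0 HA] := radius_pos (f := f) (r := r) (rho := rho) (introT andP (conj (ltW rho0) rho_r)) rf.
have M0 : 0 < modulus (f n).
  by rewrite lt_def modulus_ge0 andbT; apply: contra fn0 => /eqP /modulus_eq0 ->.
pose m := modulus (f n) * rho ^+ n; have m0 : 0 < m by rewrite mulr_gt0 // exprn_gt0.
(* Chosen such that A c = m/4 - m c, which contradicts m (1 - c) <= A c. *)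
pose c := m / (4 * (A + m)).
have Am : 0 < A + m by rewrite ltr_wpDl.
have c0 : 0 < c by rewrite divr_gt0 // mulr_gt0.
have c4 : c <= 1 / 4.
  by rewrite /c ler_pdivrMr ?mulr_gt0 // mulrA divfK // mul1r lerDr.
have cE : c * (4 * (A + m)) = m by rewrite /c divfK // gt_eqF // mulr_gt0.
clearbody c; have hc : 0 <= c < 1 by rewrite ltW //=; lra.
have hx : 0 < rho * c < r.
  by rewrite mulr_gt0 //= (le_lt_trans _ rho_r) // -[leRHS]mulr1 ler_wpM2l ?(ltW rho0) //; lra.
have e : evals_to (f + fpsC (- f n) * fpsX ^+ n) (rho * c)%:C (- f n * (rho * c)%:C ^+ n).
  rewrite -[X in evals_to _ _ X]add0r; apply: evals_toD; first exact: H.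
  have lt : modulus (rho * c)%:C < modulus (rho * c)%:C + 1 by rewrite ltrDl.
  apply: (evals_toM lt); [exact: radiusC|exact: radiusXn|exact: evals_toC|exact: evals_toXn].
have xE : modulus (rho * c)%:C = rho * c.
  by rewrite modulus_real ger0_norm // ltW //; case/andP: hx.
have P : modulus (- f n * (rho * c)%:C ^+ n) <= A * (c ^+ n.+1 / (1 - c)).
  apply: (eval_bound (ltW rho0) hc xE _ _ e) => [i|i]; rewrite fpsDE fpsC_mulE fpsXnE;
    have [->|ne] := eqVneq i n.
  - by rewrite mulr1 subrr modulus0 mul0r.
  - by rewrite mulr0 addr0.
  - by rewrite mulr1 subrr.
  - by rewrite mulr0 addr0 ltnS leq_eqVlt (negPf ne) /=; apply: IH.
have {}P : m * c ^+ n <= A * c / (1 - c) * c ^+ n.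
  have -> : m * c ^+ n = modulus (- f n * (rho * c)%:C ^+ n).
    by rewrite modulusM modulusN modulusX xE exprMn mulrA.
  by apply: le_trans P _; rewrite exprS le_eqVlt; apply/orP; left; apply/eqP; ring.
rewrite (ler_pM2r (exprn_gt0 n c0)) ler_pdivlMr ?subr_gt0 in P; last by case/andP: hc.
have l1 : m * c <= m * (1 / 4) by rewrite ler_wpM2l // ltW.
have l2 : 0 <= m * c by rewrite mulr_ge0 // ltW.
have e1 : m * (1 - c) = m - m * c by ring.
have e2 : c * (4 * (A + m)) = 4 * (A * c) + 4 * (m * c) by ring.
by rewrite cE in e2; rewrite e1 in P; lra.
Qed.

Lemma series_subst (m : nat) f x N : (0 < m)%N ->
  series (fun n => fps_subst m f n * x ^+ n) (m * N)%N =
  series (fun n => f n * (x ^+ m) ^+ n) N.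
Proof.
move=> m0; rewrite !evals_toE; under eq_bigr do rewrite fps_substE //.
elim: N => [|N IH]; first by rewrite muln0 !big_ord0.
rewrite mulnS addnC big_split_ord /= IH big_ord_recr /=; congr (_ + _).
case: m m0 {IH} => // m _; rewrite big_ord_recl /= big1 ?addr0.
  by rewrite addn0 dvdn_mulr // mulKn // -exprM.
move=> i _; rewrite dvdn_addr ?dvdn_mulr //.
by rewrite /bump /= add1n gtnNdvd ?mul0r // ltnS.
Qed.

Lemma evals_to_subst (m : nat) f x l : (0 < m)%N -> modulus x < 1 -> conv_radius 1 f ->
  evals_to f (x ^+ m) l -> evals_to (fps_subst m f) x l.
Proof.
move=> m0 x1 rf fl; have sl := evalP x1 (radius_subst m0 rf).
suff -> : l = fps_eval (fps_subst m f) x by [].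
have le n : (n <= m * n)%N by rewrite leq_pmull.
apply: cvgC_unique fl _.
have := cvgC_subseq le sl.
by under eq_fun do rewrite series_subst //.
Qed.

End Evaluation.

(** * Modular forms as functions of the nome *)

(** The recursion of [expint] has no negative coefficients, so majorants pass through it. *)
Lemma expint_majorant (K : numFieldType) (g h : fps K) :
  (forall n, `|g n| <= h n) -> forall n, `|expint g n| <= expint h n.
Proof.
move=> gh; elim/ltn_ind => n IH.
have [->|n0] := posnP n; first by rewrite !expint0E normr1.
have nK : 0 < n%:R :> K by rewrite ltr0n.
rewrite -(ler_pM2l nK) -[X in X * `|_|](ger0_norm (ltW nK)) -normrM !expint_recE //.
apply: le_trans (ler_norm_sum _ _ _) _; apply: ler_sum => -[i lt_in] _ /=.
by rewrite normrM ler_pM // IH.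
Qed.

Section Modular.
Variable R : realType.
Local Notation C := R[i].
Local Notation modulus := (@modulus R).
Implicit Types (f g h : fps C) (x : C).

Lemma modulus_le_norm (a b : C) : `|a| <= b -> modulus a <= modulus b.
Proof.
move=> ab; have b0 : 0 <= b by apply: le_trans ab.
by rewrite -lecR -!modulusE [leRHS]ger0_norm.
Qed.

Lemma sigmaq_ge0 (K : numFieldType) m n : 0 <= sigmaq K m n.
Proof. by rewrite sigmaqE sumr_ge0 // => d _; rewrite exprn_ge0. Qed.

(** From the crude bound sigma_m(n) <= n^(m+1). *)
Lemma radius_sigmaq m : conv_radius 1 (sigmaq C m).
Proof.
apply: (radius_majorant _ (@radius_natX R m.+1)) => n; rewrite sigmaqE.
apply: modulus_le_norm; rewrite ger0_norm; last first.
  by rewrite sumr_ge0 // => d _; rewrite exprn_ge0.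
have -> : Fps (fun n => n%:R ^+ m.+1) n = n%:R * n%:R ^+ m :> C by rewrite -exprS.
apply: (@le_trans _ _ (\sum_(d <- divs n) n%:R ^+ m)).
  rewrite big_seq [leRHS]big_seq; apply: ler_sum => d; rewrite mem_divs => /andP[n0 dn].
  by rewrite lerXn2r ?nnegrE ?ler0n // ler_nat dvdn_leq.
rewrite big_const_seq count_predT iter_addr_0 -[leLHS]mulr_natl ler_wpM2r ?exprn_ge0 //.
by rewrite ler_nat /divs size_filter (leq_trans (count_size _ _)) // size_iota.
Qed.

Lemma radius_eta s : all (fun p => 0 < p.1)%N s -> conv_radius 1 (eta_quotient C s).
Proof.
move=> /allP s0; apply: radius_expint; rewrite /eta_log.
apply: radiusN; apply: radius_sum => p /s0 p0.
rewrite -(rmorph_int (@fpsC C)) -(rmorph_nat (@fpsC C)).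
by do 2![apply: radiusM; first exact: radiusC]; apply: radius_subst => //; apply: radius_sigmaq.
Qed.

Lemma evals_to_pochhammer N x : modulus x < 1 ->
  conv_radius 1 (pochhammer N (fpsX : fps C)) /\
  evals_to (pochhammer N fpsX) x (\prod_(1 <= j < N.+1) (1 - x ^+ j)).
Proof.
move=> x1; elim: N => [|N [rN IH]].
  rewrite /pochhammer !big_geq // -(rmorph1 (@fpsC C)).
  by split; [exact: radiusC|exact: evals_toC].
have e : (1 - fpsX ^+ N.+1 : fps C) = fpsC 1 + fpsC (- 1) * fpsX ^+ N.+1.
  by rewrite (rmorph1 fpsC) (rmorphN1 fpsC) mulN1r.
have r2 : conv_radius 1 (1 - fpsX ^+ N.+1 : fps C).
  by rewrite e; apply: radiusD; [|apply: radiusM]; try exact: radiusC; exact: radiusXn.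
have -> : pochhammer N.+1 (fpsX : fps C) = pochhammer N fpsX * (1 - fpsX ^+ N.+1).
  by rewrite /pochhammer (@big_nat_recr _ _ _ N.+1).
have e2 : evals_to (1 - fpsX ^+ N.+1) x (1 - x ^+ N.+1).
  rewrite e -[in X in evals_to _ _ X]mulN1r; apply: evals_toD; first exact: evals_toC.
  by apply: (evals_toM x1); [exact: radiusC|exact: radiusXn|exact: evals_toC|exact: evals_toXn].
rewrite (@big_nat_recr _ _ _ N.+1 1 _ (ltn0Sn N)); split; first exact: radiusM.
exact: (evals_toM x1 rN r2 IH e2).
Qed.

Lemma eta1E : eta_log C [:: (1%N, 1%Z)] = - sigmaq C 1.
Proof.
rewrite eta_log1 mul1r; congr (- _); apply: fpsP => n.
by rewrite fps_substE // dvd1n divn1.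
Qed.

(** The series [g], the inverse of Euler's product, dominates all partial products and their limit,
    as every logarithmic derivative involved is bounded by sigma_1. *)
Lemma eta_prod_cvg x : modulus x < 1 ->
  (fun N => \prod_(1 <= j < N.+1) (1 - x ^+ j)) @ \oo -->
    fps_eval (eta_quotient C [:: (1%N, 1%Z)]) x.
Proof.
move=> x1; pose g := expint (sigmaq C 1).
have maj (h : fps C) : (forall n, `|h n| <= sigmaq C 1 n) ->
    forall n, modulus (expint h n) <= modulus (g n).
  by move=> hs n; apply/modulus_le_norm/expint_majorant.
have m1 n : modulus (eta_quotient C [:: (1%N, 1%Z)] n) <= modulus (g n).
  rewrite /eta_quotient eta1E; apply: maj => k.
  by rewrite fpsNE normrN ger0_norm // sigmaq_ge0.
have m2 N n : modulus (pochhammer N fpsX n) <= modulus (g n).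
  rewrite pochhammer_expint; apply: maj => k; rewrite fpsNE normrN.
  have [lt|le] := ltnP k N.+1.
    by rewrite (@sigma_upto_sigmaq C N k lt) ger0_norm // sigmaq_ge0.
  have k0 : (0 < k)%N by apply: leq_trans le.
  rewrite sigmaqE /sigma_upto [coefs _ _]/= k0 /= -big_mkcond /= ger0_norm; last first.
    by apply: sumr_ge0 => d _; apply: ler0n.
  rewrite /divs big_filter /index_iota subn1 /=.
  have -> : iota 1 k = iota 1 N ++ iota N.+1 (k - N).
    by rewrite -[in LHS](subnKC (ltnW le)) iotaD add1n.
  rewrite big_cat /=; under [X in _ <= X + _]eq_bigr do rewrite expr1.
  by rewrite lerDl sumr_ge0 // => d _; rewrite exprn_ge0.
have rg : conv_radius 1 g by apply/radius_expint/radius_sigmaq.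
apply: (evals_to_limit x1 rg m1 m2) => [N n lt|N|].
- by apply: pochhammer_eta1; apply: leqW.
- by case: (evals_to_pochhammer N x1).
- by apply: (evalP x1); apply: radius_eta.
Qed.

Section Eval.
Variable x : C.
Hypothesis x1 : modulus x < 1.

Lemma evalD f g : conv_radius 1 f -> conv_radius 1 g ->
  fps_eval (f + g) x = fps_eval f x + fps_eval g x.
Proof. by move=> rf rg; apply: evals_to_eval; apply: evals_toD; apply: evalP x1 _. Qed.

Lemma evalM f g : conv_radius 1 f -> conv_radius 1 g ->
  fps_eval (f * g) x = fps_eval f x * fps_eval g x.
Proof. by move=> rf rg; apply: evals_to_eval; apply: (evals_toM x1) => //; apply: evalP x1 _. Qed.

Lemma evalC c : fps_eval (fpsC c) x = c.
Proof. by apply: evals_to_eval; apply: evals_toC. Qed.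

Lemma evalXn m : fps_eval (fpsX ^+ m) x = x ^+ m.
Proof. by apply: evals_to_eval; apply: evals_toXn. Qed.

Lemma evalX f m : conv_radius 1 f -> fps_eval (f ^+ m) x = fps_eval f x ^+ m.
Proof.
move=> rf; elim: m => [|m IH]; first by rewrite !expr0 -(rmorph1 (@fpsC C)) evalC.
by rewrite !exprS evalM ?IH //; apply: radiusX.
Qed.

Lemma eval_sum (I : eqType) (s : seq I) (F : I -> fps C) :
  (forall i, i \in s -> conv_radius 1 (F i)) ->
  fps_eval (\sum_(i <- s) F i) x = \sum_(i <- s) fps_eval (F i) x.
Proof.
elim: s => [|i s IH] H; first by rewrite !big_nil -(rmorph0 (@fpsC C)) evalC.
have Hs j : j \in s -> conv_radius 1 (F j) by move=> js; apply: H; rewrite inE js orbT.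
rewrite !big_cons evalD ?IH //; first by apply: H; rewrite inE eqxx.
exact: radius_sum.
Qed.

Lemma modulusX_lt1 m : (0 < m)%N -> modulus (x ^+ m) < 1.
Proof. by move=> m0; rewrite modulusX exprn_ilt1 ?modulus_ge0 // -lt0n. Qed.

Lemma eval_subst m f : (0 < m)%N -> conv_radius 1 f ->
  fps_eval (fps_subst m f) x = fps_eval f (x ^+ m).
Proof.
move=> m0 rf; apply: evals_to_eval; apply: evals_to_subst => //.
by apply: evalP rf; apply: modulusX_lt1.
Qed.

(** For x = q this is eta(rz) without its factor q^(r/24). *)
Definition eta_value r := fps_eval (eta_quotient C [:: (r, 1%Z)]) x.

Lemma eta_value_prod r : (0 < r)%N ->
  (fun N => \prod_(1 <= j < N.+1) (1 - (x ^+ r) ^+ j)) @ \oo --> eta_value r.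
Proof.
move=> r0; rewrite /eta_value -[r in X in _ --> X]muln1.
have -> : [:: ((r * 1)%N, 1%Z)] = [seq ((r * p.1)%N, p.2) | p <- [:: (1%N, 1%Z)]] by [].
rewrite -fps_subst_eta // eval_subst //; last by apply: radius_eta.
exact/eta_prod_cvg/modulusX_lt1.
Qed.

Lemma eta_quotient_nil : eta_quotient C [::] = 1.
Proof. by rewrite /eta_quotient /eta_log big_nil oppr0 expint0. Qed.

Lemma eta_quotient1V r : eta_quotient C [:: (r, (- 1)%Z)] * eta_quotient C [:: (r, 1%Z)] = 1.
Proof.
rewrite -eta_quotient_cat -eta_quotient_nil /eta_quotient /eta_log /= !big_cons !big_nil.
by congr (expint (- _)); rewrite addr0 -mulrDl -rmorphD mul0r.
Qed.

Lemma eta_value_inv r : (0 < r)%N ->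
  fps_eval (eta_quotient C [:: (r, (- 1)%Z)]) x * eta_value r = 1.
Proof.
move=> r0; rewrite /eta_value -evalM ?eta_quotient1V; try by apply: radius_eta; rewrite /= r0.
by rewrite -(rmorph1 (@fpsC C)) evalC.
Qed.

(** The inverse quotient converges on the same disk, so the product of the two values is 1. *)
Lemma eta_value_neq0 r : (0 < r)%N -> eta_value r != 0.
Proof.
move=> /eta_value_inv e; apply: contra_eq_neq e => ->.
by rewrite mulr0 eq_sym oner_neq0.
Qed.

Lemma eval_eta s : all (fun p => 0 < p.1)%N s ->
  fps_eval (eta_quotient C s) x = \prod_(p <- s) eta_value p.1 ^ p.2.
Proof.
elim: s => [_|[r e] s IH /= /andP[r0 s0]].
  by rewrite big_nil eta_quotient_nil -(rmorph1 (@fpsC C)) evalC.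
rewrite big_cons -cat1s eta_quotient_cat evalM ?IH //; try by apply: radius_eta; rewrite /= ?r0.
congr (_ * _) => /=; case: e => n.
  have -> : [:: (r, n%:Z)] = [seq (p.1, p.2 *+ n) | p <- [:: (r, 1%Z)]].
    by rewrite /= -mulr_natl mulr1 natz.
  by rewrite -eta_quotientX evalX //; apply: radius_eta; rewrite /= r0.
have -> : [:: (r, Negz n)] = [seq (p.1, p.2 *+ n.+1) | p <- [:: (r, (- 1)%Z)]].
  have eN : (- 1)%Z *+ n.+1 = Negz n by rewrite -mulr_natr natz NegzE; lia.
  by rewrite [map _ _]/= eN.
rewrite -eta_quotientX evalX; last by apply: radius_eta; rewrite /= r0.
rewrite -[RHS]/((eta_value r ^+ n.+1)^-1) -exprVn; congr (_ ^+ _).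
by apply: (mulIf (eta_value_neq0 r0)); rewrite eta_value_inv // mulVf ?eta_value_neq0.
Qed.

End Eval.
End Modular.

Lemma abszX2 (m : int) : (`|m| ^ 2)%:Z = m ^+ 2.
Proof. by rewrite -abszX gez0_abs ?sqr_ge0. Qed.

(** Pairs the indices s and -s. The ring is arbitrary because x is a number when theta is evaluated
    and the series q when representations are counted. *)
Lemma theta_square_sum (A : comNzRingType) (x : A) N :
  \sum_(0 <= n < (2 * N).+1) x ^+ (`|n%:Z - N%:Z| ^ 2) =
  1 + 2 * \sum_(1 <= s < N.+1) x ^+ (s * s).
Proof.
elim: N => [|N IH].
  have e : (`|0%:Z - 0%:Z| ^ 2 = 0)%N by [].
  by rewrite muln0 big_nat1 big_geq // e expr0 mulr0 addr0.
have -> : (2 * N.+1 = (2 * N).+2)%N by rewrite mulnS.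
rewrite (@big_nat_recr _ _ _ (2 * N).+2 0) // big_nat_recl //.
have -> : `|0%:Z - N.+1%:Z|%N = N.+1 by lia.
have -> : `|(2 * N).+2%:Z - N.+1%:Z|%N = N.+1 by lia.
have -> : \sum_(0 <= n < (2 * N).+1) x ^+ (`|n.+1%:Z - N.+1%:Z| ^ 2) =
    \sum_(0 <= n < (2 * N).+1) x ^+ (`|n%:Z - N%:Z| ^ 2).
  apply: eq_bigr => n _; have e : n.+1%:Z - N.+1%:Z = n%:Z - N%:Z by lia.
  by rewrite e.
rewrite IH (@big_nat_recr _ _ _ N.+1 1) // expnS expn1.
move: (x ^+ (N.+1 * N.+1)) (\sum_(1 <= s < N.+1) _) => y S.
by rewrite -![Monoid.Law.sort _ _ _]/(_ + _); ring.
Qed.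

Lemma theta_truncX (K : numFieldType) N :
  eqfps N.+1 (theta_series K) (1 + 2 * \sum_(1 <= s < N.+1) fpsX ^+ (s * s)).
Proof.
have -> : 1 + 2 * \sum_(1 <= s < N.+1) fpsX ^+ (s * s) =
    1 + 2 * \sum_(1 <= s < N.+1) (-1) ^+ s * (- fpsX) ^+ (s * s) :> fps K.
  congr (1 + 2 * _); apply: eq_bigr => s _.
  by rewrite (exprNn fpsX) mulrA -exprD -signr_odd oddD oddM andbb addbb expr0 mul1r.
exact: theta_trunc.
Qed.

(** * The series of the statement as functions of z *)

Section Nome.
Variable R : realType.
Local Notation C := R[i].
Local Notation modulus := (@modulus R).
Implicit Types (z w x : C).

Lemma expCD z w : expC (z + w) = expC z * expC w.
Proof.
rewrite /expC !raddfD /= expRD cosD sinD.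
by apply/eqP; rewrite eq_complex /=; apply/andP; split; apply/eqP; ring.
Qed.

Lemma expC0 : expC (0 : C) = 1.
Proof. by rewrite /expC /= expR0 cos0 sin0; apply/eqP; rewrite eq_complex /= ; apply/andP; split; apply/eqP; ring. Qed.

Lemma expCMn z n : expC (z * n%:R) = expC z ^+ n.
Proof.
elim: n => [|n IH]; first by rewrite mulr0 expC0 expr0.
by rewrite -[n.+1]addn1 natrD mulrDr expCD IH mulr1 exprD expr1.
Qed.

Lemma expC_neq0 z : expC z != 0.
Proof.
apply/eqP => e; have := expC0; rewrite -(subrr z) expCD e mul0r => /eqP.
by rewrite eq_sym oner_eq0.
Qed.

Lemma modulus_expC z : modulus (expC z) = expR (complex.Re z).
Proof.
rewrite /expC modulusM modulus_real ger0_norm ?expR_ge0 //.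
by rewrite /modulus normc_def /= cos2Dsin2 sqrtr1 mulr1.
Qed.

Lemma nomeX z n : nome (n%:R * z) = nome z ^+ n.
Proof. by rewrite /nome mulrCA mulrC -expCMn mulrC mulrA. Qed.

Lemma modulus_nome z : modulus (nome z) = expR (- (2 * pi * complex.Im z)).
Proof.
rewrite /nome modulus_expC; congr expR; case: z => a b /=; ring.
Qed.

Lemma modulus_nome_lt1 z : upper_half_plane R z -> modulus (nome z) < 1.
Proof.
move=> z0; rewrite modulus_nome -expR0 ltr_expR oppr_lt0 !mulr_gt0 ?pi_gt0 //.
Qed.

(** The imaginary axis supplies the real points at which expansions in q are compared. *)
Lemma nome_real (x : R) : 0 < x < 1 -> exists2 z, upper_half_plane R z & nome z = x%:C.
Proof.
move=> /andP[x0 x1]; have p0 : (2 * pi : R) != 0 by rewrite mulf_neq0 // gt_eqF ?pi_gt0.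
exists (0 +i* (- ln x / (2 * pi))).
  rewrite /upper_half_plane /= divr_gt0 ?mulr_gt0 ?pi_gt0 // oppr_gt0 ln_lt0 //.
  by rewrite x0 x1.
have e : (2 * pi)%:C * 'i * (0 +i* (- ln x / (2 * pi))) = (ln x)%:C :> C.
  apply/eqP; rewrite eq_complex /=; apply/andP; split; apply/eqP; last by ring.
  by rewrite -[RHS](divfK p0); ring.
by rewrite /nome e /expC /= lnK ?posrE // cos0 sin0; apply/eqP; rewrite eq_complex /=; apply/andP; split; apply/eqP; ring.
Qed.

Lemma dedekind_etaE z r : (0 < r)%N -> upper_half_plane R z ->
  dedekind_eta (r%:R * z) = expC ((pi / 12)%:C * 'i * z) ^+ r * eta_value (nome z) r.
Proof.
move=> r0 hz; rewrite /dedekind_eta; congr (_ * _).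
  by rewrite mulrCA mulrC -expCMn mulrC mulrA.
rewrite -(cvg_lim _ (eta_value_prod (modulus_nome_lt1 hz) r0)) //.
congr (limn _); apply: funext => N; apply: eq_bigr => j _; congr (1 - _).
rewrite -exprM -nomeX /nome; congr expC; rewrite natrM; ring.
Qed.

Lemma nome_pi12 z : expC ((pi / 12)%:C * 'i * z) ^+ 24 = nome z.
Proof.
rewrite -expCMn /nome; congr expC; apply/eqP; rewrite eq_complex /=.
by case: z => a b /=; apply/andP; split; apply/eqP; field.
Qed.

Lemma radius_etaC j m : conv_radius 1 (fpsX ^+ j *
    (eta_quotient C eta_R * eta_quotient C eta_t ^+ j * eta_quotient C eta_W ^+ m)).
Proof.
apply: radiusM; first exact: radiusXn.
apply: radiusM; last by apply: radiusX; apply: radius_eta.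
by apply: radiusM; [apply: radius_eta|apply: radiusX; apply: radius_eta].
Qed.

Lemma eval_etaC x j m : modulus x < 1 ->
  fps_eval (fpsX ^+ j *
    (eta_quotient C eta_R * eta_quotient C eta_t ^+ j * eta_quotient C eta_W ^+ m)) x =
  x ^+ j * ((\prod_(p <- eta_R) eta_value x p.1 ^ p.2) *
    (\prod_(p <- eta_t) eta_value x p.1 ^ p.2) ^+ j *
    (\prod_(p <- eta_W) eta_value x p.1 ^ p.2) ^+ m).
Proof.
move=> x1.
have rR : conv_radius 1 (eta_quotient C eta_R) by apply: radius_eta.
have rt : conv_radius 1 (eta_quotient C eta_t) by apply: radius_eta.
have rW : conv_radius 1 (eta_quotient C eta_W) by apply: radius_eta.
have rtj := radiusX j rt; have rWm := radiusX m rW; have rRt := radiusM rR rtj.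
rewrite (evalM x1 (@radiusXn _ 1 j) (radiusM rRt rWm)) (evalM x1 rRt rWm) (evalM x1 rR rtj).
rewrite (evalX x1 j rt) (evalX x1 m rW) evalXn.
by rewrite (@eval_eta _ x x1 eta_R) ?(@eval_eta _ x x1 eta_t) ?(@eval_eta _ x x1 eta_W).
Qed.

Lemma eta_block_R (F : fieldType) (E : nat -> F) : \prod_(p <- eta_R) E p.1 ^ p.2 =
  E 2%N ^+ 10 * (E 3%N ^+ 5 * (E 4%N * (E 6%N ^+ 2 * (E 1%N ^- 15 * (E 12%N ^- 3 * 1))))).
Proof. by rewrite !big_cons big_nil. Qed.

Lemma eta_block_t (F : fieldType) (E : nat -> F) : \prod_(p <- eta_t) E p.1 ^ p.2 =
  E 2%N ^+ 2 * (E 3%N * (E 12%N ^+ 3 * (E 1%N ^- 3 * ((E 4%N)^-1 * (E 6%N ^- 2 * 1))))).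
Proof. by rewrite !big_cons big_nil. Qed.

Lemma eta_block_W (F : fieldType) (E : nat -> F) : \prod_(p <- eta_W) E p.1 ^ p.2 =
  E 1%N ^+ 6 * (E 6%N * (E 2%N ^- 3 * (E 3%N ^- 2 * 1))).
Proof. by rewrite !big_cons big_nil. Qed.

(** Here u is e^(pi i z/12). The three quotients have total orders 0, 24 and 0 in u, so that only
    u^(24 j) = q^j survives. *)
Lemma etaC_field (F : fieldType) (u : F) (E : nat -> F) (j m : nat) : u != 0 ->
  (forall r, (0 < r)%N -> E r != 0) ->
  let e r := u ^+ r * E r in
  (e 2%N ^+ 10 * e 3%N ^+ 5 * e 4%N * e 6%N ^+ 2 / (e 1%N ^+ 15 * e 12%N ^+ 3))
  * (e 2%N ^+ 2 * e 3%N * e 12%N ^+ 3 / (e 1%N ^+ 3 * e 4%N * e 6%N ^+ 2)) ^+ j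
  * (e 1%N ^+ 6 * e 6%N / (e 2%N ^+ 3 * e 3%N ^+ 2)) ^+ m =
  (u ^+ 24) ^+ j * ((\prod_(p <- eta_R) E p.1 ^ p.2) *
    (\prod_(p <- eta_t) E p.1 ^ p.2) ^+ j * (\prod_(p <- eta_W) E p.1 ^ p.2) ^+ m).
Proof.
move=> u0 E0 e; rewrite eta_block_R eta_block_t eta_block_W /e {e}.
have := E0 12%N isT; have := E0 6%N isT; have := E0 4%N isT.
have := E0 3%N isT; have := E0 2%N isT; have := E0 1%N isT.
move: (E 1%N) (E 2%N) (E 3%N) (E 4%N) (E 6%N) (E 12%N).
move=> x1 x2 x3 x4 x6 x12 e1 e2 e3 e4 e6 e12.
rewrite [RHS]mulrA [X in _ = X * _]mulrCA -[X in _ = _ * X * _]exprMn.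
congr (_ * _ ^+ _ * _ ^+ _).
- by field; rewrite u0 e1 e12.
- by field; rewrite u0 e1 e4 e6.
- by field; rewrite u0 e2 e3.
Qed.

Lemma etaC_eval z j m : upper_half_plane R z ->
  etaC j%:Z m%:Z z = fps_eval (fpsX ^+ j *
    (eta_quotient C eta_R * eta_quotient C eta_t ^+ j * eta_quotient C eta_W ^+ m))
    (nome z).
Proof.
move=> hz; have x1 := modulus_nome_lt1 hz.
rewrite (eval_etaC _ _ x1) -[X in X ^+ j * _](nome_pi12 z).
have dE r : (0 < r)%N -> dedekind_eta (r%:R * z) = _ := @dedekind_etaE z r ^~ hz.
rewrite -etaC_field; [|exact: expC_neq0|exact: eta_value_neq0].
cbv zeta; rewrite -(dE 1%N) // -(dE 2%N) // -(dE 3%N) // -(dE 4%N) // -(dE 6%N) // -(dE 12%N) //.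
Qed.

Lemma theta_sum x N :
  \sum_(0 <= n < (2 * N).+1) x ^ ((n%:Z - N%:Z) ^+ 2) =
  1 + 2 * \sum_(1 <= s < N.+1) x ^+ (s * s) :> C.
Proof. by rewrite -theta_square_sum; apply: eq_bigr => n _; rewrite -abszX2. Qed.

(** The symmetric partial sums are polynomials dominated by the theta series itself, whose
    convergence is read off Gauss's product. *)
Lemma theta_eval z : upper_half_plane R z -> theta z = fps_eval (theta_series C) (nome z).
Proof.
move=> hz; have x1 := modulus_nome_lt1 hz; apply: cvg_lim => //.
have rth : conv_radius 1 (theta_series C) by rewrite gauss_theta; apply: radius_eta.
pose F N : fps C := fpsC 1 + fpsC 2 * \sum_(1 <= s < N.+1) fpsX ^+ (s * s).
have Fe N : eqfps N.+1 (F N) (theta_series C).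
  by rewrite /F (rmorph1 fpsC) (rmorph_nat fpsC); apply/eqfps_sym/theta_truncX.
have coefF N n : F N n = (n == 0%N)%:R + 2 * \sum_(1 <= s < N.+1) (n == s * s)%N%:R.
  rewrite /F (rmorph1 fpsC) fpsDE fpsC_mulE fps_sumE fps1E.
  by congr (_ + _ * _); apply: eq_bigr => s _; rewrite fpsXnE.
apply: (@evals_to_limit _ F (theta_series C) (theta_series C) (nome z) _ _ 1 x1 rth) => //.
- move=> N n; have [lt|le] := ltnP n N.+1; first by rewrite Fe.
  rewrite coefF -(Fe n n (ltnSn n)) coefF; apply: modulus_le_norm.
  rewrite ger0_norm; last by rewrite addr_ge0 ?ler0n // mulr_ge0 ?ler0n // sumr_ge0.
  rewrite lerD2l ler_wpM2l ?ler0n //.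
  rewrite [leRHS](@big_cat_nat _ _ _ N.+1) //=; last exact: ltnW.
  by rewrite lerDl sumr_ge0.
- by move=> N n lt; apply: Fe; apply: leqW.
- move=> N; rewrite theta_sum; apply: evals_toD; first exact: evals_toC.
  have rs : conv_radius 1 (\sum_(1 <= s < N.+1) fpsX ^+ (s * s) : fps C).
    by apply: radius_sum => s _; apply: radiusXn.
  apply: (evals_toM x1) => //; [exact: radiusC|exact: evals_toC|].
  have e : fps_eval (\sum_(1 <= s < N.+1) fpsX ^+ (s * s)) (nome z) =
      \sum_(1 <= s < N.+1) nome z ^+ (s * s).
    rewrite (eval_sum x1 (fun s _ => @radiusXn R 1 (s * s))).
    by apply: eq_bigr => s _; exact: evalXn.
  by rewrite -e; exact: (evalP x1 rs).
- exact: (evalP x1 rth).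
Qed.

Lemma upper_half_plane_natM r z : (0 < r)%N -> upper_half_plane R z ->
  upper_half_plane R (r%:R * z).
Proof.
move=> r0; rewrite /upper_half_plane /= => hz.
have -> : complex.Im (r%:R * z) = r%:R * complex.Im z.
  have -> : r%:R = (r%:R : R)%:C by rewrite rmorph_nat.
  by case: z hz => a b _ /=; ring.
by rewrite mulr_gt0 // ltr0n.
Qed.

Lemma sigma_nat m n : (0 < n)%N -> (sigma m n%:R)%:R = sigmaq C m n.
Proof.
move=> n0; rewrite /sigma natr_nat natrK sigmaqE natr_sum.
rewrite (perm_big (divs n)); first by apply: eq_bigr => d _; rewrite natrX.
apply: uniq_perm; [exact: divisors_uniq|exact: divs_uniq|].
by move=> d; rewrite -dvdn_divisors // mem_divs n0.
Qed.

(** If r does not divide n, then n/r is not a natural number and both sides are zero. *)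
Lemma sigma_div m n r : (0 < n)%N -> (0 < r)%N ->
  (sigma m (n%:R / r%:R))%:R = fps_subst r (sigmaq C m) n.
Proof.
move=> n0 r0; rewrite fps_substE //.
have rQ : r%:R != 0 :> rat by rewrite pnatr_eq0 -lt0n.
case: ifP => [dvd|ndvd].
  have -> : n%:R / r%:R = (n %/ r)%N%:R :> rat.
    by apply: (mulIf rQ); rewrite divfK // -natrM divnK.
  by rewrite sigma_nat // divn_gt0 // dvdn_leq.
rewrite /sigma; case: ifP => // /natrP[d e]; case/negP: (negbT ndvd).
apply/dvdnP; exists d; apply/eqP; rewrite -(eqr_nat rat) natrM -e divfK //.
Qed.

Lemma eisenstein_eval (g : fps C) k r z : (0 < r)%N -> upper_half_plane R z ->
    (2 * k - 2)`!%:R / 2 * g (2 * k)%N =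
      (- (bernoulli_number R (2 * k) / (4 * k)%:R))%:C ->
  eisenstein k (r%:R * z) = fps_eval (fps_subst r (eis g k)) (nome z).
Proof.
move=> r0 hz gE; have x1 := modulus_nome_lt1 hz.
have xr := modulusX_lt1 x1 r0; have rs := @radius_sigmaq R (2 * k - 1).
rewrite eval_subst //; last by apply: radiusD => //; exact: radiusC.
rewrite /eis gE (evalD xr (@radiusC R 1 _) rs).
rewrite evalC /eisenstein nomeX; congr (_ + _); apply: cvg_lim => //.
have := cvgC_subseq (phi := S) leqnSn (evalP xr rs).
have -> // : (fun n => series (fun n0 => sigmaq C (2 * k - 1) n0 * (nome z ^+ r) ^+ n0) n.+1) =
  (fun N => \sum_(1 <= n < N.+1) (sigma (2 * k - 1) n%:R)%:R * (nome z ^+ r) ^+ n).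
apply: funext => N; rewrite evals_toE.
rewrite -(big_mkord xpredT (fun n => sigmaq C (2 * k - 1) n * (nome z ^+ r) ^+ n)).
rewrite (@big_ltn _ _ _ 0 N.+1) // sigmaq0E mul0r add0r.
by apply: eq_big_nat => n /andP[n0 _]; rewrite sigma_nat.
Qed.

End Nome.

(** * Bernoulli numbers *)

Section FormalBernoulli.
Variable K : numFieldType.
Implicit Types f g w : fps K.

(** For f = x / (e^x - 1), f - x f' = x^2 e^x / (e^x - 1)^2 = x^2 / (e^x + e^-x - 2). *)
Lemma bernoulli_sinh f : f * (fps_exp 1 - 1) = fpsX ->
  (f - fpsD f) * (cosh2 K 1 - 2) = fpsX ^+ 2.
Proof.
move=> fE.
have -> : cosh2 K 1 = fps_exp 1 + fps_exp (- 1) by [].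
have DE : fpsD f * (fps_exp 1 - 1) + f * (fpsX * fps_exp 1) = fpsX.
  have := congr1 (@fpsD K) fE; rewrite fpsDM fpsDX => e; rewrite -[RHS]e.
  by rewrite raddfB /= fpsD1 subr0 fpsD_exp rmorph1 mulr1.
have inv : fps_exp 1 * fps_exp (-1) = 1 :> fps K by rewrite -fps_expD subrr fps_exp0.
move: (fpsD f) (fps_exp 1) (fps_exp (-1)) DE inv fE => Df a b DE inv fE.
have -> : a + b - 2 = (a - 1) * (1 - b) by apply: (eq_lincomb (c := 1) inv); ring.
have -> : (f - Df) * ((a - 1) * (1 - b)) = f * (fpsX * a) * (1 - b).
  have e : f * (a - 1) - (Df * (a - 1) + f * (fpsX * a)) = fpsX - fpsX by rewrite fE DE.
  by apply: (eq_lincomb (c := 1 - b) e); ring.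
have e : f * (a - 1) * fpsX - f * fpsX * (a * b - 1) = fpsX * fpsX - 0.
  by rewrite fE inv subrr mulr0.
by apply: (eq_lincomb (c := 1) e); ring.
Qed.

Lemma sum_pow2 n : \sum_(i < n) (2 : K) ^+ i + 1 = 2 ^+ n.
Proof.
elim: n => [|n IH]; first by rewrite big_ord0 add0r expr0.
by rewrite big_ord_recr /= addrAC IH exprS; ring.
Qed.

(** The coefficients 1/(n+1)! of (e^x - 1)/x are at most 1, so that |f n| is at most the sum of the
    earlier bounds 2^i. This gives a radius of at least 1/2. *)
Lemma bernoulli_exists : exists2 f : fps K, f * (fps_exp 1 - 1) = fpsX &
  forall n, `|f n| <= 2 ^+ n.
Proof.
pose E : fps K := Fps (fun n => (n.+1`!)%:R^-1).
have E0 : E 0%N = 1 by rewrite /E [coefs _ _]/= invr1.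
have eE : fps_exp 1 - 1 = fpsX * E.
  apply: fpsP => n; rewrite fpsX_mulE fpsBE fps_expE fps1E; case: n => [|n].
    by rewrite expr0 divr1 subrr.
  by rewrite expr1n div1r subr0.
have E0n : E 0%N != 0 by rewrite E0 oner_neq0.
have [f fE] := fps_inv_exists E0n; exists f; first by rewrite eE mulrCA [f * E]mulrC fE mulr1.
elim/ltn_ind => n IH; have := congr1 (fun h : fps K => h n) fE.
rewrite mulrC fpsME big_ord_recr -![Monoid.Law.sort _ _ _]/(_ + _) [nat_of_ord _]/= subnn E0 mulr1 fps1E.
case: n IH => [|n] IH; first by rewrite big_ord0 add0r => ->; rewrite normr1.
move/eqP; rewrite addrC addr_eq0 => /eqP ->; rewrite normrN.
apply: le_trans (ler_norm_sum _ _ _) _; rewrite -sum_pow2.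
apply: (@le_trans _ _ (\sum_(i < n.+1) 2 ^+ i)); last by rewrite lerDl.
apply: ler_sum => -[i lt] _; rewrite normrM -[leRHS]mulr1 ler_pM ?IH //.
rewrite /E [coefs _ _]/= normfV normr_nat invf_le1 ?ltr0n ?fact_gt0 //.
by rewrite ler1n fact_gt0.
Qed.

(** By induction from g 4 > 0 > g 6, no term of the recursion has the opposite sign. This yields
    B_2k != 0, by which alpha_k divides. *)
Lemma sinh_even_sign g w k : w = cosh2 K 1 - 2 -> g * w = fpsX ^+ 2 -> (1 < k)%N ->
  0 < (-1) ^+ k * g (2 * k)%N.
Proof.
move=> w_def gE; have [_ _ g4 g6] := sinh_values w_def gE.
elim/ltn_ind: k => k IH k1.
have [k4|k4] := ltnP 3 k; last first.
  have : k = 2%N \/ k = 3%N by lia.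
  case=> ->; first by rewrite sqrrN expr1n mul1r g4 div1r invr_gt0 ltr0n.
  by rewrite g6 -signr_odd expr1 mulNr mul1r mulNr opprK div1r invr_gt0 ltr0n.
pose n := (2 * k - 4)%N; have nE : (2 * k = n.+4)%N by rewrite /n; lia.
have n0 : (0 < n)%N by rewrite /n; lia.
have rec := sinh_rec w_def gE n0.
have f1 : 0 < (n.+4%:R - 6) * (n.+4%:R + 1) :> K.
  apply: mulr_gt0; last by rewrite addr_gt0 ?ltr01 ?ltr0n.
  by rewrite subr_gt0 (ltr_nat K 6 n.+4) -nE; lia.
rewrite -(pmulr_rgt0 _ f1) mulrCA nE rec mulrCA mulr_gt0 ?ltr0n // mulr_sumr.
have term i : (3 <= i < n.+2)%N -> 0 <= (-1) ^+ k * (g i * g (n.+4 - i)%N).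
  move=> /andP[i3 iN]; have [oi|ei] := boolP (odd i).
    by rewrite (sinh_odd w_def gE oi) mul0r mulr0.
  have iE : (i = 2 * i./2)%N by rewrite mul2n -[LHS]odd_double_half (negPf ei).
  rewrite iE in i3 iN *; move: (i./2) i3 iN => m m3 mN.
  have [l1 l2 l3 l4] : [/\ (m < k)%N, (1 < m)%N, (k - m < k)%N & (1 < k - m)%N].
    by split; lia.
  have -> : (n.+4 - 2 * m = 2 * (k - m))%N by lia.
  have -> : (-1) ^+ k = (-1) ^+ m * (-1) ^+ (k - m) :> K by rewrite -exprD subnKC // ltnW.
  by rewrite mulrACA ltW // mulr_gt0 // IH.
(* The term i = 3 is zero, and the term i = 4 provides strict positivity. *)
rewrite big_ltn; last by rewrite ltnS; lia.
rewrite (sinh_odd w_def gE (n := 3)) // mul0r mulr0 add0r big_ltn; last by lia.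
apply: ltr_pwDl; last first.
  by rewrite big_nat sumr_ge0 // => i /andP[i5 iN]; apply: term; rewrite iN andbT; lia.
have -> : (n.+4 - 4 = 2 * (k - 2))%N by lia.
have -> : (-1) ^+ k = (-1) ^+ 2 * (-1) ^+ (k - 2) :> K by rewrite -exprD subnKC.
by rewrite mulrACA mulr_gt0 // IH //; lia.
Qed.

Lemma sinh_even_neq0 g w k : w = cosh2 K 1 - 2 -> g * w = fpsX ^+ 2 -> (1 < k)%N ->
  g (2 * k)%N != 0.
Proof.
move=> w_def gE k1; have := sinh_even_sign w_def gE k1.
by apply: contraTneq => ->; rewrite mulr0 ltxx.
Qed.

End FormalBernoulli.

Section Bernoulli.
Variable R : realType.
Local Notation C := R[i].
Local Notation modulus := (@modulus R).
Implicit Types (x : R) (B : nat -> R).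

Lemma cvg_real (u : nat -> R) (l : R) :
  ((fun n => (u n)%:C : C) @ \oo --> (l%:C : C)) <-> (u @ \oo --> l).
Proof.
have e n : modulus (l%:C - (u n)%:C) = `|l - u n| by rewrite -rmorphB modulus_real.
split=> H.
  apply/cvgrPdist_le => d /(cvgCP H)[N _ HN]; exists N => // n leNn.
  by rewrite -e; apply: HN.
apply: cvgC_le => d d0; move/cvgrPdist_le : H => /(_ d d0)[N _ HN]; exists N => // n leNn.
by rewrite /= e; apply: HN.
Qed.

Lemma evals_to_real (f : fps C) (c : nat -> R) x (l : R) : (forall n, f n = (c n)%:C) ->
  evals_to f x%:C l%:C <-> (series (fun n => c n * x ^+ n) : nat -> R) @ \oo --> l.
Proof.
move=> fc; rewrite -cvg_real /evals_to.
have -> // : (series (fun n => f n * x%:C ^+ n) : nat -> C) =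
  (fun n => (series (fun n => c n * x ^+ n) n)%:C).
apply: funext => n; rewrite /series rmorph_sum; apply: eq_bigr => j _.
by rewrite fc rmorphM rmorphXn.
Qed.

Lemma fps_exp1_real n : fps_exp (1 : C) n = ((n`!%:R : R)^-1)%:C.
Proof. by rewrite fps_expE expr1n div1r fmorphV rmorph_nat. Qed.

Lemma evals_to_exp x : evals_to (fps_exp (1 : C)) x%:C (expR x)%:C.
Proof.
apply/(evals_to_real _ _ fps_exp1_real).
have -> : (fun n => (n`!%:R : R)^-1 * x ^+ n) = exp_coeff x.
  by apply: funext => n; rewrite /exp_coeff /= mulrC.
exact: is_cvg_series_exp_coeff.
Qed.

Lemma radius_exp r : conv_radius r (fps_exp (1 : C)).
Proof.
have h := evals_to_radius (@evals_to_exp `|r|).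
apply: radius_weaken h.
by rewrite modulus_real normr_id ler_norm.
Qed.

Lemma evals_to_expm1 x : evals_to (fps_exp (1 : C) - 1) x%:C (expR x - 1)%:C.
Proof.
rewrite rmorphB rmorph1; apply: evals_toD; first exact: evals_to_exp.
by rewrite -(rmorphN1 fpsC); apply: evals_toC.
Qed.

Lemma radius_expm1 r : conv_radius r (fps_exp (1 : C) - 1).
Proof. by apply: radiusB; [exact: radius_exp|rewrite -(rmorph1 fpsC); exact: radiusC]. Qed.

Let bfps B : fps C := Fps (fun n => (B n / n`!%:R)%:C).

Let bfpsE B x (l : R) : evals_to (bfps B) x%:C l%:C <->
  (series (fun n => B n * x ^+ n / n`!%:R) : nat -> R) @ \oo --> l.
Proof.
rewrite (evals_to_real x l (c := fun n => B n / n`!%:R)) //.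
have -> // : (fun n => B n / n`!%:R * x ^+ n) = (fun n => B n * x ^+ n / n`!%:R).
by apply: funext => n; rewrite mulrAC.
Qed.

(** Needed for [xget] to return genuine Bernoulli numbers and not its default. *)
Lemma is_bernoulli_exists : exists B, @is_bernoulli R B.
Proof.
have [f fE f2] := bernoulli_exists R.
exists (fun n => f n * n`!%:R); pose B n := f n * n`!%:R.
have fact0 n : n`!%:R != 0 :> R by rewrite pnatr_eq0 -lt0n fact_gt0.
have Bf n : bfps B n = (f n)%:C by rewrite /bfps [coefs _ _]/= /B mulfK.
have BE : bfps B * (fps_exp 1 - 1) = fpsX.
  apply: fpsP => n; have e := congr1 (fun h : fps R => (h n)%:C) fE.
  cbv beta in e; rewrite (fpsME f) rmorph_sum in e.
  have -> : (fpsX : fps C) n = (fpsX n : R)%:C.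
    have XE (K : comNzRingType) : (fpsX : fps K) n = (n == 1%N)%:R.
      by rewrite -[fpsX]expr1 fpsXnE.
    by rewrite !XE rmorph_nat.
  rewrite (fpsME (bfps B) _ n) -[RHS]e; apply: eq_bigr => i _; rewrite rmorphM Bf; congr (_ * _).
  by rewrite !fpsBE !fps_expE !fps1E !expr1n rmorphB rmorph_nat fmorph_div rmorph1 rmorph_nat.
have rB : conv_radius (1 / 2) (bfps B).
  move=> rho /andP[rho0 rho1]; exists 1 => n; rewrite Bf modulus_real.
  apply: (@le_trans _ _ (2 ^+ n * rho ^+ n)); first by rewrite ler_wpM2r ?exprn_ge0.
  by rewrite -exprMn exprn_ile1 ?mulr_ge0 //; lra.
suff : nbhs (0 : R) (fun x => x != 0 ->
    (series (fun n => B n * x ^+ n / n`!%:R) : nat -> R) @ \oo --> x / (expR x - 1)) by [].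
apply/nbhs_ballP; exists (1 / 2) => /=; first by rewrite divr_gt0.
move=> x; rewrite /ball /= sub0r normrN => xlt x0.
apply/bfpsE.
have xm : modulus x%:C < 1 / 2 by rewrite modulus_real.
have ex : (expR x - 1)%:C != 0 :> C.
  rewrite -(rmorph0 (real_complex R)) (inj_eq (@complexI R)) subr_eq0.
  by apply: contra x0 => /eqP e; rewrite -[x]expRK e ln1.
have ev := evals_toM xm rB (@radius_expm1 _) (evalP xm rB) (@evals_to_expm1 x).
rewrite BE in ev.
have ex2 : fps_eval (bfps B) x%:C * (expR x - 1)%:C = x%:C.
  have := @evals_toXn R 1 x%:C; rewrite !expr1 => ev'.
  exact: cvgC_unique ev ev'.
have -> : (x / (expR x - 1))%:C = fps_eval (bfps B) x%:C.
  apply: (mulIf ex); rewrite ex2 -rmorphM divfK // subr_eq0.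
  by apply: contra x0 => /eqP e; rewrite -[x]expRK e ln1.
exact: evalP xm rB.
Qed.

(** The product takes the value x at all small x > 0, so [fps_eq0] turns the analytic
    characterization into an identity of formal series. *)
Lemma is_bernoulli_formal B : is_bernoulli B -> bfps B * (fps_exp 1 - 1) = fpsX.
Proof.
move=> HB; have : nbhs (0 : R) (fun x => x != 0 ->
    (series (fun n => B n * x ^+ n / n`!%:R) : nat -> R) @ \oo --> x / (expR x - 1)) by [].
move=> /nbhs_ballP[d /= d0 Hd].
have conv x : 0 < x < d -> evals_to (bfps B) x%:C (x / (expR x - 1))%:C.
  move=> /andP[x0 xd]; apply/bfpsE; apply: Hd; last by rewrite gt_eqF.
  by rewrite /ball /= sub0r normrN gtr0_norm.
have d2 : 0 < d / 2 < d by rewrite divr_gt0 //= ltr_pdivrMr // mulr2n mulrDr mulr1 ltrDl.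
have rB : conv_radius (d / 2) (bfps B).
  have := evals_to_radius (conv _ d2); rewrite modulus_real gtr0_norm //.
  by case/andP: d2.
have d20 : 0 < d / 2 by case/andP: d2.
apply/eqP; rewrite -subr_eq0; apply/eqP; apply: (fps_eq0 d20).
  apply: radiusB; first by apply: radiusM => //; exact: radius_expm1.
  by rewrite -[fpsX]expr1; exact: radiusXn.
move=> x /andP[x0 xd].
have xm : modulus x%:C < d / 2 by rewrite modulus_real gtr0_norm.
have xd' : 0 < x < d by rewrite x0 (lt_trans xd) //; case/andP: d2.
have e1 := evals_toM xm rB (@radius_expm1 _) (conv x xd') (@evals_to_expm1 x).
have ex : expR x - 1 != 0.
  rewrite subr_eq0; apply/eqP => e; have := expRK x; rewrite e ln1 => x0'.
  by rewrite -x0' ltxx in x0.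
have e3 : (x / (expR x - 1))%:C * (expR x - 1)%:C = x%:C by rewrite -rmorphM divfK.
rewrite e3 in e1.
have e2 : evals_to (fpsC (-1) * fpsX ^+ 1) x%:C (-1 * x%:C ^+ 1).
  by apply: (evals_toM xm); [exact: radiusC|exact: radiusXn|exact: evals_toC|exact: evals_toXn].
have := evals_toD e1 e2.
by rewrite (rmorphN1 fpsC) !expr1 !mulN1r subrr.
Qed.

Lemma bernoulli_sinh_exists : exists2 g : fps C, g * (cosh2 C 1 - 2) = fpsX ^+ 2 &
  forall k, (0 < k)%N -> (2 * k - 2)`!%:R / 2 * g (2 * k)%N =
    (- (bernoulli_number R (2 * k) / (4 * k)%:R))%:C.
Proof.
pose B := bernoulli_number R.
have HB : is_bernoulli B.
  by have [B' HB'] := is_bernoulli_exists; apply: (xgetPex (fun=> 0)); exists B'.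
have fE := is_bernoulli_formal HB.
exists (bfps B - fpsD (bfps B)); first exact: bernoulli_sinh.
move=> k k0; rewrite fpsBE fpsDerE.
have -> : bfps B (2 * k)%N = (B (2 * k)%N / (2 * k)`!%:R)%:C by [].
rewrite -/B; move: (B _) => b.
have kE : (2 * k = (2 * k - 2).+2)%N by lia.
have fk : (2 * k)`!%:R = (2 * k)%:R * ((2 * k)%:R - 1) * (2 * k - 2)`!%:R :> R.
  have e : (2 * k - 2).+1%:R = (2 * k)%:R - 1 :> R.
    by rewrite -[X in _ - X]/(1%:R) -natrB ?muln_gt0 //; congr (_%:R); lia.
  by rewrite {1}kE !factS -kE (natrM _ (2 * k)%N) (natrM _ (2 * k - 2).+1) e mulrA.
have n1 : (2 * k - 2)`!%:R != 0 :> R by rewrite pnatr_eq0 -lt0n fact_gt0.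
have n2 : k%:R != 0 :> R by rewrite pnatr_eq0 -lt0n.
have n3 : (2 * k)%:R - 1 != 0 :> R by rewrite subr_eq0 (eqr_nat R (2 * k) 1); lia.
have -> : (2 * k - 2)`!%:R / 2 * ((b / (2 * k)`!%:R)%:C - (2 * k)%:R * (b / (2 * k)`!%:R)%:C)
   = ((2 * k - 2)`!%:R / 2 * (b / (2 * k)`!%:R - (2 * k)%:R * (b / (2 * k)`!%:R)))%:C.
  have nC m : m%:R = (m%:R : R)%:C by rewrite rmorph_nat.
  have h2 : (2 : C)^-1 = ((2 : R)^-1)%:C by rewrite fmorphV rmorph_nat.
  by rewrite h2 (nC (2 * k - 2)`!) (nC (2 * k)%N) -!rmorphM -rmorphB -rmorphM.
congr (_%:C); rewrite fk !natrM in n3 *.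
by field; rewrite n1 n2 n3.
Qed.

End Bernoulli.

(** * The theorem *)

Section Representations.
Variable K : numFieldType.
Variables s t n : nat.

Local Notation vec := {ffun 'I_(s + t) -> 'I_(2 * n).+1}.

Let weight (l : 'I_(s + t)) : nat := if (l < s)%N then 1%N else 3%N.

Let expo (y : vec) : nat := (\sum_l weight l * `|(y l)%:Z - n%:Z| ^ 2)%N.

(** The theta series cut to the box of coordinates c - n with 0 <= c <= 2n, which contains every
    representation of n. *)
Let P (w : nat) : fps K := \sum_(c < (2 * n).+1) fpsX ^+ (w * `|c%:Z - n%:Z| ^ 2).

Let P1 : eqfps n.+1 (theta_series K) (P 1).
Proof.
have -> : P 1 = 1 + 2 * \sum_(1 <= s < n.+1) fpsX ^+ (s * s).
  rewrite -theta_square_sum /P big_mkord; apply: eq_bigr => c _.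
  by rewrite mul1n.
exact: theta_truncX.
Qed.

Let P3 : eqfps n.+1 (fps_subst 3 (theta_series K)) (P 3).
Proof.
have -> : P 3 = fps_subst 3 (P 1).
  rewrite /P rmorph_sum; apply: eq_bigr => c _.
  by rewrite rmorphXn /= fps_substX // mul1n exprM.
exact: eqfps_subst.
Qed.

Let product : \prod_(l < s + t) P (weight l) = P 1 ^+ s * P 3 ^+ t.
Proof.
rewrite big_split_ord /=; congr (_ * _).
  rewrite -[in RHS](card_ord s) -prodr_const; apply: eq_bigr => l _.
  by rewrite /weight /= ltn_ord.
rewrite -[in RHS](card_ord t) -prodr_const; apply: eq_bigr => l _.
by rewrite /weight /= ltnNge leq_addr.
Qed.

(** Distributing the product of truncated theta series yields one monomial for each vector of the
    box. *)
Lemma theta_power_coef :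
  (theta_series K ^+ s * fps_subst 3 (theta_series K) ^+ t) n =
  #|[pred y : vec | n == expo y]|%:R.
Proof.
have e : eqfps n.+1 (theta_series K ^+ s * fps_subst 3 (theta_series K) ^+ t)
    (P 1 ^+ s * P 3 ^+ t) by apply: eqfpsM; apply: eqfpsX.
rewrite (e n (ltnSn n)) -product /P bigA_distr_bigA /= fps_sumE -sum1_card natr_sum.
rewrite [RHS]big_mkcond; apply: eq_bigr => y _.
by rewrite -expr_sum fpsXnE inE; case: (_ == _).
Qed.

Let shift (y : vec) : {ffun 'I_(s + t) -> int} := [ffun l => (y l)%:Z - n%:Z].

Let shift_inj : injective shift.
Proof.
move=> y y' /ffunP e; apply/ffunP => l; have := e l; rewrite !ffunE => /addIr [e'].
exact: val_inj.
Qed.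

Let qform (x : {ffun 'I_(s + t) -> int}) : int :=
  \sum_(l < s) x (lshift t l) ^+ 2 + \sum_(l < t) 3 * x (rshift s l) ^+ 2.

Let qformE x : qform x = (\sum_l weight l * `|x l| ^ 2)%N%:Z.
Proof.
have W l : (weight l * `|x l| ^ 2)%N%:R = (weight l)%:Z * x l ^+ 2 :> int.
  by rewrite natz PoszM abszX2.
rewrite -natz natr_sum (eq_bigr _ (fun l _ => W l)) big_split_ord /=.
congr (_ + _); apply: eq_bigr => l _; rewrite /weight /=.
  by rewrite ltn_ord mul1r.
by rewrite ltnNge leq_addr.
Qed.

(** A solution has x_l^2 <= n, hence |x_l| <= n, and the shift by n is a bijection from vectors of
    the box; finiteness of the solution set comes with it. *)
Lemma nb_reprE : nb_repr s t n = #|[pred y : vec | n == expo y]|.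
Proof.
rewrite /nb_repr.
pose Y := enum [pred y : vec | n == expo y].
have shiftE y : qform (shift y) = (expo y)%:Z.
  by rewrite qformE; congr Posz; apply: eq_bigr => l _; rewrite ffunE.
have AE : [set x : {ffun 'I_(s + t) -> int} | n%:Z = qform x]%classic =
    [set` map shift Y]%classic.
  apply/seteqP; split=> x /=.
    move=> xn; have bound l : (`|x l| <= n)%N.
      have h : (`|x l| ^ 2 <= n)%N.
        have nE : n = (\sum_l weight l * `|x l| ^ 2)%N by apply/eqP; rewrite -eqz_nat -qformE -xn.
        rewrite [leqRHS]nE (bigD1 l) //= (leq_trans _ (leq_addr _ _)) // leq_pmull //.
        by rewrite /weight; case: ifP.
      by apply: leq_trans h; rewrite expnS expn1; case: (`|x l|%N) => // m; rewrite leq_pmull.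
    pose y : vec := [ffun l => inord `|(x l + n%:Z)%R|%N].
    have yE : shift y = x.
      apply/ffunP => l; have := bound l; rewrite !ffunE; move: (x l) => z zn.
      have z0 : 0 <= z + n%:Z by lia.
      by rewrite inordK ?gez0_abs ?addrK //; lia.
    apply/mapP; exists y; last by rewrite yE.
    by rewrite mem_enum inE -eqz_nat -shiftE yE -xn.
  by move=> /mapP[y]; rewrite mem_enum inE => /eqP ny ->; rewrite shiftE -ny.
rewrite -/(qform _) AE.
have Yu : uniq (map shift Y) by rewrite map_inj_uniq ?enum_uniq //; exact: shift_inj.
have fin : finite_set [set` map shift Y]%classic by apply: finite_seq.
have : perm_eq (fset_set [set` map shift Y]%classic) (map shift Y).
  apply: uniq_perm => // x.
  by rewrite in_fset_set //; apply/idP/idP => [/set_mem|xY] //; apply: mem_set.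
by move=> /perm_size ->; rewrite size_map -cardE.
Qed.

End Representations.

Lemma nb_repr_coef (K : numFieldType) s t n :
  (nb_repr s t n)%:R = (theta_series K ^+ s * fps_subst 3 (theta_series K) ^+ t) n.
Proof. by rewrite theta_power_coef -nb_reprE. Qed.

Section Main.
Variable R : realType.
Local Notation C := R[i].
Local Notation modulus := (@modulus R).

(** As h is an expansion of f, [xget] returns some expansion; the two agree at real values of the
    nome, hence coefficientwise. *)
Lemma qcoefE (f : C -> C) (h : fps C) : conv_radius 1 h ->
  (forall z, upper_half_plane R z -> f z = fps_eval h (nome z)) ->
  forall n, qcoef f n = h n.
Proof.
move=> rh fh n; pose c := qcoef f.
have ex : is_qexpansion f h.
  by move=> z hz; rewrite fh //; apply: evalP rh; apply: modulus_nome_lt1.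
have cq : is_qexpansion f c by apply: (xgetPex (fun=> 0)); exists (coefs h).
suff e : Fps c - h = 0 by have := congr1 (fun u : fps C => u n) e; rewrite fpsBE => /subr0_eq.
(* Convergence at the single point q = 1/2 bounds the unknown coefficients. *)
have half : 0 < (1 / 2 : R) < 1 by lra.
have [z hz zE] := nome_real half.
have rc : conv_radius (1 / 2) (Fps c).
  have := evals_to_radius (f := Fps c) (cq z hz).
  by rewrite zE modulus_real gtr0_norm //; lra.
have r0 : 0 < (1 / 2 : R) by lra.
have rh' : conv_radius (1 / 2) h by apply: radius_weaken rh; lra.
apply: (fps_eq0 r0); first exact: radiusB.
move=> x /andP[x0 x2].
have x1 : 0 < x < 1 by rewrite x0 /=; lra.
have [w hw wE] := nome_real x1.
have e1 : evals_to (Fps c) x%:C (f w) by rewrite -wE; exact: cq.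
have e2 : evals_to h x%:C (f w) by rewrite -wE; exact: ex.
have xm : modulus x%:C < 1 / 2 by rewrite modulus_real gtr0_norm.
have {}e2 := evals_toM xm (@radiusC _ _ (-1)) rh' (@evals_toC _ (-1) x%:C) e2.
have := evals_toD e1 e2.
by rewrite (rmorphN1 fpsC) !mulN1r subrr.
Qed.

Definition etaC_series (j m : nat) : fps C := fpsX ^+ j *
  (eta_quotient C eta_R * eta_quotient C eta_t ^+ j * eta_quotient C eta_W ^+ m).

Lemma etaC_coefE j m n : etaC_coef R j m n = etaC_series j m n.
Proof.
apply: qcoefE; first exact: radius_etaC.
by move=> z hz; apply: etaC_eval.
Qed.

Lemma etaC_series_lt j m n : (n < j)%N -> etaC_series j m n = 0.
Proof. by move=> lt; rewrite /etaC_series fpsXn_mulE leqNgt lt. Qed.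

Lemma etaC_series_diag j m : etaC_series j m j = 1.
Proof.
rewrite /etaC_series fpsXn_mulE leqnn subnn !fpsM0E !fpsX0E !eta_quotient0E.
by rewrite !expr1n !mulr1.
Qed.

Lemma bcoefE r i k : (bcoef R r i k)%:C = eis_coef (alpha R k)%:C r i k.
Proof.
have eN m : (-1 : C) ^+ m = ((-1 : R) ^+ m)%:C by rewrite rmorphXn rmorphN1.
have eX p m : (p%:R : C) ^+ m = ((p%:R : R) ^+ m)%:C by rewrite rmorphXn rmorph_nat.
have tE m : 1 + (-1 : C) ^+ m = (1 + (-1 : R) ^+ m)%:C by rewrite rmorphD rmorph1 eN.
rewrite /eis_coef; cbv zeta; rewrite !tE !eN (eX 2%N) !(eX 3%N).
rewrite -!rmorphN -!rmorphD -!rmorphM.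
by do 13 (case: r => [|r] //; rewrite -?rmorphN -?rmorphM ?rmorph0 //).
Qed.

Lemma divisors12 : divisors 12 = levels.
Proof. by []. Qed.

End Main.

Section Identity.
Variable R : realType.
Local Notation C := R[i].

(** This is the normalization required by [cusp_identity], with a = alpha_k and c = -B_2k/(4k), and
    it rests on B_2k != 0. *)
Lemma alpha_normalized k (g : fps C) : (1 < k)%N -> g * (cosh2 C 1 - 2) = fpsX ^+ 2 ->
    (2 * k - 2)`!%:R / 2 * g (2 * k)%N =
      (- (bernoulli_number R (2 * k) / (4 * k)%:R))%:C ->
  (alpha R k)%:C * ((2 * k - 2)`!%:R / 2 * g (2 * k)%N) *
    ((2 ^+ (2 * k) - 1) * (3 ^+ (2 * k) - 1)) = 1.
Proof.
move=> k1 gE; have g0 := sinh_even_neq0 erefl gE k1; move=> gB.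
have B0 : bernoulli_number R (2 * k) != 0.
  apply: contraNneq g0 => B0; move: gB; rewrite B0 mul0r oppr0 rmorph0 => /eqP.
  by rewrite !mulf_eq0 invr_eq0 !pnatr_eq0 -leqn0 leqNgt fact_gt0.
rewrite gB /alpha; move: (bernoulli_number _ _) B0 => b b0.
have nz (p : nat) : (1 < p)%N -> (p%:R : R) ^+ (2 * k) - 1 != 0.
  move=> p1; rewrite subr_eq0 gt_eqF // exprn_egt1 ?ltr1n // muln_eq0 negb_or /=.
  by rewrite -lt0n ltnW.
have h2 := nz 2%N isT; have h3 := nz 3%N isT.
have e p : (p%:R : C) ^+ (2 * k) - 1 = ((p%:R : R) ^+ (2 * k) - 1)%:C.
  by rewrite rmorphB rmorph1 rmorphXn rmorph_nat.
rewrite (e 2%N) (e 3%N) -!rmorphM -(rmorph1 (real_complex R)); congr (_%:C).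
move: (_ - 1) (_ - 1) h2 h3 => x y x0 y0.
have k0 : (4 * k)%:R != 0 :> R by rewrite pnatr_eq0 muln_eq0 negb_or /= -lt0n ltnW.
move: (_%:R) k0 => m m0.
by field; rewrite b0 x0 y0 m0.
Qed.

Lemma theta_identity k i : (2 <= k)%N -> (i <= 2 * k)%N -> exists2 g : fps C,
  (2 * k - 2)`!%:R / 2 * g (2 * k)%N =
    (- (bernoulli_number R (2 * k) / (4 * k)%:R))%:C &
  exists y : nat -> C,
  theta_series C ^+ (4 * k - 2 * i) * fps_subst 3 (theta_series C) ^+ (2 * i) =
    \sum_(r <- divisors 12) fpsC (bcoef R r i k)%:C * fps_subst r (eis g k)
    + \sum_(1 <= j < (4 * k - 5).+1) fpsC (y j) * etaC_series R j (2 * k).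
Proof.
move=> k2 hi; have [t [W [L sys]]] := @modular_system_exists C _ (level_p8 C) (level_R0 C) (level_p80 C).
have [g gE gB] := bernoulli_sinh_exists R; have {}gB := gB k (ltnW k2).
exists g => //.
have [y yE] := eis_theta_identity sys erefl gE k2 hi (alpha_normalized k2 gE gB).
exists y; rewrite (@gauss_theta_subst C 3 isT) gauss_theta yE divisors12; congr (_ + _).
by apply: eq_bigr => r _; rewrite bcoefE.
Qed.

Lemma theta_identity_coef (g : fps C) (y : nat -> C) k i j :
    theta_series C ^+ (4 * k - 2 * i) * fps_subst 3 (theta_series C) ^+ (2 * i) =
      \sum_(r <- divisors 12) fpsC (bcoef R r i k)%:C * fps_subst r (eis g k)
      + \sum_(1 <= j < (4 * k - 5).+1) fpsC (y j) * etaC_series R j (2 * k) ->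
    (1 <= j <= 4 * k - 5)%N ->
  y j = (nb_repr (4 * k - 2 * i) (2 * i) j)%:R
    - \sum_(r <- divisors 12) (bcoef R r i k)%:C * (sigma (2 * k - 1) (j%:R / r%:R))%:R
    - \sum_(1 <= l < j) y l * etaC_coef R l (2 * k) j.
Proof.
move=> H /andP[j0 jk]; have := congr1 (fun f : fps C => f j) H.
rewrite -nb_repr_coef fpsDE !fps_sumE => ->.
have -> : \sum_(r <- divisors 12) (fpsC (bcoef R r i k)%:C * fps_subst r (eis g k)) j =
    \sum_(r <- divisors 12) (bcoef R r i k)%:C * (sigma (2 * k - 1) (j%:R / r%:R))%:R.
  rewrite divisors12 big_seq [RHS]big_seq; apply: eq_bigr => r hr.
  have r0 : (0 < r)%N by move: r hr; apply/allP.
  have -> : fps_subst r (eis g k) = fpsC ((2 * k - 2)`!%:R / 2 * g (2 * k)%N) +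
      fps_subst r (sigmaq C (2 * k - 1)).
    by rewrite -[X in X + _](fps_substC r) -rmorphD.
  rewrite fpsC_mulE sigma_div // fpsDE fpsCE.
  by case: j j0 {jk H} => // j _; rewrite add0r.
have -> : \sum_(1 <= l < (4 * k - 5).+1) (fpsC (y l) * etaC_series R l (2 * k)) j =
    \sum_(1 <= l < j) y l * etaC_coef R l (2 * k) j + y j.
  rewrite (@big_cat_nat _ _ _ j.+1) // (@big_nat_recr _ _ _ j 1) //.
  rewrite -![Monoid.Law.sort _ _ _]/(_ + _).
  rewrite [X in _ + X]big1_seq ?addr0.
    rewrite (fpsC_mulE (y j)) etaC_series_diag mulr1; congr (_ + _).
    by apply: eq_bigr => l _; rewrite fpsC_mulE etaC_coefE.
  move=> l /andP[_]; rewrite mem_index_iota => /andP[jl _].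
  by rewrite fpsC_mulE etaC_series_lt // mulr0.
move: (\sum_(r <- _) _) (\sum_(1 <= l < j) _) (y j) => A S b; ring.
Qed.

End Identity.
Unset Implicit Arguments.
Theorem theorem2p2 (R : realType) (k i : nat)
    (hk : (2 <= k)%N) (hi : (i <= 2 * k)%N)
    (a : nat -> R[i])
    (ha : forall j : nat, (1 <= j <= 4 * k - 5)%N ->
      a j = (nb_repr (4 * k - 2 * i) (2 * i) j)%:R
            - \sum_(r <- divisors 12)
                (bcoef R r i k)%:C * (sigma (2 * k - 1) (j%:R / r%:R))%:R
            - \sum_(1 <= l < j) a l * etaC_coef R l (2 * k) j)
    (z : R[i]) (hz : upper_half_plane R z) :
  theta z ^+ (4 * k - 2 * i) * theta (3 * z) ^+ (2 * i) =
    \sum_(r <- divisors 12) (bcoef R r i k)%:C * eisenstein k (r%:R * z)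
    + \sum_(1 <= j < (4 * k - 5).+1) a j * etaC j%:Z (2 * k)%:Z z.
Proof.
have [g gB [y H]] := @theta_identity R k i hk hi.
(* The recursion determines its solution on this range, and the coefficients of the formal identity
   satisfy it. *)
have ay j : (1 <= j <= 4 * k - 5)%N -> a j = y j.
  elim/ltn_ind: j => j IH hj; rewrite (ha j hj) (theta_identity_coef H hj); congr (_ - _).
  apply: eq_big_nat => l /andP[l0 lj]; rewrite IH // l0.
  by case/andP: hj => _; apply: leq_trans (ltnW lj).
have x1 := modulus_nome_lt1 hz.
have hz3 : upper_half_plane R (3 * z) := upper_half_plane_natM (isT : (0 < 3)%N) hz.
have rth : conv_radius 1 (theta_series R[i]) by rewrite gauss_theta; apply: radius_eta.
have rth3 : conv_radius 1 (fps_subst 3 (theta_series R[i])) by apply: radius_subst.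
have E3 : theta (3 * z) = fps_eval (fps_subst 3 (theta_series R[i])) (nome z).
  by rewrite (theta_eval hz3) (nomeX z 3) (eval_subst x1).
rewrite (theta_eval hz) E3 -(evalX x1 _ rth) -(evalX x1 _ rth3).
rewrite -(evalM x1 (radiusX _ rth) (radiusX _ rth3)) H.
have re r : r \in divisors 12 -> conv_radius 1 (fpsC (bcoef R r i k)%:C * fps_subst r (eis g k)).
  rewrite divisors12 => hr; have r0 : (0 < r)%N by move: r hr; apply/allP.
  apply: radiusM; first exact: radiusC.
  by apply: radius_subst r0 _; apply: radiusD; [exact: radiusC|exact: radius_sigmaq].
have rC j : conv_radius 1 (fpsC (y j) * etaC_series R j (2 * k)).
  by apply: radiusM; [exact: radiusC|exact: radius_etaC].
rewrite (evalD x1 (radius_sum re) (radius_sum (fun j _ => rC j))).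
rewrite (eval_sum x1 re) (eval_sum x1 (fun j _ => rC j)); congr (_ + _).
  rewrite divisors12 big_seq [RHS]big_seq; apply: eq_bigr => r hr.
  have r0 : (0 < r)%N by move: r hr; apply/allP.
  have rs : conv_radius 1 (fps_subst r (eis g k)).
    by apply: radius_subst r0 _; apply: radiusD; [exact: radiusC|exact: radius_sigmaq].
  by rewrite (evalM x1 (@radiusC R 1 _) rs) (evalC (nome z)) (eisenstein_eval r0 hz gB).
apply: eq_big_nat => j hj; rewrite (evalM x1 (@radiusC R 1 _) (@radius_etaC R j (2 * k))).
by rewrite (evalC (nome z)) (etaC_eval _ _ hz) ay.
Qed.
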